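(* Let $(M,\eta)$ be a $(2k+1)$-dimensional closed connected regular contact manifold. Then $$|\pi_1(\mathrm{Diff}_{\eta,\mathrm{str}}(M))|=\infty .$$ In particular, the homotopy class of the Reeb flow in $\pi_1(\mathrm{Diff}_{\eta,\mathrm{str}}(M))$ has infinite order.
   Context: A contact manifold $(M^{2k+1},\eta)$ is a manifold with a one-form $\eta$ such that $\eta\wedge(d\eta)^k$ is nowhere zero. Its Reeb (characteristic) vector field $\xi$ is defined by $\eta(\xi)=1$, $d\eta(\xi,\cdot)=0$. In this paper $(M,\eta)$ is called regular if the flow of $\xi$ through any point of $M$ is periodic (all orbits of $\xi$ are closed). $\mathrm{Diff}_{\eta,\mathrm{str}}(M)=\{\phi\in\mathrm{Diff}(M):\phi^*\eta=\eta\}$ is the group of strict contactomorphisms, with the topology induced from $\mathrm{Diff}(M)$ (e.g. the $C^\infty$ topology); $\pi_1$ is based at the identity. Let $\psi_t$ be the flow of $\xi$. For $M$ closed, connected and regular there is, by Wadsley's theorem, $N>0$ with $\psi_N=\mathrm{id}$; ''the homotopy class of the Reeb flow'' is the class of the loop $S^1=\mathbb R/2\pi\mathbb Z\to\mathrm{Diff}_{\eta,\mathrm{str}}(M)$, $\theta\mapsto\psi_{N\theta/2\pi}$. *)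

(* Defs.v *)
From HB Require Import structures.
From mathcomp Require Import all_boot all_order all_algebra all_fingroup.
From mathcomp Require Import all_classical all_reals all_analysis.
Set Implicit Arguments.
Unset Strict Implicit.
Unset Printing Implicit Defensive.
Import Order.TTheory GRing.Theory Num.Theory.
Import numFieldNormedType.Exports.
Local Open Scope classical_set_scope.
Local Open Scope ring_scope.

(** * Smooth maps between open subsets of normed spaces *)

Section smooth.
Context {R : realType} {n : nat} {W : normedModType R}.

Definition pderiv (s : seq 'I_n) (f : 'rV[R]_n -> W) : 'rV[R]_n -> W :=
  foldr (fun i g => 'D_(delta_mx 0 i) g) f s.

(* Meaningful for open U, where each iterated partial derivative at a point
   depends only on the germ of f; the values of f off U are irrelevant. *)
Definition smooth_on (U : set 'rV[R]_n) (f : 'rV[R]_n -> W) : Prop :=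
  forall (s : seq 'I_n) (x : 'rV[R]_n), U x ->
    {for x, continuous (pderiv s f)} /\
    forall i : 'I_n, derivable (pderiv s f) x (delta_mx 0 i).

End smooth.

(** * Smooth manifolds *)

(* Charts and their inverses are total functions, whose values outside
   chart_dom and chart_img are irrelevant. *)
Record smooth_atlas (R : realType) (n : nat) (M : topologicalType) :=
  SmoothAtlas {
    chart_index : Type;
    chart_dom : chart_index -> set M;
    chart_img : chart_index -> set 'rV[R]_n;
    chart : chart_index -> M -> 'rV[R]_n;
    chart_inv : chart_index -> 'rV[R]_n -> M;
    chart_dom_open : forall i, open (chart_dom i);
    chart_img_open : forall i, open (chart_img i);
    chart_in : forall i p, chart_dom i p -> chart_img i (chart i p);
    chart_inv_in : forall i x, chart_img i x -> chart_dom i (chart_inv i x);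
    chartK : forall i p, chart_dom i p -> chart_inv i (chart i p) = p;
    chart_invK : forall i x, chart_img i x -> chart i (chart_inv i x) = x;
    chart_cts : forall i p, chart_dom i p -> {for p, continuous (chart i)};
    chart_inv_cts : forall i x, chart_img i x ->
      {for x, continuous (chart_inv i)};
    chart_cover : forall p, exists i, chart_dom i p;
    chart_compat : forall i j,
      smooth_on [set x | chart_img i x /\ chart_dom j (chart_inv i x)]
        (fun x => chart j (chart_inv i x))
  }.

(* The topological conditions on a closed (compact, without boundary)
   connected manifold, in addition to a smooth atlas modelled on R^n.  The
   library's [connected] holds of the empty set, hence the first clause. *)
Definition closed_connected (M : topologicalType) : Prop :=
  [/\ [set: M] !=set0, hausdorff_space M, @second_countable M,
      compact [set: M] & connected [set: M]].

Section manifold.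
Context {R : realType} {n : nat} {M : topologicalType}.
Variable A : smooth_atlas R n M.
Implicit Types (i j : chart_index A) (f : M -> M).

Definition loc f i j (x : 'rV[R]_n) : 'rV[R]_n := chart j (f (chart_inv i x)).

Definition locdom f i j : set 'rV[R]_n :=
  [set x | chart_img i x /\ chart_dom j (f (chart_inv i x))].

Definition smooth_map f : Prop :=
  continuous f /\ forall i j, smooth_on (locdom f i j) (loc f i j).

Definition is_diffeo f : Prop :=
  smooth_map f /\ exists g, [/\ smooth_map g, cancel f g & cancel g f].

Record diffeo := Diffeo { diffeo_fun :> M -> M; _ : is_diffeo diffeo_fun }.

Lemma is_diffeo_id : is_diffeo id.
Proof.
have smooth_id : smooth_map id.
  by split=> [x|i j]; [exact: cvg_id | exact: chart_compat].
by split=> //; exists id; split.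
Qed.

Definition diffeo_id : diffeo := Diffeo is_diffeo_id.

(** ** The C^oo topology on the diffeomorphism group *)

(* The subbasic sets N(f; i, j, K, e) of the (weak = strong, when M is
   compact) C^oo topology: maps f and g are compared in charts i and j,
   uniformly over a compact set K, one iterated partial derivative at a time. *)
Definition Coo_nbhd f i j (K : set 'rV[R]_n) (s : seq 'I_n) (e : R) :
    set diffeo :=
  [set g : diffeo | K `<=` locdom g i j /\
    forall x, K x -> `|pderiv s (loc g i j) x - pderiv s (loc f i j) x| < e].

Definition Coo_subbase : set (set diffeo) :=
  [set B | exists f i j K s e,
    [/\ smooth_map f, compact K, K `<=` locdom f i j, 0 < e
      & B = Coo_nbhd f i j K s e]].

HB.instance Definition _ := gen_eqMixin diffeo.
HB.instance Definition _ := gen_choiceMixin diffeo.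
HB.instance Definition _ :=
  @isSubBaseTopological.Build diffeo (set diffeo) Coo_subbase id.

(** ** Vector fields and one-forms, through their local representatives *)

Record vector_field := VectorField {
  vf_loc : chart_index A -> 'rV[R]_n -> 'rV[R]_n;
  vf_smooth : forall i, smooth_on (chart_img i) (vf_loc i);
  vf_compat : forall i j x, locdom id i j x ->
    'D_(vf_loc i x) (loc id i j) x = vf_loc j (loc id i j x)
}.

(* A covector is the column of its coefficients. *)
Definition pairing (a : 'cV[R]_n) (v : 'rV[R]_n) : R := (v *m a) 0 0.

(* [pulls_back f a b] states f^* b = a for local representatives a, b. *)
Definition pulls_back f (a b : chart_index A -> 'rV[R]_n -> 'cV[R]_n) : Prop :=
  forall i j x (v : 'rV[R]_n), locdom f i j x ->
    pairing (b j (loc f i j x)) ('D_v (loc f i j) x) = pairing (a i x) v.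

Record one_form := OneForm {
  of_loc : chart_index A -> 'rV[R]_n -> 'cV[R]_n;
  of_smooth : forall i, smooth_on (chart_img i) (of_loc i);
  of_compat : pulls_back id of_loc of_loc
}.

End manifold.

(** * Alternating forms on a vector space, as functions of p vectors *)

Section exterior.
Context {R : realType} {V : Type}.

Definition pform (p : nat) := ('I_p -> V) -> R.

Definition wedge p q (a : pform p) (b : pform q) : pform (p + q) := fun v =>
  ((p`! * q`!)%N%:R)^-1 * \sum_(s : 'S_(p + q)) (-1) ^+ s *
    (a (fun i => v (s (lshift q i))) * b (fun j => v (s (rshift p j)))).

Fixpoint wedge_pow p (a : pform p) (k : nat) : pform (k * p) :=
  match k return pform (k * p) with
  | 0 => fun=> 1
  | k'.+1 => wedge a (@wedge_pow p a k')
  end.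

End exterior.
Arguments wedge_pow {R V p} a k.

(** * Contact geometry *)

Section contact.
Context {R : realType} {n : nat} {M : topologicalType}.
Variable A : smooth_atlas R n M.
Implicit Types (eta : one_form A) (xi : vector_field A) (psi : R -> M -> M).

Definition form_at eta (i : chart_index A) (x : 'rV[R]_n) :
    @pform R 'rV[R]_n 1 := fun v => pairing (of_loc eta i x) (v ord0).

(* d eta (v, w) = v (eta w) - w (eta v) for constant fields v and w. *)
Definition ext_deriv eta (i : chart_index A) (x v w : 'rV[R]_n) : R :=
  'D_v (fun y => pairing (of_loc eta i y) w) x
  - 'D_w (fun y => pairing (of_loc eta i y) v) x.

Definition dform_at eta (i : chart_index A) (x : 'rV[R]_n) :
    @pform R 'rV[R]_n 2 := fun v => ext_deriv eta i x (v ord0) (v ord_max).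

(* eta /\ (d eta)^k is nowhere zero *)
Definition contact (k : nat) eta : Prop :=
  forall (i : chart_index A) x, chart_img i x ->
    exists v, wedge (form_at eta i x) (wedge_pow (dform_at eta i x) k) v != 0.

Definition is_reeb eta xi : Prop :=
  forall (i : chart_index A) x, chart_img i x ->
    pairing (of_loc eta i x) (vf_loc xi i x) = 1 /\
    forall v, ext_deriv eta i x (vf_loc xi i x) v = 0.

(* The chart expression of (t, p) |-> psi t p on R x R^n = R^(1+n). *)
Definition flow_loc psi (i j : chart_index A) (y : 'rV[R]_(1 + n)) :
  'rV[R]_n := chart j (psi (lsubmx y 0 0) (chart_inv i (rsubmx y))).

Definition flow_locdom psi (i j : chart_index A) : set 'rV[R]_(1 + n) :=
  [set y | chart_img i (rsubmx y) /\
           chart_dom j (psi (lsubmx y 0 0) (chart_inv i (rsubmx y)))].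

(* A smooth action of R whose orbit maps are the integral curves of xi. *)
Record is_flow xi psi : Prop := IsFlow {
  flow0 : forall p, psi 0 p = p;
  flowD : forall s t p, psi (s + t) p = psi s (psi t p);
  flow_cts : continuous (fun z : R * M => psi z.1 z.2);
  flow_smooth : forall i j, smooth_on (flow_locdom psi i j) (flow_loc psi i j);
  flow_integral : forall p t (i : chart_index A), chart_dom i (psi t p) ->
    is_derive t 1 (fun s : R => chart i (psi s p))
      (vf_loc xi i (chart i (psi t p)))
}.

Definition regular psi : Prop := forall p, exists2 T, 0 < T & psi T p = p.

(* Strict contactomorphisms; as a type (via [set_type]) this set carries the
   topology induced from [diffeo A]. *)
Definition diff_str eta : set (diffeo A) :=
  [set f : diffeo A | pulls_back f (of_loc eta) (of_loc eta)].

Lemma diff_str_id eta : diffeo_id A \in diff_str eta.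
Proof. by rewrite inE; exact: of_compat. Qed.

Definition id_str eta : diff_str eta := exist _ (diffeo_id A) (diff_str_id eta).

End contact.

(** * The fundamental group *)

(* Loops and homotopies are total functions, of which only the restrictions
   to [0, 1] and to [0, 1] x [0, 1] matter.  Elements of the fundamental group
   are homotopy classes, i.e. sets of loops. *)
Section fundamental_group.
Context {R : realType} {X : topologicalType}.
Variable x0 : X.
Implicit Types (f g h : R -> X) (a b : set (R -> X)).

Definition is_loop f : Prop :=
  [/\ {within `[0, 1], continuous f}, f 0 = x0 & f 1 = x0].

Definition homotopic f g : Prop :=
  exists H : R * R -> X,
    {within `[0, 1] `*` `[0, 1], continuous H} /\
    forall t, 0 <= t <= 1 ->
      [/\ H (t, 0) = f t, H (t, 1) = g t, H (0, t) = x0 & H (1, t) = x0].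

Definition loop_class f : set (R -> X) :=
  [set g | is_loop g /\ homotopic f g].

Definition pi1 : set (set (R -> X)) := loop_class @` [set f | is_loop f].

Definition loop_concat f g : R -> X := fun t =>
  if t <= 2^-1 then f (2 * t) else g (2 * t - 1).

Definition pi1_one : set (R -> X) := loop_class (fun=> x0).

(* [f] * [g] is the class of the concatenation of f and g. *)
Definition pi1_mul a b : set (R -> X) :=
  [set h | is_loop h /\
    exists f g, [/\ a f, b g & homotopic (loop_concat f g) h]].

Definition pi1_pow a (m : nat) : set (R -> X) := iter m (pi1_mul a) pi1_one.

Definition infinite_order a : Prop :=
  forall m : nat, (0 < m)%N -> pi1_pow a m <> pi1_one.

End fundamental_group.

(* theta = 2 pi t turns the loop theta |-> psi_(N theta / 2 pi) on R / 2 pi Z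
   into t |-> psi_(N t) on [0, 1]. *)
Definition is_reeb_loop (R : realType) (n : nat) (M : topologicalType)
    (A : smooth_atlas R n M) (eta : one_form A) (psi : R -> M -> M) (N : R)
    (c : R -> diff_str eta) : Prop :=
  is_loop (id_str eta) c /\ forall t, set_val (c t) = psi (N * t) :> (M -> M).

(* Main.v *)
(* Let [psi] be the Reeb flow.  It preserves [eta]; applying [eta] to the
   linearization of [psi t y = y] shows that periods are stationary to first
   order, and a Baire category argument on the set of points near which no
   [psi t], [t > 0], is the identity shows that this set is empty.  As [M] is
   connected, some [psi N], [N > 0], is the identity (Wadsley's theorem).

   A strict contactomorphism preserves the Reeb vector field, hence commutes
   with [psi].  If the [m]-th power of the Reeb loop were null-homotopic with
   [m > 0], there would be continuous maps [H x y] of [M], for [x, y] in [0, 1],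
   commuting with [psi], with [H x 0 = psi (N m x)], and equal to the identity
   on the other three sides of the square.  For a suitable weight [l > 0], there
   are finitely many functions [s_1, ..., s_L] from [M] to the plane, without
   common zero, that [psi t] multiplies by [exp (2 pi i l t / N)].  Then
     (x_1, y_1, ..., x_L, y_L) |-> s_r (H x_1 y_1 (... (H x_L y_L p0)))
   is a section of a line bundle on the product of [L] two-dimensional tori, of
   degree [+- l m] on each factor.  Since these [L] sections have no common zero,
   the [L]-th power of the Chern class of this bundle vanishes; but it is
   [L! (+- l m)^L] times the fundamental class.  This computation is carried out
   on a fine Kuhn triangulation, where the functions equivariant under
   [psi (N / n)] alone suffice, angles between the values of a section at the
   ends of an edge give connection forms, and Stokes' formula is elementary.
   The same argument distinguishes the classes of the powers of the Reeb loop. *)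

Require Import Defs.
From mathcomp Require Import all_boot all_order all_algebra all_fingroup.
From mathcomp Require Import all_classical all_reals all_analysis.
From mathcomp Require Import ring lra zify.
Set Implicit Arguments.
Unset Strict Implicit.
Unset Printing Implicit Defensive.
Import Order.TTheory GRing.Theory Num.Theory.
Import numFieldNormedType.Exports.
Local Open Scope classical_set_scope.
Local Open Scope ring_scope.

(** * Strict differentiability *)

(** Orbits of shorter period force the weight [l]: a function that [psi t] multiplies by
    [exp (2 pi i l t / N)] vanishes wherever this factor is not 1 at some period of the point, so
    [l] must clear the denominators of all the periods. A single torus would not do: two sections of
    a nontrivial line bundle on a surface may have no common zero, and compactness of [M] gives no
    control on the number [L] of functions. With one torus for each function, the [L]-th power of
    the Chern class has top degree; commutation with the flow lets the factor picked up on a side of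
    one square pass through the other maps [H]. Of the homotopy, only joint continuity and
    commutation with the flow are kept, so smoothness serves mainly the common period and the
    commutation itself. There, derivatives are taken in the strict sense, which compares two
    arbitrary points near the centre: periodic points have to be compared with one another, and not
    only with the centre. *)

Section line.
Context {R : realType} {V W : normedModType R}.

Lemma is_derive_line (f : V -> W) (u v : V) (s : R) (D : W) :
  is_derive (u + s *: v) v f D -> is_derive s 1 (fun s => f (u + s *: v)) D.
Proof.
move=> [df Df].
have E : (fun h => h^-1 *: (f (u + (h *: 1 + s) *: v) - f (u + s *: v))) =
         (fun h => h^-1 *: (f (h *: v + (u + s *: v)) - f (u + s *: v))).
  by apply/funext => h; rewrite scalerDl addrCA /= [h *: 1]mulr1.
by split; rewrite /derivable /derive /= ?E.
Qed.

End line.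

Section mvt_line.
Context {R : realType} {V : normedModType R}.

Lemma mvt_line (f : V -> R) (u v : V) (c a e : R) :
  (forall s : R, `|s| <= `|c| -> derivable f (u + s *: v) v /\ `|'D_v f (u + s *: v) - a| <= e) ->
  `|f (u + c *: v) - f u - c * a| <= e * `|c|.
Proof.
move=> H; pose g (s : R) := f (u + s *: v).
have dg (s : R) : `|s| <= `|c| -> is_derive s 1 g ('D_v f (u + s *: v)).
  by move=> /H [df _]; apply: is_derive_line; exact: derivableP.
have ct (lo hi : R) : (forall s, s \in `[lo, hi] -> `|s| <= `|c|) ->
    {within `[lo, hi], continuous g}.
  move=> sc; apply: derivable_within_continuous => s /sc /dg ds.
  exact: ex_derive.
suff [s [sc E]] : exists s : R, `|s| <= `|c| /\ g c - g 0 = 'D_v f (u + s *: v) * c.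
  have -> : f u = g 0 by rewrite /g scale0r addr0.
  rewrite -/(g c) E mulrC -mulrBr normrM mulrC ler_wpM2r //.
  exact: (H s sc).2.
have [c0|c0] := leP 0 c.
  have sc (s : R) : s \in `[0, c] -> `|s| <= `|c|.
    by rewrite in_itv /= => /andP[s0 sc]; rewrite !ger0_norm.
  have [x xc E] := MVT_segment c0 (fun x xin => dg x (sc x (subset_itv_oo_cc xin))) (ct _ _ sc).
  by exists x; split; [exact: sc | rewrite E subr0].
have sc (s : R) : s \in `[c, 0] -> `|s| <= `|c|.
  by rewrite in_itv /= => /andP[cs s0]; rewrite !ler0_norm ?lerN2 // ltW.
have [x xc E] := MVT_segment (ltW c0) (fun x xin => dg x (sc x (subset_itv_oo_cc xin))) (ct _ _ sc).
exists x; split; first exact: sc.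
by rewrite -[LHS]opprB E sub0r mulrN opprK.
Qed.

End mvt_line.

Section mvt.
Context {R : realType} {n : nat}.
Implicit Types f : 'rV[R]_n -> R.

Lemma rV_norm_coord (x : 'rV[R]_n) i : `|x 0 i| <= `|x|.
Proof.
rewrite [leRHS]/Num.Def.normr/= mx_normrE.
exact: (le_bigmax _ (fun i : 'I_1 * 'I_n => `|x i.1 i.2|) (0, i)).
Qed.

Lemma rV_norm_le (x : 'rV[R]_n) e : 0 <= e -> (forall i, `|x 0 i| <= e) -> `|x| <= e.
Proof.
move=> e0 H; rewrite [leLHS]/Num.Def.normr/= mx_normrE.
by apply: bigmax_le => // -[i j] _ /=; rewrite ord1.
Qed.

Lemma rV_norm_lt (x : 'rV[R]_n) e : 0 < e -> (forall i, `|x 0 i| < e) -> `|x| < e.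
Proof.
move=> e0 H; rewrite [ltLHS]/Num.Def.normr/= mx_normrE.
by apply: bigmax_lt => // -[i j] _ /=; rewrite ord1.
Qed.

Lemma sdiff_real f (x : 'rV[R]_n) (a : 'I_n -> R) (d e : R) :
  (forall y i, `|y - x| < d -> derivable f y (delta_mx 0 i) /\
     `|'D_(delta_mx 0 i) f y - a i| <= e) ->
  forall y z, `|y - x| < d / 3 -> `|z - x| < d / 3 ->
  `|f y - f z - \sum_i (y - z) 0 i * a i| <= n%:R * e * `|y - z|.
Proof.
move=> H y z yx zx.
have d0 : 0 < d by have := normr_ge0 (y - x); lra.
have e0 (i : 'I_n) : 0 <= e.
  have [|_] := H x i; first by rewrite subrr normr0.
  by apply: le_trans.
(* The passage from [z] to [y] changes one coordinate at a time, through the points [w k]. As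
   [mvt_line] asks for parameters of both signs, up to [|y 0 k - z 0 k| < 2 d / 3], starting within
   [d / 3] of [x] keeps all points in the ball of radius [d]. *)
pose w k : 'rV[R]_n := \row_i (if (i < k)%N then y 0 i else z 0 i).
have wS (k : 'I_n) : w k.+1 = w k + (y 0 k - z 0 k) *: delta_mx 0 k.
  apply/rowP => i; rewrite !mxE ltnS leq_eqVlt eqxx /=.
  have [->|ik] := eqVneq i k; first by rewrite eqxx ltnn mulr1 subrKC.
  by rewrite -val_eqE in ik; rewrite (negPf ik) mulr0 addr0.
have w0 : w 0 = z by apply/rowP => i; rewrite mxE.
have wn : w n = y by apply/rowP => i; rewrite mxE ltn_ord.
have -> : f y - f z = \sum_(k < n) (f (w k.+1) - f (w k)).
  by rewrite -(big_mkord xpredT (fun k => f (w k.+1) - f (w k))) telescope_sumr // w0 wn.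
rewrite -sumrB (le_trans (ler_norm_sum _ _ _)) //.
have -> : n%:R * e * `|y - z| = \sum_(k < n) e * `|y - z|.
  by rewrite sumr_const card_ord mulr_natl -mulrnAl.
apply: ler_sum => k _; rewrite wS !mxE.
apply: (@le_trans _ _ (e * `|y 0 k - z 0 k|)); last first.
  rewrite ler_wpM2l ?(e0 k) //.
  by have := rV_norm_coord (y - z) k; rewrite !mxE.
apply: mvt_line => s sc; apply: H.
apply: rV_norm_lt => // i; rewrite !mxE.
have yi := rV_norm_coord (y - x) i; have zi := rV_norm_coord (z - x) i.
rewrite !mxE in yi zi.
have [ki|ki] := eqVneq k i; rewrite -?ki ?eqxx /=.
  clear e0; rewrite ltnn; subst i.
  have -> : z 0 k + s * 1 - x 0 k = z 0 k - x 0 k + s by ring.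
  have := ler_normD (z 0 k - x 0 k) s.
  have := ler_normB (y 0 k - x 0 k) (z 0 k - x 0 k).
  have -> : y 0 k - x 0 k - (z 0 k - x 0 k) = y 0 k - z 0 k by ring.
  lra.
rewrite mulr0 addr0; clear e0; case: ifP => _; lra.
Qed.

End mvt.

Lemma cts_norm (R : realType) (V W : normedModType R) (f : V -> W) (x : V) :
  {for x, continuous f} <-> forall e, 0 < e -> exists2 d, 0 < d & forall y, `|y - x| < d -> `|f y - f x| < e.
Proof.
split=> [fx e e0|H].
  move/cvgrPdist_lt : fx => /(_ _ e0) /nbhs_normP[d /= d0 H].
  exists d => // y yx; rewrite distrC; apply: H; by rewrite /ball_ /= distrC.
apply/cvgrPdist_lt => e /H[d d0 {}H].
apply/nbhs_normP; exists d => //= y; rewrite /ball_ /= distrC => /H; by rewrite distrC.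
Qed.

Section sdiff.
Context {R : realType} {n : nat} {W : normedModType R}.
Implicit Types (f g : 'rV[R]_n -> W) (x v : 'rV[R]_n) (D : 'I_n -> W).

Definition lincomb D v : W := \sum_i v 0 i *: D i.

Lemma lincombD D u v : lincomb D (u + v) = lincomb D u + lincomb D v.
Proof. by rewrite -big_split; apply: eq_bigr => i _; rewrite mxE scalerDl. Qed.

Lemma lincombZ D c v : lincomb D (c *: v) = c *: lincomb D v.
Proof. by rewrite scaler_sumr; apply: eq_bigr => i _; rewrite mxE scalerA. Qed.

Lemma lincombB D u v : lincomb D (u - v) = lincomb D u - lincomb D v.
Proof. by rewrite lincombD -scaleN1r lincombZ scaleN1r. Qed.

Lemma lincomb_delta D i : lincomb D (delta_mx 0 i) = D i.
Proof.
rewrite /lincomb (bigD1 i) //= big1 ?addr0 => [|j ji]; rewrite mxE eqxx /=.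
  by rewrite eqxx scale1r.
by rewrite (negPf ji) scale0r.
Qed.

Lemma lincomb_bound D : exists2 C, 0 < C & forall v, `|lincomb D v| <= C * `|v|.
Proof.
exists (1 + \sum_i `|D i|) => [|v]; first by rewrite ltr_wpDr // sumr_ge0.
rewrite mulrDl mul1r; apply: (le_trans (ler_norm_sum _ _ _)).
rewrite ler_wpDl // mulr_suml; apply: ler_sum => i _.
by rewrite normrZ mulrC ler_wpM2l // rV_norm_coord.
Qed.

(* Strict differentiability at [x]. *)
Definition sdiff f x D := forall e, 0 < e -> exists2 d, 0 < d &
  forall y z, `|y - x| < d -> `|z - x| < d ->
  `|f y - f z - lincomb D (y - z)| <= e * `|y - z|.

Lemma sdiff_near f g x D : (\forall y \near x, f y = g y) -> sdiff f x D ->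
  sdiff g x D.
Proof.
move=> /nbhs_normP[d0 /= d00 fg] H e /H[d d1 {}H].
exists (Num.min d d0) => [|y z]; first by rewrite lt_min d1.
rewrite !lt_min => /andP[yd yd0] /andP[zd zd0].
by rewrite -!fg ?H //= distrC.
Qed.

Lemma sdiff_is_derive f x D v : sdiff f x D -> is_derive x v f (lincomb D v).
Proof.
move=> H.
have L : (fun h => h^-1 *: (f (h *: v + x) - f x)) @ 0^' --> lincomb D v.
  apply/cvgrPdist_le => e e0.
  pose e' := e / (1 + `|v|); have v0 : 0 < 1 + `|v| by rewrite ltr_wpDr.
  have [d d0 {}H] := H e' (divr_gt0 e0 v0).
  near=> h.
  have h0 : h != 0 by near: h; exact: nbhs_dnbhs_neq.
  rewrite -[lincomb D v](scalerK h0) -scalerBr normrZ -lincombZ.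
  rewrite normfV ler_pdivrMl ?normr_gt0 // distrC.
  have := H (h *: v + x) x; rewrite addrK subrr normr0 => /(_ _ d0) H'.
  apply: (le_trans (H' _)).
    rewrite normrZ.
    apply: (@le_lt_trans _ _ (`|h| * (1 + `|v|))).
      by rewrite ler_wpM2l // lerDr.
    rewrite -ltr_pdivlMr //; near: h.
    by apply: dnbhs0_lt; rewrite divr_gt0.
  rewrite normrZ mulrCA ler_wpM2l // /e' mulrAC ler_pdivrMr //.
  by rewrite ler_wpM2l ?lerDr // ltW.
split; first by apply/cvg_ex; exists (lincomb D v).
exact: cvg_lim.
Unshelve. all: by end_near. Qed.

Lemma sdiff_derive f x D v : sdiff f x D -> 'D_v f x = lincomb D v.
Proof. by move=> /(@sdiff_is_derive _ _ _ v) H; exact: derive_val. Qed.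

Lemma sdiff_lipschitz f x D : sdiff f x D -> exists C d, [/\ 0 < C, 0 < d &
  forall y z, `|y - x| < d -> `|z - x| < d -> `|f y - f z| <= C * `|y - z|].
Proof.
move=> /(_ 1 ltr01)[d d0 H]; have [C C0 HC] := lincomb_bound D.
exists (1 + C), d; split=> // [|y z yd zd]; first by rewrite addr_gt0.
rewrite -[f y - f z](subrK (lincomb D (y - z))) mulrDl.
by apply: le_trans (ler_normD _ _) _; rewrite lerD // H.
Qed.

Lemma sdiff_curve f (c : R -> 'rV[R]_n) (t : R) D c' : is_derive t 1 c c' ->
  sdiff f (c t) D -> is_derive t 1 (f \o c) (lincomb D c').
Proof.
move=> dc H.
have ct : {for t, continuous c}.
  exact/differentiable_continuous/derivable1_diffP.
have cc : (fun h : R => h^-1 *: (c (h *: 1 + t) - c t)) @ 0^' --> c'.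
  by case: dc => dc <-; exact: dc.
have [K K0 HK] := lincomb_bound D.
have st : (fun h : R => h *: 1 + t) @ 0^' --> t.
  apply: cvg_within_filter.
  have {2}-> : t = 0 *: 1 + t by rewrite scale0r add0r.
  apply: cvgD; [apply: cvgZl; exact: cvg_id | exact: cvg_cst].
have L : (fun h : R => h^-1 *: ((f \o c) (h *: 1 + t) - (f \o c) t)) @ 0^' --> lincomb D c'.
  apply/cvgrPdist_le => e e0 /=.
  have c'0 : 0 < 2 * (2 + `|c'|) by rewrite mulr_gt0 // ltr_wpDr.
  have [d d0 {}H] := H (e / (2 * (2 + `|c'|))) (divr_gt0 e0 c'0).
  near=> h.
  have h0 : h != 0 by near: h; exact: nbhs_dnbhs_neq.
  set q := h^-1 *: (c (h *: 1 + t) - c t).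
  have qc : `|c' - q| <= Num.min 1 (e / (2 * K)).
    rewrite /q; near: h; move/cvgrPdist_le: cc; apply.
    by rewrite lt_min ltr01 divr_gt0 // mulr_gt0.
  move: qc; rewrite le_min => /andP[q1 qK].
  have cE : c (h *: 1 + t) - c t = h *: q by rewrite /q scalerA divff // scale1r.
  have A : `|lincomb D c' - lincomb D q| <= e / 2.
    rewrite -lincombB; apply: le_trans (HK _) _.
    rewrite mulrC -ler_pdivlMr //; apply: le_trans qK _.
    by rewrite invfM mulrA.
  have B : `|lincomb D q - h^-1 *: (f (c (h *: 1 + t)) - f (c t))| <= e / 2.
    rewrite -[lincomb D q](scalerK h0) -scalerBr normrZ -lincombZ -cE.
    rewrite normfV ler_pdivrMl ?normr_gt0 // distrC.
    apply: le_trans (H _ _ _ _) _; last 1 first.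
    + rewrite cE normrZ mulrCA ler_wpM2l //.
      have qn : `|q| <= 2 + `|c'|.
        have -> : q = c' - (c' - q) by rewrite subKr.
        by apply: le_trans (ler_normB _ _) _; rewrite addrC lerD // (le_trans q1) // ler1n.
      rewrite mulrAC ler_pdivrMr // -[e / 2 * _]mulrA [2^-1 * _]mulrA mulVf // mul1r.
      by rewrite ler_wpM2l // ltW.
    + rewrite distrC; near: h.
      have := cvg_comp _ _ st ct; move/cvgrPdist_lt; apply.
      by [].
    + by rewrite subrr normr0.
  by rewrite -(subrKA (lincomb D q)) (le_trans (ler_normD _ _)) // [e]splitr lerD.
split; first by apply/cvg_ex; exists (lincomb D c').
exact: cvg_lim.
Unshelve. all: by end_near. Qed.

End sdiff.

Section sdiff_mx.
Context {R : realType} {n p q : nat}.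
Implicit Types (U : set 'rV[R]_n) (f g : 'rV[R]_n -> 'M[R]_(p, q)).

Definition partials f x (i : 'I_n) : 'M[R]_(p, q) := 'D_(delta_mx 0 i) f x.

Lemma mx_norm_coord (A : 'M[R]_(p, q)) a b : `|A a b| <= `|A|.
Proof.
rewrite [leRHS]/Num.Def.normr/= mx_normrE.
exact: (le_bigmax _ (fun i : 'I_p * 'I_q => `|A i.1 i.2|) (a, b)).
Qed.

Lemma mx_norm_le (A : 'M[R]_(p, q)) e : 0 <= e -> (forall a b, `|A a b| <= e) -> `|A| <= e.
Proof.
move=> e0 H; rewrite [leLHS]/Num.Def.normr/= mx_normrE.
by apply: bigmax_le => // -[a b] _ /=.
Qed.

Lemma sdiff_mxP f x D : sdiff f x D <->
  forall a b, sdiff (fun y => f y a b) x (fun i => D i a b).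
Proof.
have E y z a b : (f y - f z - lincomb D (y - z)) a b =
    f y a b - f z a b - lincomb (fun i => D i a b) (y - z).
  by rewrite !mxE /lincomb summxE; congr (_ - _); apply: eq_bigr => i _; rewrite mxE.
split=> [H a b e /H[d d0 {}H]|H e e0].
  exists d => // y z yd zd; rewrite -E.
  exact: le_trans (mx_norm_coord _ _ _) (H _ _ yd zd).
(* Radii are rephrased as [d] near [0^'+], so that [filter_forall] supplies one that serves all
   entries. *)
have {}H (a : 'I_p * 'I_q) : \forall d \near 0^'+, forall y z, `|y - x| < d -> `|z - x| < d ->
    `|f y a.1 a.2 - f z a.1 a.2 - lincomb (fun i => D i a.1 a.2) (y - z)| <= e * `|y - z|.
  have [d d0 Hd] := H a.1 a.2 e e0.
  near=> d' => y z yd zd; apply: Hd; [apply: lt_trans yd _|apply: lt_trans zd _];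
    by near: d'; exact: nbhs_right_lt.
have : \forall d \near (0:R)^'+, 0 < d /\ forall a : 'I_p * 'I_q, forall y z, `|y - x| < d -> `|z - x| < d ->
    `|f y a.1 a.2 - f z a.1 a.2 - lincomb (fun i => D i a.1 a.2) (y - z)| <= e * `|y - z|.
  near=> d; split; first by near: d; exact: nbhs_right_gt.
  by near: d; apply: filter_forall.
case/filter_ex => d [d0 {}H]; exists d => // y z yd zd.
apply: mx_norm_le => [|a b]; first by rewrite mulr_ge0 // ltW.
by rewrite E; exact: (H (a, b)).
Unshelve. all: by end_near. Qed.

(** Continuity of the partials at [x] keeps them within [e'] of their values at [x] on a ball;
    [sdiff_real] turns this into a two-point estimate, entry by entry. *)
Lemma smooth_sdiff U f x : open U -> smooth_on U f -> U x ->
  sdiff f x (partials f x).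
Proof.
move=> oU sf Ux; apply/sdiff_mxP => a b e e0.
pose e' := e / (1 + n%:R).
have n0 : 0 < 1 + n%:R :> R by rewrite ltr_wpDr.
have e'0 : 0 < e' by rewrite divr_gt0.
have /nbhs_normP[d0 /= d00 dU] : nbhs x U by exact: open_nbhs_nbhs.
have Hc (i : 'I_n) : exists2 d, 0 < d & forall y, `|y - x| < d -> `|partials f y i - partials f x i| < e'.
  by have [/cts_norm /(_ _ e'0)] := sf [:: i] x Ux.
pose F d := forall y i, `|y - x| < d -> derivable (fun y => f y a b) y (delta_mx 0 i) /\
     `|'D_(delta_mx 0 i) (fun y => f y a b) y - partials f x i a b| <= e'.
have [d d1 Fd] : exists2 d, 0 < d & F d.
  have : \forall d \near (0:R)^'+, 0 < d /\ (d < d0 /\ forall i y, `|y - x| < d -> `|partials f y i - partials f x i| < e').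
    near=> d; split; first by near: d; exact: nbhs_right_gt.
    split; first by near: d; exact: nbhs_right_lt.
    near: d; apply: filter_forall => i; have [d2 d20 H] := Hc i.
    near=> d => y yd; apply: H; apply: lt_trans yd _.
    by near: d; exact: nbhs_right_lt.
  case/filter_ex => d [d1 [dd0 H]]; exists d => // y i yd.
  have Uy : U y by apply: dU; rewrite /ball_ /= distrC (lt_trans yd).
  have [_ /(_ i) /= dfy] := sf [::] y Uy.
  split; first by move/derivable_mxP : dfy; exact.
  have -> : 'D_'e_i (fun y => f y a b) y = partials f y i a b.
    by rewrite /partials derive_mx // mxE.
  apply: le_trans (ltW (H i y yd)).
  by have := mx_norm_coord (partials f y i - partials f x i) a b; rewrite !mxE.
exists (d / 3) => [|y z yd zd]; first by rewrite divr_gt0.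
rewrite /lincomb /=.
apply: le_trans (sdiff_real Fd yd zd) _.
rewrite ler_wpM2r // /e' mulrA ler_pdivrMr // mulrC ler_pM2l //.
by rewrite lerDr.
Unshelve. all: by end_near. Qed.

(** In [pderiv] the head of the list is differentiated last, hence [rcons]. *)
Lemma smooth_partial U f i : smooth_on U f -> smooth_on U ('D_(delta_mx 0 i) f).
Proof. by move=> sf s x /(sf (rcons s i)); rewrite /pderiv foldr_rcons. Qed.

Lemma smooth_near U f x v : open U -> smooth_on U f -> U x ->
  \forall y \near x, 'D_v f y = lincomb (partials f y) v.
Proof.
move=> oU sf Ux; apply: filterS (open_nbhs_nbhs (conj oU Ux)) => y Uy.
exact/sdiff_derive/(smooth_sdiff oU sf Uy).
Qed.

Lemma sdiff_lincomb m (f : 'I_m -> 'rV[R]_n -> 'M[R]_(p, q)) x D (v : 'rV[R]_m) :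
  (forall i, sdiff (f i) x (D i)) ->
  sdiff (fun y => lincomb (f ^~ y) v) x (fun j => lincomb (D ^~ j) v).
Proof.
move=> H e e0; pose e' := e / (1 + \sum_i `|v 0 i|).
have v0 : 0 < 1 + \sum_i `|v 0 i| by rewrite ltr_wpDr // sumr_ge0.
have : \forall d \near (0:R)^'+, 0 < d /\ forall i y z, `|y - x| < d -> `|z - x| < d ->
    `|f i y - f i z - lincomb (D i) (y - z)| <= e' * `|y - z|.
  near=> d; split; first by near: d; exact: nbhs_right_gt.
  near: d; apply: filter_forall => i; have [d2 d20 Hd] := H i e' (divr_gt0 e0 v0).
  near=> d => y z yd zd; apply: Hd; [apply: lt_trans yd _|apply: lt_trans zd _];
    by near: d; exact: nbhs_right_lt.
case/filter_ex => d [d0 {}H]; exists d => // y z yd zd.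
have -> : lincomb (f ^~ y) v - lincomb (f ^~ z) v - lincomb (fun j => lincomb (D ^~ j) v) (y - z)
    = \sum_i v 0 i *: (f i y - f i z - lincomb (D i) (y - z)).
  have -> : lincomb (fun j => lincomb (D ^~ j) v) (y - z) = \sum_i v 0 i *: lincomb (D i) (y - z).
    rewrite /lincomb; under eq_bigr do rewrite scaler_sumr.
    rewrite exchange_big /=; apply: eq_bigr => i _; rewrite scaler_sumr.
    by apply: eq_bigr => j _; rewrite !scalerA mulrC.
  by rewrite /lincomb -!sumrB; apply: eq_bigr => i _; rewrite !scalerBr.
apply: le_trans (ler_norm_sum _ _ _) _.
apply: (@le_trans _ _ (\sum_i `|v 0 i| * (e' * `|y - z|))).
  by apply: ler_sum => i _; rewrite normrZ ler_wpM2l // H.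
rewrite -mulr_suml mulrA ler_wpM2r // /e' mulrA ler_pdivrMr // mulrC ler_pM2l //.
by rewrite lerDr.
Unshelve. all: by end_near. Qed.

Lemma sdiff_deriv U f x v : open U -> smooth_on U f -> U x ->
  sdiff ('D_v f) x (fun j => lincomb (fun i => 'D_(delta_mx 0 j) ('D_(delta_mx 0 i) f) x) v).
Proof.
move=> oU sf Ux.
apply: (@sdiff_near _ _ _ (fun y => lincomb (partials f y) v)).
  by apply: filterS (smooth_near v oU sf Ux) => y ->.
apply: sdiff_lincomb => i.
exact: (smooth_sdiff oU (smooth_partial i sf) Ux).
Qed.

End sdiff_mx.

(** * Symmetry of second derivatives *)

Section schwarz.
Context {R : realType} {n : nat}.

(** The second difference is the increment along [h *: u] of [phi y = f (y + h *: v) - f y]. The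
    mean value theorem reduces it to [g (y + h *: v) - g y] at a moving point [y], which strict
    differentiability of [g] at [x] estimates. *)
Lemma second_difference (f g : 'rV[R]_n -> R) x u v D e :
  (\forall y \near x, is_derive y u f (g y)) -> sdiff g x D -> 0 < e ->
  \forall h \near (0:R)^', `|f (x + h *: u + h *: v) - f (x + h *: u) - f (x + h *: v) + f x -
    h ^+ 2 * lincomb D v| <= e * `|h| ^+ 2.
Proof.
move=> /nbhs_normP[d0 /= d00 Hd] H e0.
have v1 : 0 < 1 + `|v| by rewrite ltr_wpDr.
have [d1 d10 {}H] := H (e / (1 + `|v|)) (divr_gt0 e0 v1).
pose C := 1 + `|u| + `|v|.
have C0 : 0 < C by rewrite /C -addrA ltr_wpDr // addr_ge0.
near=> h.
have hC : `|h| * C < Num.min d0 d1.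
  rewrite -ltr_pdivlMr //; near: h; apply: dnbhs0_lt.
  by rewrite divr_gt0 // lt_min d00.
move: hC; rewrite lt_min => /andP[hC0 hC1].
have B s : `|s| <= `|h| -> `|s *: u| <= `|h| * C /\ `|s *: u + h *: v| <= `|h| * C.
  move=> sh.
  have su : `|s *: u| <= `|h| * `|u| by rewrite normrZ ler_wpM2r.
  split; first by apply: le_trans su _; rewrite ler_wpM2l // /C -addrA addrCA lerDl addr_ge0.
  apply: le_trans (ler_normD _ _) _; rewrite /C [`|h *: v|]normrZ !mulrDr.
  by rewrite lerD2r ler_wpDl // mulr1.
pose phi y := f (y + h *: v) - f y.
have -> : f (x + h *: u + h *: v) - f (x + h *: u) - f (x + h *: v) + f x -
    h ^+ 2 * lincomb D v = phi (x + h *: u) - phi x - h * (h * lincomb D v).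
  by rewrite /phi expr2; ring.
apply: le_trans (@mvt_line _ _ phi x u h _ (e * `|h|) _) _; last by rewrite expr2 mulrA.
move=> s sh; have [B1 B2] := B s sh.
have D1 : is_derive (x + s *: u) u f (g (x + s *: u)).
  by apply: Hd; rewrite /ball_ /= opprD addrA subrr sub0r normrN (le_lt_trans B1).
have D2 : is_derive (x + s *: u + h *: v) u f (g (x + s *: u + h *: v)).
  apply: Hd; rewrite /ball_ /= -addrA opprD addrA subrr sub0r normrN.
  by rewrite (le_lt_trans B2).
have D3 : is_derive (x + s *: u) u (fun y => f (y + h *: v)) (g (x + s *: u + h *: v)).
  have E : (fun k => k^-1 *: (f (k *: u + (x + s *: u) + h *: v) - f (x + s *: u + h *: v))) =
    (fun k => k^-1 *: (f (k *: u + (x + s *: u + h *: v)) - f (x + s *: u + h *: v))).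
    by apply/funext => k; rewrite -[in LHS](addrA (k *: u)).
  by case: D2 => D2 D2'; split; rewrite /derivable /derive /= E.
have D4 : is_derive (x + s *: u) u phi (g (x + s *: u + h *: v) - g (x + s *: u)).
  exact: is_deriveB.
split; first exact: ex_derive.
rewrite derive_val (_ : h * lincomb D v = lincomb D (h *: v)); last by rewrite lincombZ.
have := H (x + s *: u + h *: v) (x + s *: u).
have -> : x + s *: u + h *: v - (x + s *: u) = h *: v by rewrite addrC addKr.
move=> /(_ _ _)/le_trans; apply.
- by rewrite addrAC (addrAC x) subrr add0r (le_lt_trans B2).
- by rewrite addrAC subrr add0r (le_lt_trans B1).
- rewrite normrZ mulrAC ler_pdivrMr // -!mulrA ler_wpM2l // ?(ltW e0) //.
  by rewrite ler_wpM2l // lerDr.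
Unshelve. all: by end_near. Qed.

(** The second difference is symmetric in [u] and [v]; divided by [h ^+ 2], it approaches both
    sides. *)
Lemma schwarz_real (f gu gv : 'rV[R]_n -> R) x u v Du Dv :
  (\forall y \near x, is_derive y u f (gu y)) -> sdiff gu x Du ->
  (\forall y \near x, is_derive y v f (gv y)) -> sdiff gv x Dv ->
  lincomb Du v = lincomb Dv u.
Proof.
move=> fu su fv sv.
apply/eqP; rewrite -subr_eq0 -normr_le0; apply/ler_addgt0Pl => e e0; rewrite addr0.
have e2 : 0 < e / 2 by rewrite divr_gt0.
have S1 := second_difference v fu su e2; have S2 := second_difference u fv sv e2.
have : \forall h \near (0:R)^', h != 0 /\
   (`|f (x + h *: u + h *: v) - f (x + h *: u) - f (x + h *: v) + f x -
    h ^+ 2 * lincomb Du v| <= e / 2 * `|h| ^+ 2 /\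
   `|f (x + h *: v + h *: u) - f (x + h *: v) - f (x + h *: u) + f x -
    h ^+ 2 * lincomb Dv u| <= e / 2 * `|h| ^+ 2).
  near=> h; split; first by near: h; exact: nbhs_dnbhs_neq.
  by split; near: h; [exact: S1|exact: S2].
case/filter_ex => h [h0 [A B]].
rewrite -(ler_pM2l (_ : 0 < `|h| ^+ 2)); last by rewrite exprn_gt0 // normr_gt0.
rewrite -normrX -normrM mulrBr.
move: A B; rewrite -normrX (addrAC x (h *: v)).
set a := f _; set b := f _; set c := f _; set d := f x; set P := h ^+ 2 * _; set Q := h ^+ 2 * _.
move=> A B.
have -> : P - Q = (a - c - b + d - Q) - (a - b - c + d - P) by ring.
by apply: le_trans (ler_normB _ _) _; rewrite mulrC [e]splitr mulrDl lerD.
Unshelve. all: by end_near. Qed.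

Lemma schwarz p q (U : set 'rV[R]_n) (f : 'rV[R]_n -> 'M[R]_(p, q)) x u v :
  open U -> smooth_on U f -> U x -> 'D_v ('D_u f) x = 'D_u ('D_v f) x.
Proof.
move=> oU sf Ux.
have su := sdiff_deriv u oU sf Ux; have sv := sdiff_deriv v oU sf Ux.
apply: eq_trans (sdiff_derive v su) (eq_trans _ (esym (sdiff_derive u sv))).
apply/matrixP => a b.
have H w : \forall y \near x, is_derive y w (fun y => f y a b) ('D_w f y a b).
  apply: filterS (open_nbhs_nbhs (conj oU Ux)) => y Uy.
  have df : derivable f y w by have [] := sdiff_is_derive w (smooth_sdiff oU sf Uy).
  split; first by move/derivable_mxP : df; exact.
  by rewrite derive_mx // mxE.
move/sdiff_mxP/(_ a b) : su => su; move/sdiff_mxP/(_ a b) : sv => sv.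
have := schwarz_real (H u) su (H v) sv.
have L (D : 'I_n -> 'M[R]_(p, q)) w : lincomb D w a b = lincomb (fun i => D i a b) w.
  by rewrite /lincomb summxE; apply: eq_bigr => i _; rewrite mxE.
by rewrite !L.
Unshelve. all: by end_near. Qed.

End schwarz.

Section comp.
Context {R : realType} {n m : nat} {W : normedModType R}.

Lemma lincomb_comp (D : 'I_n -> 'rV[R]_m) (E : 'I_m -> W) v :
  lincomb E (lincomb D v) = lincomb (fun i => lincomb E (D i)) v.
Proof.
rewrite /lincomb; under [RHS]eq_bigr do rewrite scaler_sumr.
rewrite exchange_big /=; apply: eq_bigr => i _; rewrite summxE scaler_suml.
by apply: eq_bigr => j _; rewrite !mxE scalerA.
Qed.

Lemma sdiff_comp (f : 'rV[R]_n -> 'rV[R]_m) (g : 'rV[R]_m -> W) x D E :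
  sdiff f x D -> sdiff g (f x) E ->
  sdiff (g \o f) x (fun i => lincomb E (D i)).
Proof.
move=> sf sg e e0.
have [C [d1 [C0 d10 Hf]]] := sdiff_lipschitz sf.
have [K K0 HK] := lincomb_bound E.
have [d2 d20 Hg] := sg (e / (2 * C)) (divr_gt0 e0 (mulr_gt0 (ltr0Sn _ 1) C0)).
have [d3 d30 {}sf] := sf (e / (2 * K)) (divr_gt0 e0 (mulr_gt0 (ltr0Sn _ 1) K0)).
exists (Num.min d1 (Num.min (d2 / C) d3)) => [|y z].
  by rewrite !lt_min d10 d30 divr_gt0.
rewrite !lt_min => /and3P[y1 y2 y3] /and3P[z1 z2 z3].
have fx w : `|w - x| < d1 -> `|w - x| < d2 / C -> `|f w - f x| < d2.
  move=> w1 w2; apply: le_lt_trans (Hf _ _ w1 _) _; first by rewrite subrr normr0.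
  by rewrite mulrC -ltr_pdivlMr.
rewrite -lincomb_comp /= -(subrKA (lincomb E (f y - f z))) -lincombB.
rewrite (le_trans (ler_normD _ _)) // [e]splitr mulrDl lerD //.
  apply: le_trans (Hg _ _ (fx _ y1 y2) (fx _ z1 z2)) _.
  rewrite invfM mulrA -mulrA ler_wpM2l //; first by rewrite divr_ge0 ?(ltW e0).
  by rewrite ler_pdivrMl ?Hf.
apply: le_trans (HK _) _; rewrite -ler_pdivlMl //.
apply: le_trans (sf _ _ y3 z3) _.
rewrite le_eqVlt; apply/orP; left; apply/eqP; rewrite invfM; ring.
Qed.

End comp.

Section jac.
Context {R : realType}.

(** Vectors are rows, so the differential is multiplication by [jac] on the right, and the chain
    rule reads [jac f x *m jac g (f x)]. *)
Definition jac n m (f : 'rV[R]_n -> 'rV[R]_m) x : 'M[R]_(n, m) :=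
  \matrix_i partials f x i.

Lemma lincomb_jac n m (f : 'rV[R]_n -> 'rV[R]_m) x v :
  lincomb (partials f x) v = v *m jac f x.
Proof. by rewrite mulmx_sum_row; apply: eq_bigr => i _; rewrite rowK. Qed.

Definition sdf n p q (f : 'rV[R]_n -> 'M[R]_(p, q)) x := sdiff f x (partials f x).

Lemma sdiff_partials n p q (f : 'rV[R]_n -> 'M[R]_(p, q)) x D :
  sdiff f x D -> partials f x = D.
Proof.
move=> H; apply/funext => i.
by rewrite /partials (sdiff_derive _ H) lincomb_delta.
Qed.

Lemma sdiff_sdf n p q (f : 'rV[R]_n -> 'M[R]_(p, q)) x D :
  sdiff f x D -> sdf f x.
Proof. by move=> H; rewrite /sdf (sdiff_partials H). Qed.

Lemma sdf_near n p q (f g : 'rV[R]_n -> 'M[R]_(p, q)) x :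
  (\forall y \near x, f y = g y) -> sdf f x -> sdf g x /\ partials g x = partials f x.
Proof.
move=> fg /(sdiff_near fg) H; split; first exact: sdiff_sdf H.
exact: sdiff_partials.
Qed.

Lemma jac_near n m (f g : 'rV[R]_n -> 'rV[R]_m) x :
  (\forall y \near x, f y = g y) -> sdf f x -> jac g x = jac f x.
Proof. by move=> fg /(sdf_near fg)[_ E]; rewrite /jac E. Qed.

Lemma derive_jac n m (f : 'rV[R]_n -> 'rV[R]_m) x v :
  sdf f x -> 'D_v f x = v *m jac f x.
Proof. by move=> /sdiff_derive ->; rewrite lincomb_jac. Qed.

Lemma sdf_comp n m p (f : 'rV[R]_n -> 'rV[R]_m) (g : 'rV[R]_m -> 'rV[R]_p) x :
  sdf f x -> sdf g (f x) ->
  sdf (g \o f) x /\ jac (g \o f) x = jac f x *m jac g (f x).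
Proof.
move=> sf sg; have H := sdiff_comp sf sg; split; first exact: sdiff_sdf H.
apply/row_matrixP => i; rewrite rowK (sdiff_partials H) lincomb_jac.
by rewrite row_mul rowK.
Qed.

Lemma sdf_id n x : sdf (@id 'rV[R]_n) x /\ jac (@id 'rV[R]_n) x = 1%:M.
Proof.
have H : sdiff (@id 'rV[R]_n) x (fun i => delta_mx 0 i).
  move=> e e0; exists 1 => // y z _ _.
  rewrite /lincomb -row_sum_delta subrr normr0 mulr_ge0 //; exact: ltW.
split; first exact: sdiff_sdf H.
by apply/row_matrixP => i; rewrite rowK (sdiff_partials H) rowE mulmx1.
Qed.

Lemma sdf_curve n m (f : 'rV[R]_n -> 'rV[R]_m) (c : R -> 'rV[R]_n) (t : R) c' :
  is_derive t 1 c c' -> sdf f (c t) -> is_derive t 1 (f \o c) (c' *m jac f (c t)).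
Proof. by move=> dc sf; rewrite -lincomb_jac; exact: sdiff_curve. Qed.

Lemma sdf_bound n m (f : 'rV[R]_n -> 'rV[R]_m) x e : sdf f x -> 0 < e ->
  exists2 d, 0 < d & forall y z, `|y - x| < d -> `|z - x| < d ->
  `|f y - f z - (y - z) *m jac f x| <= e * `|y - z|.
Proof.
move=> sf /sf[d d0 H]; exists d => // y z yd zd.
by rewrite -lincomb_jac H.
Qed.

Lemma smooth_sdf n p q U (f : 'rV[R]_n -> 'M[R]_(p, q)) x :
  open U -> smooth_on U f -> U x -> sdf f x.
Proof. exact: smooth_sdiff. Qed.

Lemma mulmx_bound m n (J : 'M[R]_(m, n)) :
  exists2 C, 0 < C & forall v : 'rV_m, `|v *m J| <= C * `|v|.
Proof.
have [C C0 H] := lincomb_bound (fun i => row i J); exists C => // v.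
by rewrite mulmx_sum_row; exact: H.
Qed.

End jac.

(** * Calculus on manifolds and flows *)

Lemma for_continuous_pair (T U V : topologicalType) (a : T -> U) (b : T -> V) z :
  {for z, continuous a} -> {for z, continuous b} ->
  {for z, continuous (fun z => (a z, b z))}.
Proof. by move=> ca cb; exact: (@cvg_pair _ _ _ (nbhs z) _ _ _ _ _ a b ca cb). Qed.

(** * Freezing the time coordinate *)

Section slice.
Context {R : realType} {m n : nat} {W : normedModType R}.
Implicit Types (f : 'rV[R]_(m + n) -> W) (a : 'rV[R]_m) (x : 'rV[R]_n).

Lemma row_mx_continuous a : continuous (fun x : 'rV[R]_n => row_mx a x).
Proof.
move=> x; apply/cts_norm => e e0; exists e => // y yx.
rewrite opp_row_mx add_row_mx subrr; apply: rV_norm_lt => // i; rewrite mxE.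
case: split_ordP => j _; first by rewrite mxE normr0.
by apply: le_lt_trans yx; exact: rV_norm_coord.
Qed.

Lemma derive_slice f a x v h : h *: row_mx 0 v + row_mx a x = row_mx a (h *: v + x).
Proof. by rewrite scale_row_mx scaler0 add_row_mx add0r. Qed.

Lemma delta_rshift (i : 'I_n) : delta_mx 0 (rshift m i) = row_mx 0 (delta_mx 0 i) :> 'rV[R]_(m + n).
Proof.
apply/rowP => k; rewrite !mxE; case: split_ordP => j ->; rewrite !mxE ?eqxx /=.
  by rewrite eq_lrshift.
by rewrite eq_rshift.
Qed.

Lemma derive_row_mx f a x v :
  'D_v (fun y => f (row_mx a y)) x = 'D_(row_mx 0 v) f (row_mx a x) /\
  (derivable f (row_mx a x) (row_mx 0 v) -> derivable (fun y => f (row_mx a y)) x v).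
Proof.
have E : (fun h : R => h^-1 *: (((fun y => f (row_mx a y)) \o shift x) (h *: v) - f (row_mx a x))) =
   (fun h : R => h^-1 *: ((f \o shift (row_mx a x)) (h *: row_mx 0 v) - f (row_mx a x))).
  by apply/funext => h /=; rewrite derive_slice.
by rewrite /derive /derivable E.
Qed.

Lemma pderiv_slice f a s :
  pderiv s (fun y => f (row_mx a y)) =
  fun y => pderiv (map (@rshift m n) s) f (row_mx a y).
Proof.
elim: s => [//|i s IH] /=; rewrite -/(pderiv s) IH; apply/funext => y.
by have [-> _] := derive_row_mx (pderiv [seq rshift m k | k <- s] f) a y (delta_mx 0 i); rewrite delta_rshift.
Qed.

Lemma smooth_slice (U : set 'rV[R]_(m + n)) f a : smooth_on U f ->
  smooth_on [set x | U (row_mx a x)] (fun y => f (row_mx a y)).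
Proof.
move=> sf s x Ux; rewrite pderiv_slice.
have [cf df] := sf (map (@rshift m n) s) _ Ux; split.
  apply: (@continuous_comp _ _ _ (fun y => row_mx a y)); first exact: row_mx_continuous.
  exact: cf.
move=> i; have [_] := derive_row_mx (pderiv [seq rshift m k | k <- s] f) a x (delta_mx 0 i).
by apply; rewrite -delta_rshift; exact: df.
Qed.

End slice.

Lemma smooth_sub {R : realType} {n : nat} {W : normedModType R} (U V : set 'rV[R]_n)
  (f : 'rV[R]_n -> W) : V `<=` U -> smooth_on U f -> smooth_on V f.
Proof. by move=> VU sf s x /VU; exact: sf. Qed.

Section manifold_calculus.
Context {R : realType} {n : nat} {M : topologicalType}.
Variable A : smooth_atlas R n M.
Implicit Types (i j l : chart_index A) (f g : M -> M).

Lemma open_preimage_chart {m} (U : set 'rV[R]_m) (g : 'rV[R]_m -> M) (V : set M) :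
  open U -> (forall x, U x -> {for x, continuous g}) -> open V ->
  open [set x | U x /\ V (g x)].
Proof.
move=> oU cg oV; rewrite openE => x [Ux Vx].
apply: filterI; first exact: open_nbhs_nbhs.
by apply: (cg x Ux); exact: open_nbhs_nbhs.
Qed.

Lemma locdom_open f i j : continuous f -> open (locdom f i j).
Proof.
move=> cf; apply: (@open_preimage_chart _ _ (f \o chart_inv i)).
- exact: chart_img_open.
- by move=> x ix; apply: continuous_comp; [exact: chart_inv_cts|exact: cf].
- exact: chart_dom_open.
Qed.

Lemma smooth_map_sdf f i j x : smooth_map A f -> locdom f i j x -> sdf (loc f i j) x.
Proof. by move=> [cf sf]; apply: (smooth_sdf _ (sf i j)); exact: locdom_open. Qed.

Lemma loc_comp f g i j l x : locdom f i j x ->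
  loc (g \o f) i l x = loc g j l (loc f i j x).
Proof. by move=> [ix jx]; rewrite /loc /= chartK. Qed.

Lemma locdom_comp f g i j l x : locdom f i j x ->
  locdom g j l (loc f i j x) <-> locdom (g \o f) i l x.
Proof.
move=> [ix jx]; rewrite /locdom /loc /= chartK //; split=> [[_ ?]|[_ ?]]; split=> //.
exact: chart_in.
Qed.

Lemma jac_loc_comp f g i j l x : smooth_map A f -> smooth_map A g ->
  locdom f i j x -> locdom g j l (loc f i j x) ->
  sdf (loc (g \o f) i l) x /\
  jac (loc (g \o f) i l) x = jac (loc f i j) x *m jac (loc g j l) (loc f i j x).
Proof.
move=> sf sg fx gx.
have [H E] := sdf_comp (smooth_map_sdf sf fx) (smooth_map_sdf sg gx).
have N : \forall y \near x, (loc g j l \o loc f i j) y = loc (g \o f) i l y.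
  have oL : open (locdom f i j) by apply: locdom_open; case: sf.
  by apply: filterS (open_nbhs_nbhs (conj oL fx)) => y fy; rewrite (loc_comp _ _ fy).
by split; [exact: (sdf_near N H).1 | rewrite -E (jac_near N H)].
Qed.

Lemma smooth_map_id : smooth_map A id.
Proof. by case: (is_diffeo_id A). Qed.

Lemma loc_id_eq i x : chart_img i x -> loc id i i x = x.
Proof. by move=> ix; rewrite /loc /= chart_invK. Qed.

Lemma locdom_id i x : chart_img i x -> locdom id i i x.
Proof. by move=> ix; split=> //=; exact: chart_inv_in. Qed.

Lemma jac_loc_id i x : chart_img i x -> jac (loc id i i) x = 1%:M.
Proof.
move=> ix; have [s <-] := sdf_id x.
apply: jac_near s; apply: filterS (open_nbhs_nbhs (conj (@chart_img_open _ _ _ _ i) ix)) => y iy.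
by rewrite loc_id_eq.
Qed.

Lemma nbhs_chart i p (U : set 'rV[R]_n) : chart_dom i p -> nbhs (chart i p) U ->
  nbhs p [set q | chart_dom i q /\ U (chart i q)].
Proof.
move=> ip Up; apply: filterI; last exact: (chart_cts ip).
by apply: open_nbhs_nbhs; split=> //; exact: chart_dom_open.
Qed.

Lemma nbhs_chart_inv i x (V : set M) : chart_img i x -> nbhs (chart_inv i x) V ->
  nbhs x [set y | chart_img i y /\ V (chart_inv i y)].
Proof.
move=> ix Vx; apply: filterI; last exact: (chart_inv_cts ix).
by apply: open_nbhs_nbhs; split=> //; exact: chart_img_open.
Qed.

End manifold_calculus.

(** * The flow in charts *)

Section flow.
Context {R : realType} {n : nat} {M : topologicalType}.
Variables (A : smooth_atlas R n M) (xi : vector_field A) (psi : R -> M -> M).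
Hypothesis flow_psi : is_flow xi psi.
Implicit Types (i j l : chart_index A) (s t : R) (p q : M) (x : 'rV[R]_n).

Definition tx t x : 'rV[R]_(1 + n) := row_mx (const_mx t) x.

Lemma tx_lsub t x : lsubmx (tx t x) 0 0 = t.
Proof. by rewrite row_mxKl mxE. Qed.

Lemma tx_rsub t x : rsubmx (tx t x) = x.
Proof. by rewrite row_mxKr. Qed.

Lemma tx_eta (y : 'rV[R]_(1 + n)) : y = tx (lsubmx y 0 0) (rsubmx y).
Proof.
rewrite /tx -[LHS]hsubmxK; congr row_mx.
by apply/rowP => k; rewrite !mxE ord1.
Qed.

Lemma txB s t x y : tx s x - tx t y = tx (s - t) (x - y).
Proof.
rewrite /tx opp_row_mx add_row_mx; congr row_mx.
by apply/rowP => k; rewrite !mxE.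
Qed.

Lemma tx_norm t x : `|tx t x| <= Num.max `|t| `|x|.
Proof.
apply: rV_norm_le => [|k]; first by rewrite le_max normr_ge0.
rewrite mxE; case: split_ordP => a _; first by rewrite mxE le_max lexx.
by rewrite le_max rV_norm_coord orbT.
Qed.

Lemma tx_norm_ltP t x e : `|t| < e -> `|x| < e -> `|tx t x| < e.
Proof. by move=> te xe; apply: le_lt_trans (tx_norm t x) _; rewrite gt_max te. Qed.

Lemma flow_loc_tx i j t x : flow_loc psi i j (tx t x) = loc (psi t) i j x.
Proof. by rewrite /flow_loc tx_lsub tx_rsub. Qed.

Lemma flow_locdom_tx i j t x : flow_locdom psi i j (tx t x) <-> locdom (psi t) i j x.
Proof. by rewrite /flow_locdom /= tx_lsub tx_rsub. Qed.

Lemma flow_continuous2 (T : topologicalType) (a : T -> R) (b : T -> M) z :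
  {for z, continuous a} -> {for z, continuous b} ->
  {for z, continuous (fun z => psi (a z) (b z))}.
Proof.
move=> ca cb.
apply: (@continuous_comp _ _ _ (fun z => (a z, b z)) (fun z : R * M => psi z.1 z.2)).
  exact: for_continuous_pair.
exact: (flow_cts flow_psi).
Qed.

Lemma flow_map_continuous t : continuous (psi t).
Proof. by move=> p; apply: flow_continuous2; [exact: cvg_cst|exact: cvg_id]. Qed.

Lemma flow_orbit_continuous p : continuous (psi ^~ p).
Proof. by move=> t; apply: flow_continuous2; [exact: cvg_id|exact: cvg_cst]. Qed.

Lemma flow_locdom_open i j : open (flow_locdom psi i j).
Proof.
rewrite openE => y [iy jy]; rewrite /interior.
have ctl : {for y, continuous (fun y : 'rV[R]_(1 + n) => lsubmx y 0 0)}.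
  apply/cts_norm => e e0; exists e => // z zy.
  by have := rV_norm_coord (z - y) (lshift n 0); rewrite !mxE => /le_lt_trans; apply.
have ctr : {for y, continuous (fun y : 'rV[R]_(1 + n) => rsubmx y)}.
  apply/cts_norm => e e0; exists e => // z zy.
  apply: rV_norm_lt => // k.
  by have := rV_norm_coord (z - y) (rshift 1 k); rewrite !mxE => /le_lt_trans; apply.
apply: filterI.
  by apply: ctr; apply: open_nbhs_nbhs; split=> //; exact: chart_img_open.
have : {for y, continuous (fun y => psi (lsubmx y 0 0) (chart_inv i (rsubmx y)))}.
  apply: flow_continuous2 => //.
  by apply: (continuous_comp ctr); exact: chart_inv_cts.
by apply; apply: open_nbhs_nbhs; split=> //; exact: chart_dom_open.
Qed.

Lemma flow_smooth_on i j : smooth_on (flow_locdom psi i j) (flow_loc psi i j).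
Proof. exact: (@flow_smooth _ _ _ _ _ _ flow_psi). Qed.

Lemma flow_loc_sdf i j t x : locdom (psi t) i j x -> sdf (flow_loc psi i j) (tx t x).
Proof.
move=> H; apply: (smooth_sdf _ (@flow_smooth_on i j)); first exact: flow_locdom_open.
exact/flow_locdom_tx.
Qed.

Lemma loc_flow_slice i j t : loc (psi t) i j = fun x => flow_loc psi i j (row_mx (const_mx t) x).
Proof. by apply/funext => x; rewrite -flow_loc_tx. Qed.

Lemma flow_smooth_map t : smooth_map A (psi t).
Proof.
split=> [|i j]; first exact: flow_map_continuous.
rewrite loc_flow_slice.
have S := @smooth_slice _ _ _ _ _ _ (const_mx t) (@flow_smooth_on i j).
by apply: smooth_sub S => x /flow_locdom_tx.
Qed.

Lemma flow_is_diffeo t : is_diffeo A (psi t).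
Proof.
split; first exact: flow_smooth_map.
exists (psi (- t)); split; first exact: flow_smooth_map.
  by move=> p; rewrite -(flowD flow_psi) addNr (flow0 flow_psi).
by move=> p; rewrite -(flowD flow_psi) addrN (flow0 flow_psi).
Qed.

(** In the time direction the flow equation gives [xi]; in the space directions the joint derivative
    restricts to that of [psi t]. *)
Lemma flow_jac i j t x : locdom (psi t) i j x -> forall s v,
  tx s v *m jac (flow_loc psi i j) (tx t x) =
  s *: vf_loc xi j (loc (psi t) i j x) + v *m jac (loc (psi t) i j) x.
Proof.
move=> H s v; have sd := flow_loc_sdf H.
have -> : tx s v = s *: tx 1 0 + tx 0 v.
  rewrite /tx scale_row_mx add_row_mx scaler0 add0r; congr row_mx.
  by apply/rowP => k; rewrite !mxE mulr1 addr0.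
rewrite mulmxDl -scalemxAl; congr (_ *: _ + _).
  rewrite -derive_jac //.
  have [ix jx] := H.
  have [_ <-] := flow_integral flow_psi jx.
  have E : (fun h : R => h^-1 *: ((flow_loc psi i j \o shift (tx t x)) (h *: tx 1 0) - flow_loc psi i j (tx t x))) =
      (fun h : R => h^-1 *: (((fun s => chart j (psi s (chart_inv i x))) \o shift t) (h *: 1) - chart j (psi t (chart_inv i x)))).
    apply/funext => h /=.
    have -> : h *: tx 1 0 + tx t x = tx (h *: 1 + t) x.
      rewrite /tx scale_row_mx add_row_mx scaler0 add0r; congr row_mx.
      by apply/rowP => k; rewrite !mxE.
    by rewrite !flow_loc_tx.
  by rewrite /derive E.
rewrite -derive_jac // -derive_jac; last exact: (smooth_map_sdf (flow_smooth_map t)).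
rewrite loc_flow_slice.
have [-> _] := derive_row_mx (flow_loc psi i j) (const_mx t) x v.
by congr ('D_(_) _ _); rewrite /tx; congr row_mx.
Qed.

Lemma loc_flow_derive i j t x : locdom (psi t) i j x ->
  is_derive t 1 (fun s => loc (psi s) i j x) (vf_loc xi j (loc (psi t) i j x)).
Proof. by move=> [ix jx]; exact: (flow_integral flow_psi). Qed.

End flow.

Section derivative_of_pairing.
Context {R : realType} {n : nat} {V : normedModType R}.

Lemma is_derive_coord p q (f : V -> 'M[R]_(p, q)) x u D :
  is_derive x u f D <-> forall a b, is_derive x u (fun y => f y a b) (D a b).
Proof.
split=> [[df <-] a b|H].
  split; first by move/derivable_mxP : df; exact.
  by rewrite derive_mx // mxE.
have df : derivable f x u by apply/derivable_mxP => a b; exact: ex_derive.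
split=> //; rewrite derive_mx //; apply/matrixP => a b; rewrite mxE.
exact: derive_val.
Qed.

Lemma is_derive_pairing (a : V -> 'cV[R]_n) (w : V -> 'rV[R]_n) x u a' w' :
  is_derive x u a a' -> is_derive x u w w' ->
  is_derive x u (fun y => pairing (a y) (w y)) (pairing a' (w x) + pairing (a x) w').
Proof.
move=> /is_derive_coord da /is_derive_coord dw.
have -> : (fun y => pairing (a y) (w y)) = \sum_k ((fun y => w y 0 k) * (fun y => a y k 0)).
  by apply/funext => y; rewrite /pairing mxE fct_sumE.
have -> : pairing a' (w x) + pairing (a x) w' =
    \sum_k (w x 0 k *: a' k 0 + a x k 0 *: w' 0 k).
  rewrite /pairing !mxE -big_split; apply: eq_bigr => k _ /=.
  by rewrite [w' 0 k * _]mulrC.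
by apply: is_derive_sum => k; apply: is_deriveM.
Qed.

End derivative_of_pairing.

Section pairing.
Context {R : realType} {n : nat}.
Implicit Types (a b : 'cV[R]_n) (v w : 'rV[R]_n).

Lemma pairingD a v w : pairing a (v + w) = pairing a v + pairing a w.
Proof. by rewrite /pairing mulmxDl mxE. Qed.

Lemma pairingZ a c v : pairing a (c *: v) = c * pairing a v.
Proof. by rewrite /pairing -scalemxAl mxE. Qed.

Lemma pairing0 a : pairing a 0 = 0.
Proof. by rewrite /pairing mul0mx mxE. Qed.

Lemma pairingB a v w : pairing a (v - w) = pairing a v - pairing a w.
Proof. by rewrite pairingD -scaleN1r pairingZ mulN1r. Qed.

Lemma pairing_bound a : exists2 C, 0 < C & forall v, `|pairing a v| <= C * `|v|.
Proof.
have [C C0 H] := mulmx_bound a; exists C => // v.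
exact: le_trans (mx_norm_coord (v *m a) 0 0) (H v).
Qed.

End pairing.

Section constant_curves.
Context {R : realType}.

Lemma is_derive0_const n (c : R -> 'rV[R]_n) (t d : R) :
  (forall s, `|s - t| < d -> is_derive s 1 c 0) ->
  forall s, `|s - t| < d -> c s = c t.
Proof.
move=> H s st; apply/rowP => k.
have : `|c (t + (s - t) *: 1) 0 k - c t 0 k - (s - t) * 0| <= 0 * `|s - t|.
  apply: (mvt_line (f := fun y => c y 0 k)) => y yst.
  have /H /is_derive_coord/(_ 0 k) D : `|t + y *: 1 - t| < d.
    by rewrite addrAC subrr add0r [y *: _]mulr1 (le_lt_trans yst).
  split; first exact: ex_derive.
  by rewrite derive_val mxE subrr normr0.
rewrite mulr0 subr0 mul0r normr_le0 subr_eq0 [(s - t) *: _]mulr1 => /eqP.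
by rewrite addrC subrK.
Qed.

Context {n : nat} {M : topologicalType}.
Variable A : smooth_atlas R n M.

(** The curve is constant near each time, so the set of times at which it takes a given value is
    open and closed in [R]. *)
Lemma locally_constant_curve (c : R -> M) : hausdorff_space M -> continuous c ->
  (forall t : R, exists2 i : chart_index A, chart_dom i (c t) &
     \forall s \near t, is_derive (s : R) (1 : R) (chart i \o c) 0) ->
  forall s t, c s = c t.
Proof.
move=> hM cc H.
have L t : \forall s \near t, c s = c t.
  have [i ct Hi] := H t.
  have : \forall s \near t, chart_dom i (c s).
    by apply: cc; apply: open_nbhs_nbhs; split=> //; exact: chart_dom_open.
  move/nbhs_normP : Hi => [d /= d0 Hd].
  have : \forall s \near t, ball_ Num.Def.normr t d s by apply/nbhs_normP; exists d.
  apply: filterS2 => s; rewrite /ball_ /= => st cs.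
  rewrite -(chartK cs) -(chartK ct); congr chart_inv.
  apply: (@is_derive0_const _ (chart i \o c) t d); last by rewrite distrC.
  by move=> u ut; apply: Hd; rewrite /ball_ /= distrC.
move=> s t.
have C : connected [set: R] by apply/connected_intervalP => x y _ _ z _.
pose S := [set u | c u = c t].
have -> // : c s = c t.
suff : S s by [].
rewrite (C S) //.
- by exists t.
- exists S; last by rewrite setTI.
  by rewrite openE => u cu; apply: filterS (L u) => v; rewrite /S /= cu.
- exists S; last by rewrite setTI.
  rewrite closedE => u cu.
  have [v [/= vt vu]] : exists v, c v = c t /\ c v = c u.
    by apply: contrapT => N; apply: cu; apply: filterS (L u) => v vu vt; apply: N; exists v.
  by rewrite /S /= -vu.
Qed.

End constant_curves.

(** * Invariance of the form under the Reeb flow *)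

Section reeb_flow.
Context {R : realType} {n : nat} {M : topologicalType}.
Variables (A : smooth_atlas R n M) (eta : one_form A).
Implicit Types (i j l : chart_index A) (x v w : 'rV[R]_n).

Lemma of_sdf i x : chart_img i x -> sdf (of_loc eta i) x.
Proof. by move=> ix; apply: (smooth_sdf _ (@of_smooth _ _ _ _ eta i)) ix; exact: chart_img_open. Qed.

Lemma is_derive_form i x v w : chart_img i x ->
  is_derive x v (fun y => pairing (of_loc eta i y) w)
    (pairing (lincomb (partials (of_loc eta i) x) v) w).
Proof.
move=> ix.
have D := is_derive_pairing (sdiff_is_derive v (of_sdf ix)) (is_derive_cst w x v).
by move: D; rewrite pairing0 addr0.
Qed.

Lemma ext_derivE i x v w : chart_img i x -> ext_deriv eta i x v w =
  pairing (lincomb (partials (of_loc eta i) x) v) w -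
  pairing (lincomb (partials (of_loc eta i) x) w) v.
Proof.
move=> ix; rewrite /ext_deriv.
have [_ ->] := is_derive_form v w ix.
by have [_ ->] := is_derive_form w v ix.
Qed.

Lemma pullback_chart_independent (f : M -> M) i j l x v : smooth_map A f ->
  locdom f i j x -> locdom f i l x ->
  pairing (of_loc eta l (loc f i l x)) (v *m jac (loc f i l) x) =
  pairing (of_loc eta j (loc f i j x)) (v *m jac (loc f i j) x).
Proof.
move=> sf fj fl.
have jl : locdom id j l (loc f i j x) by apply/(locdom_comp id l fj).
have [_ ->] := jac_loc_comp sf (smooth_map_id A) fj jl.
have -> : loc f i l x = loc id j l (loc f i j x) by rewrite -(loc_comp id l fj).
rewrite mulmxA -(derive_jac (v *m _) (smooth_map_sdf (smooth_map_id A) jl)).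
exact: of_compat jl.
Qed.

Variables (xi : vector_field A) (psi : R -> M -> M).
Hypothesis reeb_xi : is_reeb eta xi.

Lemma vf_sdf i x : chart_img i x -> sdf (vf_loc xi i) x.
Proof. by move=> ix; apply: (smooth_sdf _ (@vf_smooth _ _ _ _ xi i)) ix; exact: chart_img_open. Qed.

(** Cartan's formula in coordinates. Since [d eta (xi, w) = 0], the derivative of [eta] along [xi]
    may be exchanged for the one along [w], and the sum becomes the derivative along [w] of the
    constant [eta (xi) = 1]. *)
Lemma reeb_lie_derivative i x w : chart_img i x ->
  pairing (lincomb (partials (of_loc eta i) x) (vf_loc xi i x)) w +
  pairing (of_loc eta i x) (w *m jac (vf_loc xi i) x) = 0.
Proof.
move=> ix.
have [_ /(_ w)] := reeb_xi ix; rewrite ext_derivE // => /eqP.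
rewrite subr_eq0 => /eqP ->.
have D : is_derive x w (fun y => pairing (of_loc eta i y) (vf_loc xi i y))
    (pairing (lincomb (partials (of_loc eta i) x) w) (vf_loc xi i x) +
     pairing (of_loc eta i x) (w *m jac (vf_loc xi i) x)).
  apply: is_derive_pairing; first exact: sdiff_is_derive (of_sdf ix).
  by rewrite -lincomb_jac; exact: sdiff_is_derive (vf_sdf ix).
have [_ <-] := D.
have N : \forall y \near x, pairing (of_loc eta i y) (vf_loc xi i y) = cst (1 : R) y.
  apply: filterS (open_nbhs_nbhs (conj (@chart_img_open _ _ _ _ i) ix)) => y iy.
  by have [] := reeb_xi iy.
by rewrite (near_eq_derive w N) derive_cst.
Qed.

Hypothesis flow_psi : is_flow xi psi.

Lemma flow_locdom_near i j t x : locdom (psi t) i j x ->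
  \forall s \near t, locdom (psi s) i j x.
Proof.
move=> [ix jx].
have : \forall s \near t, chart_dom j (psi s (chart_inv i x)).
  apply: (flow_orbit_continuous flow_psi); apply: open_nbhs_nbhs; split=> //.
  exact: chart_dom_open.
by apply: filterS => s; split.
Qed.

(** The first variation equation: [v *m jac] is a space derivative of the joint flow, whose time
    derivative is [xi]; [schwarz] exchanges the two. *)
Lemma flow_variation i j t x v : locdom (psi t) i j x ->
  is_derive t 1 (fun s => v *m jac (loc (psi s) i j) x)
    (v *m jac (loc (psi t) i j) x *m jac (vf_loc xi j) (loc (psi t) i j x)).
Proof.
move=> H; set Phi := flow_loc psi i j.
have E s : locdom (psi s) i j x -> v *m jac (loc (psi s) i j) x = 'D_(tx 0 v) Phi (tx s x).
  move=> Hs; rewrite (derive_jac _ (flow_loc_sdf flow_psi Hs)).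
  by rewrite (flow_jac flow_psi Hs) scale0r add0r.
have oU : open (flow_locdom psi i j) by exact: (@flow_locdom_open _ _ _ _ _ _ flow_psi).
have sU : smooth_on (flow_locdom psi i j) Phi by exact: (@flow_smooth_on _ _ _ _ _ _ flow_psi).
have Ut : flow_locdom psi i j (tx t x) by apply/flow_locdom_tx.
have sD := sdiff_deriv (tx 0 v) oU sU Ut.
have D0 : is_derive (tx t x) (tx 1 0) ('D_(tx 0 v) Phi) ('D_(tx 1 0) ('D_(tx 0 v) Phi) (tx t x)).
  by have [] := sdiff_is_derive (tx 1 0) sD.
have D1 : is_derive t 1 (fun s => 'D_(tx 0 v) Phi (tx s x)) ('D_(tx 1 0) ('D_(tx 0 v) Phi) (tx t x)).
  have T s : tx s x = tx 0 x + s *: tx 1 0 :> 'rV[R]_(1 + n).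
    rewrite /tx scale_row_mx add_row_mx scaler0 addr0; congr row_mx.
    by apply/rowP => k; rewrite !mxE add0r mulr1.
  rewrite (_ : (fun s => _) = (fun s => 'D_(tx 0 v) Phi (tx 0 x + s *: tx 1 0))); last first.
    by apply/funext => s; rewrite T.
  have D0' : is_derive (tx 0 x + t *: tx 1 0) (tx 1 0) ('D_(tx 0 v) Phi) ('D_(tx 1 0) ('D_(tx 0 v) Phi) (tx t x)).
    by rewrite -T.
  exact: (is_derive_line D0').
have -> : v *m jac (loc (psi t) i j) x *m jac (vf_loc xi j) (loc (psi t) i j x) =
   'D_(tx 1 0) ('D_(tx 0 v) Phi) (tx t x).
  rewrite -(schwarz (tx 1 0) (tx 0 v) oU sU Ut).
  have jy : chart_img j (Phi (tx t x)) by rewrite /Phi flow_loc_tx; case: H => _ /chart_in.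
  have N : \forall y \near tx t x, (vf_loc xi j \o Phi) y = 'D_(tx 1 0) Phi y.
    apply: filterS (open_nbhs_nbhs (conj oU Ut)) => y.
    rewrite (tx_eta y) => /flow_locdom_tx Hy.
    rewrite (derive_jac _ (flow_loc_sdf flow_psi Hy)) (flow_jac flow_psi Hy).
    by rewrite scale1r mul0mx addr0 /= /Phi flow_loc_tx.
  rewrite -(near_eq_derive _ N).
  have [sc jc] := sdf_comp (flow_loc_sdf flow_psi H) (vf_sdf jy).
  rewrite (derive_jac _ sc) jc mulmxA (flow_jac flow_psi H) scale0r add0r.
  by rewrite /Phi flow_loc_tx.
apply: near_eq_is_derive D1.
by apply: filterS (flow_locdom_near H) => s /E.
Qed.

Lemma flow_form_derive i j t x v : locdom (psi t) i j x ->
  is_derive t 1 (fun s => pairing (of_loc eta j (loc (psi s) i j x)) (v *m jac (loc (psi s) i j) x)) 0.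
Proof.
move=> H; have jy : chart_img j (loc (psi t) i j x) by case: H => _ /chart_in.
have D1 := flow_variation v H.
have D2 := sdiff_curve (loc_flow_derive flow_psi H) (of_sdf jy).
have := is_derive_pairing D2 D1.
by rewrite reeb_lie_derivative.
Qed.

Lemma flow_preserves_form t : pulls_back (psi t) (of_loc eta) (of_loc eta).
Proof.
move=> i j x v H; have sm s : smooth_map A (psi s) by exact: (flow_smooth_map flow_psi).
rewrite (derive_jac _ (smooth_map_sdf (sm t) H)).
have ix : chart_img i x by case: H.
(* The orbit may cross many charts. One is chosen at each time; by [gE], [g] agrees near each time
   with its expression in a fixed chart, whose derivative is zero there. *)
have ch s : {l : chart_index A | locdom (psi s) i l x}.
  by apply: cid; have [l Hl] := chart_cover A (psi s (chart_inv i x)); exists l.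
pose G s l := pairing (of_loc eta l (loc (psi s) i l x)) (v *m jac (loc (psi s) i l) x).
pose g s := G s (sval (ch s)).
have gE s l : locdom (psi s) i l x -> g s = G s l.
  by move=> Hl; apply: pullback_chart_independent => //; exact: (svalP (ch s)).
have dg (s : R) : is_derive s (1 : R) g 0.
  have Hs := svalP (ch s).
  apply: near_eq_is_derive (flow_form_derive v Hs).
  by apply: filterS (flow_locdom_near Hs) => u /gE ->.
rewrite -/(G t j) -(gE _ _ H) (is_derive_0_is_cst t 0 dg).
have p0 : psi 0 = id by apply/funext => p; rewrite (flow0 flow_psi).
rewrite (gE 0 i); last by rewrite p0; exact: locdom_id.
by rewrite /G p0 loc_id_eq // jac_loc_id // mulmx1.
Qed.

Lemma flow_jac_form t i j x v : locdom (psi t) i j x ->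
  pairing (of_loc eta j (loc (psi t) i j x)) (v *m jac (loc (psi t) i j) x) =
  pairing (of_loc eta i x) v.
Proof.
move=> H; rewrite -(derive_jac _ (smooth_map_sdf (flow_smooth_map flow_psi t) H)).
exact: flow_preserves_form.
Qed.

End reeb_flow.

(** * Periods of the Reeb flow *)

Lemma near_ballP {R : realType} {V : normedModType R} (x : V) (P : V -> Prop) :
  (exists2 d, 0 < d & forall y : V, `|y - x| < d -> P y) <-> \forall y \near x, P y.
Proof.
split=> [[d d0 H]|/nbhs_normP[d /= d0 H]].
  by apply/nbhs_normP; exists d => // y; rewrite /ball_ /= distrC; exact: H.
by exists d => // y yx; apply: H; rewrite /ball_ /= distrC.
Qed.

Section periods.
Context {R : realType} {M : topologicalType}.
Variable psi : R -> M -> M.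
Hypothesis psi0 : forall p, psi 0 p = p.
Hypothesis psiD : forall s t p, psi (s + t) p = psi s (psi t p).
Hypothesis psi_cts : continuous (fun z : R * M => psi z.1 z.2).
Hypothesis hM : hausdorff_space M.
Implicit Types (p q x : M) (s t : R).

Lemma near_neq p q : p <> q -> \forall z \near (p, q), z.1 <> z.2.
Proof.
move=> pq; move: hM; rewrite open_hausdorff => /(_ p q) [|[U V] /= []].
  exact/eqP.
rewrite !inE => Up Vq [oU oV UV].
exists (U, V); first by split; apply: open_nbhs_nbhs.
move=> [x y] [/= Ux Vy] xy; have : set0 x by rewrite -UV; split=> //; rewrite xy.
by [].
Qed.

Lemma near_flow_neq (K : set R) p q : compact K ->
  (forall t, K t -> psi t p <> q) ->
  \forall z \near (p, q), forall t, K t -> psi t z.1 <> z.2.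
Proof.
move=> /compact_near_coveringP cK H.
apply: (cK _ (nbhs (p, q)) (fun z t => psi t z.1 <> z.2)) => t Kt.
have C : {for (t, (p, q)), continuous (fun w : R * (M * M) => (psi w.1 w.2.1, w.2.2))}.
  apply: for_continuous_pair; last first.
    apply: (@continuous_comp _ _ _ (fun w : R * (M * M) => w.2) snd); exact: cvg_snd.
  apply: (@continuous_comp _ _ _ (fun w : R * (M * M) => (w.1, w.2.1)) (fun z : R * M => psi z.1 z.2)); last exact: psi_cts.
  apply: for_continuous_pair; first exact: cvg_fst.
  apply: (@continuous_comp _ _ _ (fun w : R * (M * M) => w.2) fst); first exact: cvg_snd.
  exact: cvg_fst.
exact: C (near_neq (H t Kt)).
Qed.

Lemma near_diag (P : M * M -> Prop) p : (\forall z \near (p, p), P z) ->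
  \forall x \near p, P (x, x).
Proof.
move=> H.
have C : {for p, continuous (fun x : M => (x, x))} by apply: for_continuous_pair; exact: cvg_id.
exact: C H.
Qed.

Lemma near_no_period (K : set R) p : compact K ->
  (forall t, K t -> psi t p <> p) ->
  \forall x \near p, forall t, K t -> psi t x <> x.
Proof. by move=> cK /(near_flow_neq cK)/near_diag. Qed.

Lemma closed_period (K : set R) : compact K ->
  closed [set p | exists2 t, K t & psi t p = p].
Proof.
move=> cK; rewrite -openC openE => p Np.
have : \forall x \near p, forall t, K t -> psi t x <> x.
  by apply: near_no_period => // t Kt E; apply: Np; exists t.
by apply: filterS => x Hx [t Kt]; exact: Hx.
Qed.

Lemma closed_fix t : closed [set p | psi t p = p].
Proof.
have := @closed_period [set t] (@compact_set1 _ t).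
have -> : [set p | exists2 t0, [set t] t0 & psi t0 p = p] = [set p | psi t p = p].
  by apply/seteqP; split=> p /=; [move=> [s ->]|exists t].
by [].
Qed.

Lemma flow_mulr t p (k : nat) : psi t p = p -> psi (k%:R * t) p = p.
Proof.
move=> tp; elim: k => [|k IH]; first by rewrite mul0r psi0.
by rewrite -natr1 mulrDl mul1r psiD tp.
Qed.

Lemma flow_opp_fix t p : psi t p = p -> psi (- t) p = p.
Proof. by move=> tp; rewrite -{1}tp -psiD addNr psi0. Qed.

Variable e0 : R.
Hypothesis e0_gt0 : 0 < e0.
Hypothesis no_small_period : forall p t, 0 < t < e0 -> psi t p <> p.
Hypothesis regular_psi : regular psi.

Definition is_min_period p tau :=
  [/\ 0 < tau, psi tau p = p & forall t, 0 < t -> psi t p = p -> tau <= t].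

(** The infimum of the periods is at least [e0], hence positive; it is attained because
    [psi t p <> p] is an open condition on [t]. *)
Lemma min_period_exists p : exists tau, is_min_period p tau.
Proof.
pose S := [set t | 0 < t /\ psi t p = p].
have [T T0 Tp] := regular_psi p.
have lb : lbound S e0.
  move=> t [t0 tp]; rewrite leNgt; apply/negP => te.
  by apply: (no_small_period _ tp); rewrite t0.
have hS : has_inf S by split; [exists T|exists e0].
have me0 : e0 <= inf S by apply: lb_le_inf => //; exists T.
have m0 : 0 < inf S by exact: lt_le_trans me0.
exists (inf S); split=> // [|t t0 tp]; last by apply: ge_inf; [exists e0|].
apply: contrapT => N.
have C : {for inf S, continuous (fun t => (psi t p, p))}.
  apply: for_continuous_pair; last exact: cvg_cst.
  apply: (@continuous_comp _ _ _ (fun t : R => (t, p)) (fun z : R * M => psi z.1 z.2)); last exact: psi_cts.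
  by apply: for_continuous_pair; [exact: cvg_id|exact: cvg_cst].
have /nbhs_normP[d /= d0 Hd] := C _ (near_neq N).
have [t [t0 tp] tm] := inf_adherent d0 hS.
apply: (Hd t) => //=; rewrite /ball_ /= distrC ger0_norm ?ltrBlDl //.
by rewrite subr_ge0; apply: ge_inf; [exists e0|].
Qed.

Definition tau p := sval (cid (min_period_exists p)).

Lemma tau_gt0 p : 0 < tau p.
Proof. by rewrite /tau; case: cid => ? []. Qed.

Lemma tau_fix p : psi (tau p) p = p.
Proof. by rewrite /tau; case: cid => ? []. Qed.

Lemma tau_le p t : 0 < t -> psi t p = p -> tau p <= t.
Proof. by rewrite /tau; case: cid => ? [? ? H] /=; exact: H. Qed.

Lemma e0_le_tau p : e0 <= tau p.
Proof.
rewrite leNgt; apply/negP => te; apply: (@no_small_period p (tau p)); last exact: tau_fix.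
by rewrite tau_gt0.
Qed.

Lemma tau_multiple p t : 0 <= t -> psi t p = p -> exists k : nat, t = k%:R * tau p.
Proof.
move=> t0 tp.
pose k := Num.truncn (t / tau p); exists k.
have /andP[k1 k2] := truncn_itv (divr_ge0 t0 (ltW (tau_gt0 p))).
rewrite -/k in k1 k2.
move: k1 k2; rewrite ler_pdivlMr ?tau_gt0 // ltr_pdivrMr ?tau_gt0 // => k1 k2.
have r : psi (t - k%:R * tau p) p = p.
  by rewrite psiD (flow_opp_fix (flow_mulr k (tau_fix p))).
apply/eqP; rewrite -subr_eq0 eq_le; apply/andP; split; last by rewrite subr_ge0.
rewrite leNgt; apply/negP => pos; have := tau_le pos r.
rewrite leNgt => /negP; apply.
by rewrite ltrBlDl -natr1 mulrDl mul1r in k2 *; rewrite addrC in k2; rewrite addrC.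
Qed.

Lemma tau_multiple_gt0 p t : 0 < t -> psi t p = p ->
  exists2 k : nat, (0 < k)%N & t = k%:R * tau p.
Proof.
move=> t0 /(tau_multiple (ltW t0))[[|k] E]; last by exists k.+1.
by move: t0; rewrite E mul0r ltxx.
Qed.

(** Lower semicontinuity of the minimal period: the bound [e0] confines the periods in question to a
    compact interval away from [0]. *)
Lemma closed_tau_le c : closed [set p | tau p <= c].
Proof.
have -> : [set p | tau p <= c] = [set p | exists2 t, [set` `[e0, c]] t & psi t p = p].
  apply/seteqP; split=> p /= => [pc|[t]].
    by exists (tau p); [rewrite /= in_itv /= e0_le_tau|exact: tau_fix].
  rewrite /= in_itv /= => /andP[te tc] tp; apply: le_trans tc.
  by apply: tau_le => //; exact: lt_le_trans te.
by apply: closed_period; exact: segment_compact.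
Qed.

End periods.

(** * The Baire category argument *)

Section baire.
Context {M : topologicalType}.

(** If no [C n] contains a nonempty relatively open piece of [B], open sets meeting [B] can be
    chosen in turn so that the closure of each lies in the previous one and avoids the next [C n]. A
    cluster point of their traces on [B] lies in no [C n]. *)
Lemma compact_baire (B : set M) (C : nat -> set M) : hausdorff_space M ->
  compact [set: M] -> closed B -> B !=set0 -> (forall n, closed (C n)) ->
  (forall x, B x -> exists n, C n x) ->
  exists n V, [/\ open V, V `&` B !=set0 & V `&` B `<=` C n].
Proof.
move=> hM cM clB B0 clC cover; apply: contrapT => N.
pose good V := open V /\ V `&` B !=set0.
have step (V : {V | good V}) (n : nat) :
    {W : {V | good V} | closure (sval W) `<=` sval V `&` ~` C n}.
  apply: cid; case: V => V [oV V0] /=.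
  have [x [[Vx Bx] Cx]] : exists x, (V `&` B) x /\ ~ C n x.
    apply: contrapT => H; apply: N; exists n, V; split=> // x Hx.
    by apply: contrapT => Cx; apply: H; exists x.
  have nx : nbhs x (V `&` ~` C n).
    by apply: open_nbhs_nbhs; split=> //; apply: openI => //; exact: closed_openC.
  have [D Dx cD] := @compact_regular _ x _ hM cM (filterT) _ nx.
  have gD : good (D°).
    split; first exact: open_interior.
    by exists x; split=> //; exact: Dx.
  by exists (exist _ _ gD); apply: subset_trans cD => /=; apply: closureS; exact: interior_subset.
have gT : good [set: M] by split; [exact: openT|rewrite setTI].
pose V := fix V n := if n is n'.+1 then sval (step (V n') n') else exist _ _ gT.
have VS n : closure (sval (V n.+1)) `<=` sval (V n) `&` ~` C n by exact: svalP (step (V n) n).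
have Vdec n m : (n <= m)%N -> sval (V m) `<=` sval (V n).
  elim: m => [|m IH]; first by rewrite leqn0 => /eqP ->.
  rewrite leq_eqVlt => /predU1P[-> //|]; rewrite ltnS => /IH H x Vx.
  by apply: H; have [] := VS m x (subset_closure Vx).
pose F := filter_from setT (fun n => sval (V n) `&` B).
have FF : ProperFilter F.
  apply: filter_from_proper => [|n _]; last by have [] := svalP (V n).
  apply: filter_from_filter => [|n m _ _]; first by exists 0%N.
  by exists (maxn n m) => // x [Vx Bx]; split; split=> //; apply: Vdec Vx; rewrite ?leq_maxl ?leq_maxr.
have [x [_ Fx]] := cM F FF filterT.
have Bx : B x.
  apply: clB => U /(Fx B) H; apply: H.
  by exists 0%N => // y [].
have [n Cn] := cover x Bx.
have [|_] := VS n x; last by [].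
move=> U /(Fx (sval (V n.+1))) H; apply: H.
by exists n.+1 => // y [].
Qed.

End baire.

(** * First-order behaviour at periodic points *)

Section common_period.
Context {R : realType} {n : nat} {M : topologicalType}.
Variables (A : smooth_atlas R n M) (eta : one_form A) (xi : vector_field A)
  (psi : R -> M -> M).
Hypothesis reeb_xi : is_reeb eta xi.
Hypothesis flow_psi : is_flow xi psi.
Hypothesis hM : hausdorff_space M.
Implicit Types (i j l : chart_index A) (x y v w : 'rV[R]_n) (s t T : R) (p q : M).

Let psi0 := flow0 flow_psi.
Let psiD := flowD flow_psi.
Let psi_cts := flow_cts flow_psi.

Lemma loc_fix i t x : chart_img i x -> psi t (chart_inv i x) = chart_inv i x ->
  loc (psi t) i i x = x.
Proof. by move=> ix E; rewrite /loc E chart_invK. Qed.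

Lemma locdom_fix i t x : chart_img i x -> psi t (chart_inv i x) = chart_inv i x ->
  locdom (psi t) i i x.
Proof. by move=> ix E; split=> //; rewrite E; exact: chart_inv_in. Qed.

(* Applying [eta] to the linearization of [psi t y = y] kills [y - y'], because
   [psi T] preserves [eta]; so periods are stationary to first order. *)
Lemma period_estimate i x0 T e : chart_img i x0 ->
  psi T (chart_inv i x0) = chart_inv i x0 -> 0 < e ->
  exists2 d, 0 < d & forall y y' t t', `|y - x0| < d -> `|y' - x0| < d ->
    `|t - T| < d -> `|t' - T| < d ->
    loc (psi t) i i y = y -> loc (psi t') i i y' = y' ->
    `|t - t'| <= e * `|y - y'| /\
    `|(y - y') *m (jac (loc (psi T) i i) x0 - 1%:M)| <= e * `|y - y'|.
Proof.
move=> ix0 fT e0; set L := jac _ _.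
have H := locdom_fix ix0 fT.
set a := of_loc eta i x0; set X := vf_loc xi i x0.
have [C C0 HC] := pairing_bound a.
pose K := (1 + C) * (1 + `|X|).
have K0 : 0 < K by rewrite mulr_gt0 // ltr_wpDr // ltW.
(* [K] exceeds both [C] and [1 + C * |X|]. The [2^-1] lets [|s|] be absorbed below, the [e] yields
   the two conclusions. *)
pose e1 := Num.min (2^-1) e / K.
have m0 : 0 < Num.min (2^-1) e by rewrite lt_min e0 invr_gt0 ltr0n.
have e10 : 0 < e1 by rewrite divr_gt0.
have Xge : 0 <= `|X| by [].
have CX : 0 <= C * `|X| by rewrite mulr_ge0 // ltW.
have eK : e1 * K = Num.min (2^-1) e by rewrite /e1 divfK // gt_eqF.
have [d d0 Hd] := sdf_bound (flow_loc_sdf flow_psi H) e10.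
exists d => // y y' t t' yd yd' td td' fy fy'.
have := Hd (tx t y) (tx t' y'); rewrite !txB => /(_ (tx_norm_ltP td yd) (tx_norm_ltP td' yd')).
rewrite (flow_jac flow_psi H) !flow_loc_tx fy fy' loc_fix // -/X -/L.
set s := t - t'; set u := y - y' => E1.
have E : `|u - (s *: X + u *m L)| <= e1 * Num.max `|s| `|u|.
  by apply: le_trans E1 _; rewrite ler_wpM2l ?(ltW e10) // tx_norm.
have pL : pairing a (u *m L) = pairing a u.
  have := flow_jac_form reeb_xi flow_psi u H.
  by rewrite loc_fix.
clearbody s u.
have s1 : `|s| <= C * (e1 * Num.max `|s| `|u|).
  apply: le_trans (ler_wpM2l (ltW C0) E).
  apply: le_trans (HC _); rewrite pairingB pairingD pairingZ pL.
  have [-> _] := reeb_xi ix0.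
  by rewrite mulr1 [s + _]addrC opprD addrA subrr sub0r normrN.
have Ce : C * e1 <= Num.min (2^-1) e.
  rewrite -eK [e1 * K]mulrC ler_wpM2r ?(ltW e10) // /K mulrDl mul1r mulrDr mulr1.
  by have := ltW C0; lra.
(* Were [|s|] the larger one, the bound would read [|s| <= |s| / 2]. *)
have us : `|s| <= `|u|.
  rewrite leNgt; apply/negP => us.
  have : `|s| <= 2^-1 * `|s|.
    apply: le_trans s1 _; rewrite max_l ?(ltW us) // mulrA ler_wpM2r //.
    by apply: le_trans Ce _; rewrite ge_min lexx.
  have : 0 < `|s| by apply: le_lt_trans us.
  by lra.
rewrite max_r // in s1 E.
have se : `|s| <= e * `|u|.
  apply: le_trans s1 _; rewrite mulrA ler_wpM2r //.
  by apply: le_trans Ce _; rewrite ge_min lexx orbT.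
split=> //.
have -> : u *m (L - 1%:M) = - (u - (s *: X + u *m L)) - s *: X.
  by rewrite mulmxBr mulmx1 opprB [s *: X + _]addrC addrAC addrK.
apply: le_trans (ler_normB _ _) _; rewrite normrN normrZ.
apply: (@le_trans _ _ (e1 * `|u| + C * (e1 * `|u|) * `|X|)).
  by rewrite lerD // ler_wpM2r.
have -> : e1 * `|u| + C * (e1 * `|u|) * `|X| = e1 * (1 + C * `|X|) * `|u| by ring.
rewrite ler_wpM2r //; apply: (@le_trans _ _ (e1 * K)).
  rewrite ler_wpM2l ?(ltW e10) // /K mulrDl mul1r mulrDr mulr1.
  by have := ltW C0; lra.
by rewrite eK ge_min lexx orbT.
Qed.

Lemma chart_ball i q d : chart_dom i q -> 0 < d ->
  \forall p \near q, chart_dom i p /\ `|chart i p - chart i q| < d.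
Proof.
move=> iq d0.
have H : \forall y \near chart i q, `|y - chart i q| < d by apply/near_ballP; exists d.
exact: (nbhs_chart iq H).
Qed.

(** [period_estimate] at [T = 0], with [y = y'] and the times [t] and [0]: the bound on [|t - 0|] is
    then zero. *)
Lemma near_no_small_period q :
  \forall p \near q & e \near (0 : R)^'+, forall t, 0 < t < e -> psi t p <> p.
Proof.
have [i iq] := chart_cover A q.
have f0 : psi 0 (chart_inv i (chart i q)) = chart_inv i (chart i q) by rewrite psi0.
have [d d0 Hd] := period_estimate (chart_in iq) f0 (@ltr01 R).
have N : \forall p \near q, chart_dom i p /\ `|chart i p - chart i q| < d.
  by exact: chart_ball.
exists ([set p | chart_dom i p /\ `|chart i p - chart i q| < d], [set e | e < d]).
  by split=> //=; exact: nbhs_right_lt.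
move=> [p e] [/= [ip pd] ed] t /andP[t0 te] tp.
have fp s : psi s p = p -> loc (psi s) i i (chart i p) = chart i p.
  by move=> sp; rewrite /loc chartK // sp.
have [] := Hd _ _ t 0 pd pd _ _ (fp _ tp) (fp _ (psi0 p)).
- by rewrite subr0 gtr0_norm // (lt_trans te).
- by rewrite subrr normr0.
- by rewrite subrr normr0 mulr0 subr0 normr_le0 gt_eqF.
Qed.

Hypothesis cM : compact [set: M].

Lemma no_small_period : exists2 e0, 0 < e0 & forall p t, 0 < t < e0 -> psi t p <> p.
Proof.
have /compact_near_coveringP cM' := cM.
have H := cM' _ (0 : R)^'+ (fun e p => forall t, 0 < t < e -> psi t p <> p) _
  (fun q _ => near_no_small_period q).
have [e [e0 He]] : exists e, 0 < e /\ [set: M] `<=` (fun p => forall t, 0 < t < e -> psi t p <> p).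
  apply: (@filter_ex _ (0 : R)^'+); near=> e; split; first by near: e; exact: nbhs_right_gt.
  by near: e; apply: H.
by exists e => // p; exact: He.
Unshelve. all: by end_near. Qed.

Lemma jac_flow_mul i q T (k : nat) : chart_dom i q -> psi T q = q ->
  jac (loc (psi T) i i) (chart i q) = 1%:M ->
  jac (loc (psi (k%:R * T)) i i) (chart i q) = 1%:M.
Proof.
move=> iq Tq JT.
have H s : psi s q = q -> locdom (psi s) i i (chart i q).
  by move=> sq; apply: locdom_fix; rewrite ?chartK //; exact: chart_in.
elim: k => [|k IH].
  have -> : psi (0%:R * T) = id by rewrite mul0r; apply/funext => p; rewrite psi0.
  by rewrite jac_loc_id //; exact: chart_in.
have E : psi (k.+1%:R * T) = psi (k%:R * T) \o psi T.
  by apply/funext => p; rewrite -natr1 mulrDl mul1r psiD.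
have lT : loc (psi T) i i (chart i q) = chart i q by rewrite /loc chartK // Tq.
have kq : psi (k%:R * T) q = q := flow_mulr psi0 psiD k Tq.
have Hk : locdom (psi (k%:R * T)) i i (loc (psi T) i i (chart i q)).
  by rewrite lT; exact: H.
by rewrite E (jac_loc_comp (flow_smooth_map flow_psi T) (flow_smooth_map flow_psi _) (H _ Tq) Hk).2 JT lT IH mulmx1.
Qed.

Lemma near_flow_fixed q T (P : M -> Prop) : psi T q = q -> (\forall p \near q, P p) ->
  \forall p \near q, P (psi T p).
Proof.
move=> Tq H.
have C : psi T x @[x --> q] --> psi T q by exact: (@flow_map_continuous _ _ _ _ _ _ flow_psi T).
by rewrite Tq in C; exact: C _ H.
Qed.

(* The increments [c (j+1) - c j] of the orbit all lie within half of the
   first one from it, and they sum up to zero. *)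
Lemma periodic_near_identity i q T (b : nat) : chart_dom i q -> psi T q = q ->
  jac (loc (psi T) i i) (chart i q) = 1%:M -> (0 < b)%N ->
  \forall p \near q, psi (b%:R * T) p = p -> psi T p = p.
Proof.
move=> iq Tq JT b0.
have H (j : 'I_b) : \forall p \near q,
    `|chart i (psi (j.+1%:R * T) p) - chart i (psi (j%:R * T) p) - (chart i (psi T p) - chart i p)| <=
    2^-1 * `|chart i (psi T p) - chart i p|.
  have jq : psi (j%:R * T) q = q := flow_mulr psi0 psiD j Tq.
  have Hj : locdom (psi (j%:R * T)) i i (chart i q).
    by apply: locdom_fix; rewrite ?chartK //; exact: chart_in.
  have s2 : 0 < 2^-1 :> R by rewrite invr_gt0 ltr0n.
  have [d d0 Hd] := sdf_bound (smooth_map_sdf (flow_smooth_map flow_psi _) Hj) s2.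
  have N : \forall p \near q, chart_dom i p /\ `|chart i p - chart i q| < d.
    by exact: chart_ball.
  have N' := near_flow_fixed Tq N.
  apply: filterS2 N N' => p [ip pd] [ip' pd'].
  have := Hd _ _ pd' pd; rewrite jac_flow_mul // mulmx1 /loc !chartK //.
  by have -> : j.+1%:R * T = j%:R * T + T by [rewrite -natr1 mulrDl mul1r]; rewrite psiD.
have Hall : \forall p \near q, forall j : 'I_b,
    `|chart i (psi (j.+1%:R * T) p) - chart i (psi (j%:R * T) p) - (chart i (psi T p) - chart i p)| <=
    2^-1 * `|chart i (psi T p) - chart i p| by exact: filter_forall.
have N : \forall p \near q, chart_dom i p.
  by apply: open_nbhs_nbhs; split=> //; exact: chart_dom_open.
have N' := near_flow_fixed Tq N.
apply: filterS3 N N' Hall => p ip ip' Hp bp.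
pose c (j : nat) := chart i (psi (j%:R * T) p).
pose v := chart i (psi T p) - chart i p.
have S : \sum_(j < b) (c j.+1 - c j) = 0.
  rewrite -(big_mkord xpredT (fun j : nat => c j.+1 - c j)) telescope_sumr //.
  by rewrite /c bp mul0r psi0 subrr.
have : `|\sum_(j < b) (c j.+1 - c j - v)| <= b%:R * (2^-1 * `|v|).
  apply: le_trans (ler_norm_sum _ _ _) _.
  apply: (@le_trans _ _ (\sum_(j < b) 2^-1 * `|v|)); first by apply: ler_sum => j _; exact: Hp.
  by rewrite sumr_const card_ord mulr_natl.
rewrite sumrB S sub0r normrN sumr_const card_ord -scaler_nat normrZ normr_nat.
rewrite ler_pM2l ?ltr0n // => vv.
have v0 : v = 0.
  apply/eqP; rewrite -normr_le0; have := normr_ge0 v; lra.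
move/eqP : v0; rewrite subr_eq0 => /eqP E.
by rewrite -(chartK ip') E chartK.
Qed.

Definition Ifix S : set M := [set p | \forall q \near p, psi S q = q].

Lemma open_Ifix S : open (Ifix S).
Proof. exact: (@open_interior _ [set q | psi S q = q]). Qed.

Lemma Ifix_fix S p : Ifix S p -> psi S p = p.
Proof. exact: nbhs_singleton. Qed.

Lemma closure_Ifix_fix S p : closure (Ifix S) p -> psi S p = p.
Proof.
move=> cp; have C : closed [set p | psi S p = p] by exact: (closed_fix psi_cts hM).
apply: C; apply: closureS cp => q.
exact: Ifix_fix.
Qed.

(** Strict differentiability at [q] applies to pairs of points near some [z] of [Ifix psi S] close
    to [q]. Both points of a pair are fixed by [psi S], so [v - v *m L] is arbitrarily small
    compared with [v]. *)
Lemma closure_Ifix_jac S i q : chart_dom i q -> closure (Ifix S) q ->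
  jac (loc (psi S) i i) (chart i q) = 1%:M.
Proof.
move=> iq cq; set L := jac _ _.
have Sq := closure_Ifix_fix cq.
have H : locdom (psi S) i i (chart i q).
  by apply: locdom_fix; rewrite ?chartK //; exact: chart_in.
have K e v : 0 < e -> `|v - v *m L| <= e * `|v|.
  move=> e0.
  have [d d0 Hd] := sdf_bound (smooth_map_sdf (flow_smooth_map flow_psi _) H) e0.
  have N : \forall p \near q, chart_dom i p /\ `|chart i p - chart i q| < d.
    by exact: chart_ball.
  have [z [Sz [iz zd]]] := cq _ N.
  have N1 : \forall y \near chart i z, `|y - chart i q| < d.
    apply/near_ballP; exists (d - `|chart i z - chart i q|); first by rewrite subr_gt0.
    move=> y yz; rewrite -(subrKA (chart i z)) (le_lt_trans (ler_normD _ _)) //.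
    by rewrite -ltrBrDr.
  have N2 : \forall y \near chart i z, loc (psi S) i i y = y.
    have := @nbhs_chart_inv _ _ _ A i (chart i z) [set p | psi S p = p] (chart_in iz).
    rewrite chartK // => /(_ Sz); apply: filterS => y [iy Sy]; exact: loc_fix.
  have [r r0 Hr] := (near_ballP _ _).2 (filterI N1 N2).
  have v1 : 0 < 1 + `|v| by rewrite ltr_wpDr.
  (* Scales [v] to fit into a ball about [chart i z] on which [psi S] is the identity; the estimate
     is homogeneous in [h]. *)
  pose h := r / (1 + `|v|).
  have h0 : 0 < h by rewrite divr_gt0.
  have zr : `|chart i z - chart i z| < r by rewrite subrr normr0.
  have zr' : `|chart i z + h *: v - chart i z| < r.
    rewrite addrAC subrr add0r normrZ gtr0_norm // /h mulrAC ltr_pdivrMr //.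
    by rewrite ltr_pM2l // ltr_pwDl.
  have [y1 f1] := Hr _ zr; have [y2 f2] := Hr _ zr'.
  have E : chart i z + h *: v - chart i z = h *: v by rewrite addrAC subrr add0r.
  clearbody h; have := Hd _ _ y2 y1; rewrite f1 f2 -/L E -scalemxAl -scalerBr !normrZ.
  by rewrite (gtr0_norm h0) mulrCA ler_pM2l.
apply/row_matrixP => k; rewrite [in RHS]rowE mulmx1 rowE.
apply/esym/eqP; rewrite -subr_eq0 -normr_le0; apply/ler_addgt0Pl => e e0; rewrite addr0.
set v : 'rV_n := delta_mx 0 k.
have v1 : 0 < 1 + `|v| by rewrite ltr_wpDr.
apply: le_trans (K (e / (1 + `|v|)) v (divr_gt0 e0 v1)) _.
by rewrite mulrAC ler_pdivrMr // ler_wpM2l ?(ltW e0) // lerDr.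
Qed.

End common_period.

(** * Emptiness of the set of bad points *)

Section wadsley.
Context {R : realType} {n : nat} {M : topologicalType}.
Variables (A : smooth_atlas R n M) (eta : one_form A) (xi : vector_field A)
  (psi : R -> M -> M).
Hypothesis reeb_xi : is_reeb eta xi.
Hypothesis flow_psi : is_flow xi psi.
Hypothesis hM : hausdorff_space M.
Hypothesis cM : compact [set: M].
Hypothesis regular_psi : regular psi.
Implicit Types (i j l : chart_index A) (x y v w : 'rV[R]_n) (s t T : R) (p q : M).

Let psi0 := flow0 flow_psi.
Let psiD := flowD flow_psi.
Let psi_cts := flow_cts flow_psi.

Variable e0 : R.
Hypothesis e0_gt0 : 0 < e0.
Hypothesis e0_min : forall p t, 0 < t < e0 -> psi t p <> p.

Let mper := tau psi_cts hM e0_gt0 e0_min regular_psi.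

Lemma mper_gt0 p : 0 < mper p.
Proof. exact: tau_gt0. Qed.

Lemma mper_fix p : psi (mper p) p = p.
Proof. exact: tau_fix. Qed.

Lemma mper_multiple p t : 0 < t -> psi t p = p ->
  exists2 k : nat, (0 < k)%N & t = k%:R * mper p.
Proof. exact: tau_multiple_gt0. Qed.

(** The bad points, those outside this open set, are what the category argument excludes. *)
Definition good_point := [set p | exists2 S, 0 < S & Ifix psi S p].

Lemma open_good : open good_point.
Proof.
rewrite openE => p [S S0 Sp].
have oS : nbhs p (Ifix psi S) by apply: open_nbhs_nbhs; split=> //; exact: open_Ifix.
by apply: filterS oS => q Sq; exists S.
Qed.

(** At a point [z] common to both interiors, [S] and [S'] are multiples [a] and [b] of one minimal
    period, so [b S = a S']. Hence [psi (b S)] is the identity near [q]; as [psi S] has identity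
    differential at [q], [periodic_near_identity] makes it the identity near [q]. *)
Lemma Ifix_extend S q : 0 < S -> closure (Ifix psi S) q -> good_point q -> Ifix psi S q.
Proof.
move=> S0 cq [S' S'0 S'q].
have [z [Sz S'z]] : (Ifix psi S `&` Ifix psi S') !=set0.
  by apply: cq; apply: open_nbhs_nbhs; split=> //; exact: open_Ifix.
have [a a0 Ea] := mper_multiple S0 (Ifix_fix Sz).
have [b b0 Eb] := mper_multiple S'0 (Ifix_fix S'z).
have Sq := closure_Ifix_fix flow_psi hM cq.
have [i iq] := chart_cover A q.
have JT := closure_Ifix_jac flow_psi hM iq cq.
have N := periodic_near_identity flow_psi iq Sq JT b0.
apply: filterS2 N S'q => p Np S'p; apply: Np.
have -> : b%:R * S = a%:R * S' by rewrite Ea Eb; ring.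
exact: flow_mulr.
Qed.

(** By [Ifix_extend], [Ifix psi S] is closed as well as open among the good points. *)
Lemma Ifix_connected S (C : set M) p : 0 < S -> connected C -> C `<=` good_point ->
  C p -> Ifix psi S p -> C `<=` Ifix psi S.
Proof.
move=> S0 cC CG Cp Sp.
have <- : C `&` Ifix psi S = C.
  apply: cC.
  - by exists p.
  - by exists (Ifix psi S) => //; exact: open_Ifix.
  - exists (closure (Ifix psi S)); first exact: closed_closure.
    apply/seteqP; split=> q [Cq Hq]; split=> //; first exact: subset_closure.
    by apply: Ifix_extend => //; exact: CG.
by move=> q [].
Qed.

Lemma Ifix_segment S i (a b : 'rV[R]_n) : 0 < S ->
  (forall u : R, 0 <= u <= 1 -> chart_img i (a + u *: (b - a)) /\
     good_point (chart_inv i (a + u *: (b - a)))) ->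
  Ifix psi S (chart_inv i a) -> Ifix psi S (chart_inv i b).
Proof.
move=> S0 H Sa.
pose g (u : R) := chart_inv i (a + u *: (b - a)).
have g0 : g 0 = chart_inv i a by rewrite /g scale0r addr0.
have g1 : g 1 = chart_inv i b by rewrite /g scale1r addrC subrK.
have cg : connected (g @` `[0, 1]).
  apply: connected_continuous_connected; first exact: segment_connected.
  apply: continuous_in_subspaceT => u; rewrite inE /= in_itv /= => /H [iu _].
  apply: (@continuous_comp _ _ _ (fun u : R => a + u *: (b - a)) (chart_inv i)).
    apply: cvgD; first exact: cvg_cst.
    by apply: cvgZl; exact: cvg_id.
  exact: chart_inv_cts.
have := @Ifix_connected S _ (chart_inv i a) S0 cg.
move=> /(_ _ _ Sa); rewrite -g1; apply.
- by move=> _ [u /= + <-]; rewrite in_itv /= => /H [].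
- by exists 0; rewrite ?g0 //= in_itv /= lexx ler01.
- by exists 1 => //=; rewrite in_itv /= lexx ler01.
Qed.

(* The bad points near [q] lie in a thin cone around the hyperplane [ell = 0],
   so a line in direction [w] meets them at most once: every point near [q] has
   one of two periods, and these are both periods of [q]. *)
Lemma thin_cone_good i q (ell : 'rV[R]_n -> R) w (C k d : R) :
  chart_dom i q -> ~ good_point q ->
  (forall v v', ell (v + v') = ell v + ell v') -> (forall c v, ell (c *: v) = c * ell v) ->
  0 < C -> (forall v, `|ell v| <= C * `|v|) ->
  `|w| <= 1 -> ell w = k -> 0 < k -> 0 < d ->
  (forall y, `|y - chart i q| < d -> chart_img i y) ->
  (forall y y', `|y - chart i q| < d -> `|y' - chart i q| < d ->
    ~ good_point (chart_inv i y) -> ~ good_point (chart_inv i y') ->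
    `|ell (y - y')| <= k / 4 * `|y - y'|) ->
  good_point q.
Proof.
set x0 := chart i q; move=> iq Nq ellD ellZ C0 ellC w1 ellw k0 d0 img thin.
have Nx0 : ~ good_point (chart_inv i x0) by rewrite chartK.
have x0d : `|x0 - x0| < d by rewrite subrr normr0.
have far y : `|y - x0| < d -> k / 4 * d <= `|ell (y - x0)| -> good_point (chart_inv i y).
  move=> yd ky; apply: contrapT => Ny.
  have := thin _ _ yd x0d Ny Nx0; apply/negP; rewrite -ltNge.
  by apply: lt_le_trans ky; rewrite ltr_pM2l // divr_gt0.
(* With [r <= d / 4], moves by at most [d / 2] along [w] stay in the ball of radius [d]. With
   [C * r <= k * d / 16], [ell] changes by so little that the far ends, where it has moved by
   [k * d / 2], satisfy the bound in [far]. *)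
pose r := Num.min (d / 4) (k * d / (16 * C)).
have r0 : 0 < r by rewrite lt_min !divr_gt0 // mulr_gt0.
have r1 : r <= d / 4 by rewrite ge_min lexx.
have r2 : C * r <= k * d / 16.
  apply: (@le_trans _ _ (C * (k * d / (16 * C)))); first by rewrite ler_pM2l // ge_min lexx orbT.
  rewrite le_eqVlt; apply/orP; left; apply/eqP.
  by field; rewrite gt_eqF.
clearbody r.
have kd0 : 0 < k * d by rewrite mulr_gt0.
have line (sg : R) (y : 'rV[R]_n) (u : R) : `|sg| = 1 -> `|y - x0| < r -> 0 <= u <= d / 2 ->
    `|y + u *: (sg *: w) - x0| < d.
  move=> s1 yr /andP[u0 u1]; rewrite addrAC.
  apply: le_lt_trans (ler_normD _ _) _.
  rewrite !normrZ s1 mul1r ger0_norm //.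
  have : u * `|w| <= u by rewrite ler_piMr.
  lra.
(* The far ends of the segments in direction [sg *: w] fill a convex set of good points, so one [S]
   serves them all. It propagates back along any segment of good points and reaches its end [y] by
   closure. *)
have key (sg : R) : `|sg| = 1 -> exists2 S, 0 < S & forall y, `|y - x0| < r ->
    (forall u, 0 < u <= d / 2 -> good_point (chart_inv i (y + u *: (sg *: w)))) ->
    psi S (chart_inv i y) = chart_inv i y.
  move=> s1; pose P := x0 + (d / 2) *: (sg *: w).
  have d2 : 0 <= d / 2 <= d / 2 by rewrite lexx divr_ge0 // ltW.
  have x0r : `|x0 - x0| < r by rewrite subrr normr0.
  have goodP (v : 'rV[R]_n) : `|v| < r -> good_point (chart_inv i (x0 + v + (d / 2) *: (sg *: w))).
    move=> vr; have vr' : `|x0 + v - x0| < r by rewrite addrAC subrr add0r.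
    apply: far; first exact: line.
    have -> : x0 + v + (d / 2) *: (sg *: w) - x0 = v + (d / 2) *: (sg *: w).
      by rewrite addrAC (addrAC x0) subrr add0r.
    rewrite ellD !ellZ ellw.
    have A1 : `|d / 2 * (sg * k)| = d * k / 2.
      by rewrite !normrM s1 mul1r (gtr0_norm k0) (gtr0_norm d0) gtr0_norm ?invr_gt0 //; lra.
    have A2 : `|ell v| <= k * d / 16.
      apply: le_trans (ellC v) _; apply: le_trans r2.
      by rewrite ler_pM2l // ltW.
    have := lerB_normD (d / 2 * (sg * k)) (ell v); rewrite A1 [_ + ell v]addrC.
    lra.
  have [S S0 HS] : good_point (chart_inv i P).
    by have := goodP 0; rewrite normr0 addr0; apply.
  exists S => // y yr Hy.
  have S1 : Ifix psi S (chart_inv i (y + (d / 2) *: (sg *: w))).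
    apply: (@Ifix_segment S i P _ S0 _ HS) => u /andP[u0 u1].
    have -> : P + u *: (y + (d / 2) *: (sg *: w) - P) =
        x0 + u *: (y - x0) + (d / 2) *: (sg *: w).
      by rewrite /P opprD addrACA subrr addr0 addrAC.
    have vr : `|u *: (y - x0)| < r.
      rewrite normrZ ger0_norm //; apply: le_lt_trans yr; exact: ler_piMl.
    split; last exact: goodP.
    by apply: img; apply: line => //; rewrite addrAC subrr add0r.
  have S2 (u : R) : 0 < u <= d / 2 -> Ifix psi S (chart_inv i (y + u *: (sg *: w))).
    move=> /andP[u0 u1].
    apply: (@Ifix_segment S i _ _ S0 _ S1) => h /andP[h0 h1].
    have -> : y + (d / 2) *: (sg *: w) + h *: (y + u *: (sg *: w) - (y + (d / 2) *: (sg *: w))) =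
       y + (d / 2 + h * (u - d / 2)) *: (sg *: w).
      by rewrite opprD addrACA subrr add0r -scalerBl (scalerA h) -addrA -scalerDl.
    have H1 : 0 < d / 2 + h * (u - d / 2) <= d / 2.
      have : 0 <= h * (d / 2 - u) by rewrite mulr_ge0 // subr_ge0.
      have : h * (d / 2 - u) <= d / 2 - u by rewrite ler_piMl // subr_ge0.
      by have -> : h * (u - d / 2) = - (h * (d / 2 - u)) by [ring]; lra.
    split; last exact: Hy.
    by apply: img; apply: line => //; case/andP: H1 => /ltW -> ->.
  apply: (closure_Ifix_fix flow_psi hM) => B By.
  have iy : chart_img i y by apply: img; apply: lt_le_trans yr _; lra.
  have [r' r'0 Hr'] := (near_ballP _ _).2 (nbhs_chart_inv iy By).
  pose u := Num.min (d / 2) (r' / 2).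
  have u0 : 0 < u by rewrite lt_min !divr_gt0.
  exists (chart_inv i (y + u *: (sg *: w))); split.
    by apply: S2; rewrite u0 ge_min lexx.
  apply: (Hr' _ _).2; rewrite addrAC subrr add0r !normrZ s1 mul1r gtr0_norm //.
  have : u * `|w| <= u by rewrite ler_piMr // ltW.
  have : u <= r' / 2 by rewrite ge_min lexx orbT.
  lra.
have n1 : `|1 : R| = 1 by rewrite normr1.
have n1' : `|-1 : R| = 1 by rewrite normrN1.
have [Sp Sp0 HSp] := key 1 n1; have [Sm Sm0 HSm] := key (-1) n1'.
(* Two bad points on opposite rays differ by [(u + u') *: w], on which [ell] is too large for
   [thin]. One of [u], [u'] may be zero: this covers the centre [x0], itself bad. *)
have once y (u u' : R) : `|y - x0| < r -> 0 <= u <= d / 2 -> 0 <= u' <= d / 2 -> 0 < u + u' ->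
    ~ good_point (chart_inv i (y + u *: (1 *: w))) ->
    ~ good_point (chart_inv i (y + u' *: (-1 *: w))) -> False.
  move=> yr ud ud' uu b1 b2.
  have := thin _ _ (line 1 y u n1 yr ud) (line (-1) y u' n1' yr ud') b1 b2.
  have -> : y + u *: (1 *: w) - (y + u' *: (-1 *: w)) = (u + u') *: w.
    rewrite opprD addrACA subrr add0r scale1r scaleN1r scalerN opprK.
    by rewrite -scalerDl.
  rewrite ellZ ellw normrM normrZ (gtr0_norm uu) (gtr0_norm k0).
  apply/negP; rewrite -ltNge.
  apply: (@le_lt_trans _ _ (k / 4 * (u + u'))).
    rewrite ler_wpM2l ?divr_ge0 ?(ltW k0) //.
    by rewrite ler_piMr // ltW.
  rewrite [ltRHS]mulrC ltr_pM2r //; lra.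
have x0r : `|x0 - x0| < r by rewrite subrr normr0.
have z0 : (0 : R) <= 0 <= d / 2 by rewrite lexx divr_ge0 // ltW.
have qp : psi Sp q = q.
  rewrite -(chartK iq); apply: HSp => // u /andP[u0 ud]; apply: contrapT => b1.
  apply: (once x0 u 0 x0r _ z0 _ b1); rewrite ?scale0r ?addr0 // ?u0 //.
  by rewrite (ltW u0).
have qm : psi Sm q = q.
  rewrite -(chartK iq); apply: HSm => // u /andP[u0 ud]; apply: contrapT => b1.
  apply: (once x0 0 u x0r z0 _ _ _ b1); rewrite ?scale0r ?addr0 ?add0r // ?u0 //.
  by rewrite (ltW u0).
have [a a0 Ea] := mper_multiple Sp0 qp.
have [b b0 Eb] := mper_multiple Sm0 qm.
exists (b%:R * Sp); first by rewrite mulr_gt0 // ltr0n.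
have := chart_ball iq r0; apply: filterS => p [ip pr].
(* By [once], at most one of the two rays from [p] meets a bad point, so [Sp] or [Sm] is a period of
   [p]; both divide [b Sp = a Sm]. *)
have [up|Nup] := pselect (forall u : R, 0 < u <= d / 2 -> good_point (chart_inv i (chart i p + u *: (1 *: w)))).
  apply: (flow_mulr psi0 psiD).
  by have := HSp _ pr up; rewrite chartK.
have -> : b%:R * Sp = a%:R * Sm by rewrite Ea Eb; ring.
apply: (flow_mulr psi0 psiD).
have : psi Sm (chart_inv i (chart i p)) = chart_inv i (chart i p).
  apply: HSm => // u' /andP[u'0 u'd]; apply: contrapT => b2; apply: Nup => u /andP[u0 ud].
  apply: contrapT => b1; apply: (once (chart i p) u u' pr _ _ _ b1 b2).
  - by rewrite (ltW u0).
  - by rewrite (ltW u'0).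
  - exact: addr_gt0.
by rewrite chartK.
Qed.

(* The window of periods is shorter than any period, so a point has at most
   one period in it. *)
Section window.
Variables (V : set M) (s : R).
Hypothesis oV : open V.
Let win t := s - e0 / 2 < t <= s.

(** [K] collects the times of the closed window at distance at least [d] from [T]. A period of [q]
    in [K] would differ from [T] by a nonzero amount of at most [e0 / 2], giving a period below
    [e0]; having no period in a compact set is an open condition. *)
Lemma window_continuity q T d : psi T q = q -> win T -> 0 < d ->
  \forall p \near q, forall t, win t -> psi t p = p -> `|t - T| < d.
Proof.
move=> Tq /andP[T1 T2] d0.
pose K := `[s - e0 / 2, s]%classic `&` ~` [set t | `|t - T| < d].
have oB : open [set t : R | `|t - T| < d].
  have -> : [set t : R | `|t - T| < d] = ball T d.
    by apply/seteqP; split=> t; rewrite -ball_normE /= distrC.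
  exact: ball_open.
have cK : compact K.
  apply: (subclosed_compact _ (@segment_compact _ (s - e0 / 2) s)); last by move=> t [].
  apply: closedI; last exact: open_closedC.
  exact: (compact_closed (@Rhausdorff R) (@segment_compact _ _ _)).
have H t : K t -> psi t q <> q.
  move=> [/= + /negP]; rewrite in_itv /= -leNgt => /andP[t1 t2] tT tq.
  have dq : psi (t - T) q = q by rewrite psiD (flow_opp_fix psi0 psiD Tq).
  have dq' : psi (T - t) q = q by rewrite psiD (flow_opp_fix psi0 psiD tq).
  have ne : t - T != 0 by apply/eqP => E; move: tT; rewrite E normr0; lra.
  case: (ltgtP (t - T) 0) ne => // sg _.
    by apply: (e0_min _ dq'); lra.
  by apply: (e0_min _ dq); lra.
have := near_no_period psi_cts hM cK H.
apply: filterS => p Hp t /andP[wt1 wt2] tp; rewrite ltNge; apply/negP => tT.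
apply: (Hp t) => //; split; first by rewrite /= in_itv /= wt2 ltW.
by rewrite /= => lt; move: tT; rewrite leNgt lt.
Qed.

Lemma window_estimate i q T e : chart_dom i q -> psi T q = q -> win T -> 0 < e ->
  exists2 d, 0 < d & forall y y' t t', `|y - chart i q| < d -> `|y' - chart i q| < d ->
    [/\ chart_img i y, win t & psi t (chart_inv i y) = chart_inv i y] ->
    [/\ chart_img i y', win t' & psi t' (chart_inv i y') = chart_inv i y'] ->
    `|t - t'| <= e * `|y - y'| /\
    `|(y - y') *m (jac (loc (psi T) i i) (chart i q) - 1%:M)| <= e * `|y - y'|.
Proof.
move=> iq Tq wT e1.
have Tq' : psi T (chart_inv i (chart i q)) = chart_inv i (chart i q) by rewrite chartK.
have [d d0 Hd] := period_estimate reeb_xi flow_psi (chart_in iq) Tq' e1.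
have N := window_continuity Tq wT d0.
have N' : \forall y \near chart i q, chart_img i y /\
    (forall t, win t -> psi t (chart_inv i y) = chart_inv i y -> `|t - T| < d).
  have := @nbhs_chart_inv _ _ _ A i (chart i q) (fun p => forall t, win t -> psi t p = p -> `|t - T| < d) (chart_in iq).
  by rewrite chartK // => /(_ N).
have [r r0 Hr] := (near_ballP _ _).2 N'.
exists (Num.min d r) => [|y y' t t']; first by rewrite lt_min d0.
rewrite !lt_min => /andP[yd yr] /andP[yd' yr'] [iy wt ty] [iy' wt' ty'].
have [_ Hy] := Hr _ yr; have [_ Hy'] := Hr _ yr'.
apply: Hd => //; rewrite ?loc_fix //; first exact: Hy.
exact: Hy'.
Qed.

(** By [window_estimate], the period in the window, as a function on the chart ball, has strict
    derivative zero. It is therefore constant, and one positive time fixes a neighbourhood of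
    [q]. *)
Lemma window_all_good i q d : chart_dom i q -> 0 < d ->
  (forall y, `|y - chart i q| < d -> chart_img i y /\
     exists t, win t /\ psi t (chart_inv i y) = chart_inv i y) ->
  0 < s - e0 / 2 -> good_point q.
Proof.
move=> iq d0 H s0; set x0 := chart i q.
have ch y : {t | `|y - x0| < d -> win t /\ psi t (chart_inv i y) = chart_inv i y}.
  apply: cid; have [/H[_ [t Ht]]|] := boolP (`|y - x0| < d); first by exists t.
  by exists 0.
pose f y := sval (ch y).
have fP y : `|y - x0| < d -> win (f y) /\ psi (f y) (chart_inv i y) = chart_inv i y.
  by rewrite /f; case: (ch y).
have sf z : `|z - x0| < d -> sdiff f z (fun=> 0 : R).
  move=> zd e e1.
  have [wz fz] := fP z zd; have [iz _] := H z zd.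
  have [r r0 Hr] := window_estimate (chart_inv_in iz) fz wz e1.
  rewrite chart_invK // in Hr.
  exists (Num.min r (d - `|z - x0|)) => [|y y']; first by rewrite lt_min r0 subr_gt0.
  rewrite !lt_min => /andP[yr yd] /andP[yr' yd'].
  have B u : `|u - z| < d - `|z - x0| -> `|u - x0| < d.
    move=> uz; rewrite -(subrKA z) (le_lt_trans (ler_normD _ _)) //.
    by rewrite -ltrBrDr.
  have [[wy fy] [wy' fy']] := (fP _ (B _ yd), fP _ (B _ yd')).
  have [iy _] := H _ (B _ yd); have [iy' _] := H _ (B _ yd').
  have -> : lincomb (fun=> 0 : R) (y - y') = 0.
    by rewrite /lincomb big1 // => k _; rewrite scaler0.
  by rewrite subr0; have [] := Hr y y' (f y) (f y') yr yr' (And3 iy wy fy) (And3 iy' wy' fy').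
have fE y : `|y - x0| < d -> f y = f x0.
  move=> yd.
  have : `|f (x0 + 1 *: (y - x0)) - f x0 - 1 * 0| <= 0 * `|1 : R|.
    apply: mvt_line => u; rewrite normr1 => u1.
    have ud : `|x0 + u *: (y - x0) - x0| < d.
      rewrite addrAC subrr add0r normrZ; apply: le_lt_trans yd.
      by rewrite ler_piMl.
    have [D1 D2] := sdiff_is_derive (y - x0) (sf _ ud).
    split=> //; rewrite D2 /lincomb big1 ?subrr ?normr0 // => k _.
    by rewrite scaler0.
  rewrite mul0r mulr0 subr0 normr_le0 subr_eq0 scale1r => /eqP <-.
  by rewrite addrC subrK.
have x0d : `|x0 - x0| < d by rewrite subrr normr0.
have [/andP[w1 w2] _] := fP _ x0d.
exists (f x0); first exact: lt_trans w1.
have := chart_ball iq d0; apply: filterS => p [ip pd].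
by have [_] := fP _ pd; rewrite fE // chartK.
Qed.

Hypothesis bad_win : forall q, V q -> ~ good_point q -> win (mper q).
Hypothesis s_gt : 0 < s - e0 / 2.

(** If some entry of [L - 1] is nonzero, its column defines a linear form [ell] that
    [window_estimate] makes small on differences of bad points near [q]. The bad points then lie in
    a thin cone, and [thin_cone_good] makes [q] good. *)
Lemma bad_point_jac i q : V q -> ~ good_point q -> chart_dom i q ->
  jac (loc (psi (mper q)) i i) (chart i q) = 1%:M.
Proof.
move=> Vq Nq iq; apply: contrapT => NL.
set x0 := chart i q; set L := jac _ _ in NL.
have [a [c ac]] : exists a c, (L - 1%:M) a c != 0.
  apply: contrapT => H; apply: NL; apply/matrixP => a c; apply/eqP.
  rewrite -subr_eq0; apply/negP => /negP ac; apply: H; exists a, c.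
  by move: ac; rewrite !mxE.
pose ell v := (v *m (L - 1%:M)) 0 c.
have ell_le v : `|ell v| <= `|v *m (L - 1%:M)| by exact: mx_norm_coord.
have [C C0 HC] := mulmx_bound (L - 1%:M).
set k0 := (L - 1%:M) a c in ac.
have k0' : 0 < `|k0| by rewrite normr_gt0.
have k4 : 0 < `|k0| / 4 by rewrite divr_gt0.
have [d1 d10 Hd1] := window_estimate iq (mper_fix q) (bad_win Vq Nq) k4.
have N : \forall y \near chart i q, chart_img i y /\ V (chart_inv i y).
  have := @nbhs_chart_inv _ _ _ A i (chart i q) V (chart_in iq).
  by rewrite chartK //; apply; exact: open_nbhs_nbhs.
have [d2 d20 Hd2] := (near_ballP _ _).2 N.
apply: (Nq); apply: (@thin_cone_good i q ell (Num.sg k0 *: delta_mx 0 a) C `|k0| (Num.min d1 d2)) => //.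
- by move=> v v'; rewrite /ell mulmxDl mxE.
- by move=> c' v; rewrite /ell -scalemxAl mxE.
- by move=> v; exact: le_trans (ell_le v) (HC v).
- rewrite normrZ; apply: (@le_trans _ _ (1 * 1)); last by rewrite mulr1.
  apply: ler_pM => //; first by rewrite normr_sg; case: (k0 != 0).
  apply: rV_norm_le => // m; rewrite mxE eqxx /=.
  by case: (m == a); rewrite ?normr1 ?normr0.
- by rewrite /ell -scalemxAl -rowE [LHS]mxE [X in _ * X]mxE -/k0 -normrEsg.
- by rewrite lt_min d10.
- by move=> y; rewrite lt_min => /andP[_ /Hd2[]].
- move=> y y'; rewrite !lt_min => /andP[y1 /Hd2[iy Vy]] /andP[y1' /Hd2[iy' Vy']] Ny Ny'.
  apply: le_trans (ell_le _) _.
  have [] // := Hd1 y y' (mper (chart_inv i y)) (mper (chart_inv i y')) y1 y1'.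
    by split=> //; [exact: bad_win|exact: mper_fix].
  by split=> //; [exact: bad_win|exact: mper_fix].
Qed.

(* A point [x] near [p] has the minimal period of the first bad point met on the
   way from [x] to [p]. *)
Lemma window_good p : V p -> good_point p.
Proof.
move=> Vp; apply: contrapT => Np.
have [i ip] := chart_cover A p.
set x0 := chart i p.
have N : \forall y \near x0, chart_img i y /\ V (chart_inv i y).
  have := @nbhs_chart_inv _ _ _ A i x0 V (chart_in ip).
  by rewrite chartK //; apply; exact: open_nbhs_nbhs.
have [d d0 Hd] := (near_ballP _ _).2 N.
apply: (Np); apply: (window_all_good ip d0) => // x xd.
have [ix Vx] := Hd _ xd; split=> //.
have [Gx|Nx] := pselect (good_point (chart_inv i x)); last first.
  by exists (mper (chart_inv i x)); split; [exact: bad_win|exact: mper_fix].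
pose Y (u : R) := x + u *: (x0 - x).
have Yd (u : R) : 0 <= u <= 1 -> `|Y u - x0| < d.
  move=> /andP[u0 u1].
  have -> : Y u - x0 = (1 - u) *: (x - x0).
    by rewrite /Y scalerBl scale1r !scalerBr opprB addrAC.
  rewrite normrZ ger0_norm ?subr_ge0 //; apply: le_lt_trans xd.
  by rewrite ler_piMl // lerBlDr lerDl.
have Y0 : Y 0 = x by rewrite /Y scale0r addr0.
have Y1 : Y 1 = x0 by rewrite /Y scale1r addrC subrK.
have Yc (u : R) : 0 <= u <= 1 -> {for u, continuous (fun u => chart_inv i (Y u))}.
  move=> /Yd /Hd [iu _]; apply: (@continuous_comp _ _ _ Y (chart_inv i)); last exact: chart_inv_cts.
  apply: cvgD; first exact: cvg_cst.
  by apply: cvgZl; exact: cvg_id.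
(* The infimum of the bad parameters is itself bad, as the good points form an open set: [Y us] is
   the first bad point on the way from [x] to [p]. *)
pose U := [set u : R | 0 <= u <= 1 /\ ~ good_point (chart_inv i (Y u))].
have U1 : U 1 by split; [rewrite ler01 lexx|rewrite Y1 chartK].
have hU : has_inf U by split; [exists 1|exists 0 => u [/andP[]]].
pose us := inf U.
have us0 : 0 <= us by apply: lb_le_inf; [exists 1|move=> u [/andP[]]].
have us1 : us <= 1 by apply: ge_inf => //; exists 0 => u [/andP[]].
have us01 : 0 <= us <= 1 by rewrite us0.
have below (u : R) : 0 <= u < us -> good_point (chart_inv i (Y u)).
  move=> /andP[u0 u1]; apply: contrapT => Nu.
  have : us <= u.
    apply: ge_inf; first by exists 0 => v [/andP[]].
    by split=> //; rewrite u0 (le_trans (ltW u1)).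
  by rewrite leNgt u1.
set q := chart_inv i (Y us).
have Nq : ~ good_point q.
  move=> Gq.
  have /(Yc us us01) : nbhs q good_point by apply: open_nbhs_nbhs; split=> //; exact: open_good.
  move=> /nbhs_normP[h /= h0 Hh].
  have [u [u01 Nu] uh] := inf_adherent h0 hU.
  apply: (Nu); apply: Hh; rewrite /ball_ /= distrC ger0_norm ?ltrBlDl //.
  by rewrite subr_ge0; apply: ge_inf; [exists 0 => v [/andP[]]|split].
have [iy Vq] := Hd _ (Yd us us01).
have iq : chart_dom i q by exact: chart_inv_in.
have uspos : 0 < us.
  rewrite lt_neqAle us0 andbT; apply/eqP => E; apply: Nq.
  by rewrite /q -E Y0.
have [S S0 HS] := Gx.
have seg (a b : R) T : 0 <= a < us -> 0 <= b < us -> 0 < T ->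
    Ifix psi T (chart_inv i (Y a)) -> Ifix psi T (chart_inv i (Y b)).
  move=> /andP[a0 a1] /andP[b0 b1] T0; apply: Ifix_segment => // u /andP[u0 u1].
  have -> : Y a + u *: (Y b - Y a) = Y (a + u * (b - a)).
    by rewrite /Y opprD addrACA subrr add0r -scalerBl scalerA -addrA -scalerDl.
  have : 0 <= (1 - u) * a by rewrite mulr_ge0 // subr_ge0.
  have : 0 <= u * b by rewrite mulr_ge0.
  have : u * (us - b) + (1 - u) * (us - a) > 0.
    have [->|u0'] := eqVneq u 0; first by rewrite mul0r add0r subr0 mul1r subr_gt0.
    by rewrite ltr_pwDl ?mulr_gt0 ?mulr_ge0 ?subr_gt0 ?subr_ge0 // ?lt_neqAle 1?eq_sym ?u0' // ltW.
  have -> : u * (us - b) + (1 - u) * (us - a) = us - (a + u * (b - a)) by ring.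
  rewrite subr_gt0 => A1 A2 A3.
  have A4 : 0 <= a + u * (b - a).
    by have -> : a + u * (b - a) = (1 - u) * a + u * b by [ring]; exact: addr_ge0.
  split; last by apply: below; rewrite A4.
  by apply: (Hd _ (Yd _ _)).1; rewrite A4 (le_trans (ltW A1)).
have zin : 0 <= (0 : R) < us by rewrite lexx.
have HY (u : R) : 0 <= u < us -> Ifix psi S (chart_inv i (Y u)).
  by move=> uu; apply: (seg 0 u) => //; rewrite Y0.
have near_q (P : M -> Prop) : (\forall z \near q, P z) -> exists2 u : R, 0 <= u < us & P (chart_inv i (Y u)).
  move=> /(Yc us us01) /nbhs_normP[h /= h0 Hh].
  exists (us - Num.min us (h / 2)).
    rewrite subr_ge0 ge_min lexx /= ltrBlDr ltrDl lt_min uspos divr_gt0 //.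
  apply: Hh; rewrite /ball_ /= opprB addrCA subrr addr0 gtr0_norm ?lt_min ?uspos ?divr_gt0 //.
  have : Num.min us (h / 2) <= h / 2 by rewrite ge_min lexx orbT.
  move: h0; rewrite /=; lra.
have cq : closure (Ifix psi S) q.
  by move=> B /near_q[u uu Bu]; exists (chart_inv i (Y u)); split=> //; exact: HY.
have [m m0 Em] := mper_multiple S0 (closure_Ifix_fix flow_psi hM cq).
(* [S] is a multiple of [mper q], and [psi (mper q)] has identity differential at [q]. So near [q]
   the points fixed by [psi S] are fixed by [psi (mper q)], which then spreads back to [x] along the
   good part of the segment. *)
have AV := periodic_near_identity flow_psi iq (mper_fix q) (bad_point_jac Vq Nq iq) m0.
have [u uu Hu] : exists2 u : R, 0 <= u < us & Ifix psi (mper q) (chart_inv i (Y u)).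
  have [u uu Au] := near_q _ (nbhs_interior AV); exists u => //.
  by apply: filterS2 Au (HY u uu) => z Az Sz; apply: Az; rewrite -Em.
exists (mper q); split; first exact: bad_win.
by rewrite -Y0; apply: Ifix_fix; apply: (seg u 0) => //; exact: mper_gt0.
Qed.

End window.

(** The category lemma, applied to the bad set and the closed sets [mper q <= k], yields an open [V]
    in which the periods of bad points are bounded. Removing the closed set of points with period at
    most [sup S - e0 / 2] leaves an open set whose bad points have their periods in a window of
    length [e0 / 2]. *)
Lemma all_good p : good_point p.
Proof.
apply: contrapT => Np.
have clB : closed (~` good_point) by apply: open_closedC; exact: open_good.
have clC (k : nat) : closed [set q | mper q <= k%:R].
  exact: (@closed_tau_le _ _ _ psi_cts hM _ e0_gt0 e0_min regular_psi).
have cover q : (~` good_point) q -> exists k : nat, mper q <= k%:R.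
  move=> _; exists (Num.truncn (mper q)).+1.
  by have /andP[_ /ltW] := truncn_itv (ltW (mper_gt0 q)).
have B0 : ~` good_point !=set0 by exists p.
have [k [V [oV [z [Vz Nz]] VB]]] := compact_baire hM cM clB B0 clC cover.
pose S := [set mper q | q in V `&` ~` good_point].
have hS : has_sup S.
  by split; [exists (mper z), z|exists k%:R => _ [q /VB Hq <-]].
have e02 : 0 < e0 / 2 by rewrite divr_gt0.
have [_ [q [Vq Nq] <-] sq] := sup_adherent e02 hS.
pose V' := V `&` ~` [set q | mper q <= sup S - e0 / 2].
have clm : closed [set q | mper q <= sup S - e0 / 2].
  exact: (@closed_tau_le _ _ _ psi_cts hM _ e0_gt0 e0_min regular_psi).
have oV' : open V' by apply: openI => //; exact: closed_openC.
have V'q : V' q by split=> //=; apply/negP; rewrite -ltNge.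
apply: (Nq); apply: (@window_good V' (sup S) oV') => // [x [Vx /negP sx] Nx|].
  rewrite -ltNge in sx; rewrite sx /=.
  by apply: sup_upper_bound => //; exists x.
have : mper q <= sup S by apply: sup_upper_bound => //; exists q.
have : e0 <= mper q by exact: e0_le_tau.
by move: e0_gt0; lra.
Qed.

Lemma common_period_aux : [set: M] !=set0 -> connected [set: M] ->
  exists N, 0 < N /\ forall p, psi N p = p.
Proof.
move=> [p0 _] cnM; have [S S0 Sp] := all_good p0.
exists S; split=> // p.
have := @Ifix_connected S [set: M] p0 S0 cnM (fun q _ => all_good q) I Sp.
by move=> /(_ p I); exact: Ifix_fix.
Qed.

End wadsley.

(* Wadsley's theorem for Reeb flows. *)
Lemma common_period {R : realType} {n : nat} {M : topologicalType}
    (A : smooth_atlas R n M) (eta : one_form A) (xi : vector_field A)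
    (psi : R -> M -> M) :
  closed_connected M -> is_reeb eta xi -> is_flow xi psi -> regular psi ->
  exists N, 0 < N /\ forall p, psi N p = p.
Proof.
move=> [M0 hM _ cM cnM] reeb_xi flow_psi regular_psi.
have [e0 e0_gt0 e0_min] := no_small_period reeb_xi flow_psi cM.
exact: (common_period_aux reeb_xi flow_psi hM cM regular_psi e0_gt0 e0_min M0 cnM).
Qed.

(** * Cochains on the Kuhn triangulation of a torus *)

Section cochains.
Context {R : realType} {P : Type}.
Implicit Types (u : nat -> P) (a b : (nat -> P) -> R) (lam : P -> P -> R).

(* Ordered simplices are given by the first entries of [u : nat -> P]; the
   [i]-th face of [u] is [u \o bump i]. *)
Definition coboundary (k : nat) a u : R := \sum_(i < k) (-1) ^+ i * a (u \o bump i).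

(** The hypothesis says that [a] ignores the vertices after the [p]-th. The right side has two terms
    more than the left: the last face of [a] and the zeroth face of [b], which cancel. *)
Lemma leibniz (p Q : nat) a b u :
  (forall i, (p < i)%N -> a (u \o bump i) = a u) ->
  coboundary (p + Q).+1 (fun u => a u * b (u \o addn p)) u =
  coboundary p.+2 a u * b (u \o addn p.+1) +
  (-1) ^+ p * a u * coboundary Q.+1 b (u \o addn p).
Proof.
move=> Ha; rewrite /coboundary -addSn big_split_ord /=.
have E1 : \sum_(i < p.+1) (-1) ^+ lshift Q i * (a (u \o bump (lshift Q i)) * b ((u \o bump (lshift Q i)) \o addn p)) =
    (\sum_(i < p.+1) (-1) ^+ i * a (u \o bump i)) * b (u \o addn p.+1).
  rewrite mulr_suml; apply: eq_bigr => i _; rewrite mulrA; congr (_ * b _).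
  apply/funext => j /=; congr u; rewrite /bump leq_eqVlt.
  have := ltn_ord i; rewrite ltnS => ip.
  by rewrite -leq_eqVlt (leq_trans ip (leq_addr _ _)) addSn add1n.
have E2 : \sum_(i < Q) (-1) ^+ rshift p.+1 i * (a (u \o bump (rshift p.+1 i)) * b ((u \o bump (rshift p.+1 i)) \o addn p)) =
    (-1) ^+ p * a u * \sum_(i < Q) (-1) ^+ i.+1 * b ((u \o addn p) \o bump i.+1).
  rewrite mulr_sumr; apply: eq_bigr => i _ /=.
  rewrite Ha; last by rewrite addSn ltnS leq_addr.
  have -> : (u \o bump (p.+1 + i)) \o addn p = (u \o addn p) \o bump i.+1.
    apply/funext => j /=; congr u; rewrite /bump addSn -addnS leq_add2l.
    by rewrite addnCA.
  by rewrite addSn -addnS exprD; ring.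
rewrite E1 E2 [in RHS]big_ord_recr /= [in X in _ = _ + X]big_ord_recl /=.
rewrite expr0 mul1r Ha //.
have -> : (u \o addn p) \o bump 0 = u \o addn p.+1.
  by apply/funext => j /=; congr u; rewrite /bump leq0n add1n addnS addSn.
have -> : \sum_(i < Q) (-1) ^+ bump 0 i * b ((u \o addn p) \o bump (bump 0 i)) =
    \sum_(i < Q) (-1) ^+ i.+1 * b ((u \o addn p) \o bump i.+1).
  by apply: eq_bigr => i _; rewrite /(bump 0) leq0n add1n.
by rewrite exprS; ring.
Qed.

(** The coboundary of the 1-cochain [lam], that is, the curvature of a connection form. *)
Definition dlam lam u : R := lam (u 0%N) (u 1%N) + lam (u 1%N) (u 2%N) - lam (u 0%N) (u 2%N).

Lemma dlam_closed lam u : coboundary 4 (dlam lam) u = 0.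
Proof. by rewrite /coboundary !big_ord_recr big_ord0 /= /dlam /bump /=; ring. Qed.

Lemma dlam_bump lam u i : (2 < i)%N -> dlam lam (u \o bump i) = dlam lam u.
Proof. by case: i => [|[|[|i]]]. Qed.

(** The Alexander-Whitney product of the curvatures: the [r]-th factor reads the vertices [2 r],
    [2 r + 1] and [2 r + 2]. *)
Fixpoint cup_prod (ls : seq (P -> P -> R)) u : R :=
  if ls is lam :: ls' then dlam lam u * cup_prod ls' (u \o addn 2) else 1.

Lemma cup_prod_closed ls u : coboundary (size ls).*2.+2 (cup_prod ls) u = 0.
Proof.
elim: ls u => [|lam ls IH] u /=.
  by rewrite /coboundary !big_ord_recr big_ord0 /=; ring.
have -> : (size ls).+1.*2.+2 = (2 + (size ls).*2.+1).+1 by rewrite doubleS.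
rewrite (@leibniz 2 _ (dlam lam) (cup_prod ls)); last by move=> i; exact: dlam_bump.
by rewrite dlam_closed IH mul0r mulr0 addr0.
Qed.

(* A primitive of the difference of two products of cohomologous cocycles. *)
Fixpoint cup_primitive lam0 (ls : seq (P -> P -> R)) u : R :=
  if ls is lam :: ls' then
    (lam (u 0%N) (u 1%N) - lam0 (u 0%N) (u 1%N)) * cup_prod ls' (u \o addn 1) +
    dlam lam0 u * cup_primitive lam0 ls' (u \o addn 2)
  else 0.

Lemma coboundaryD k a b u :
  coboundary k (fun u => a u + b u) u = coboundary k a u + coboundary k b u.
Proof. by rewrite -big_split; apply: eq_bigr => i _; rewrite mulrDr. Qed.

(** The factors are replaced one at a time. The difference of two of them is the coboundary of
    [lam - lam0] and all other factors are closed, so the Leibniz rule leaves a telescoping sum. *)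
Lemma cup_primitiveP lam0 ls u :
  coboundary (size ls).*2.+1 (cup_primitive lam0 ls) u =
  cup_prod ls u - cup_prod (nseq (size ls) lam0) u.
Proof.
elim: ls u => [|lam ls IH] u /=.
  by rewrite /coboundary big1 ?subrr // => i _; rewrite mulr0.
rewrite coboundaryD.
have -> : (size ls).+1.*2.+1 = (1 + (size ls).*2.+1).+1 by rewrite doubleS.
rewrite (@leibniz 1 _ (fun u => lam (u 0%N) (u 1%N) - lam0 (u 0%N) (u 1%N)) (cup_prod ls)); last first.
  by move=> [|[|i]].
rewrite cup_prod_closed mulr0 addr0.
have -> : (1 + (size ls).*2.+1).+1 = (2 + (size ls).*2).+1 by [].
rewrite (@leibniz 2 _ (dlam lam0) (cup_primitive lam0 ls)); last by move=> i; exact: dlam_bump.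
rewrite dlam_closed mul0r add0r IH.
rewrite /coboundary !big_ord_recr big_ord0 /= /dlam /bump /=; ring.
Qed.

Section shift.
Variables (T : P -> P) (adj : P -> P -> Prop).
Let inv1 (f : P -> P -> R) := forall x y, adj x y -> f (T x) (T y) = f x y.
Let inv2 lam := forall u, adj (u 0%N) (u 1%N) -> adj (u 1%N) (u 2%N) -> adj (u 0%N) (u 2%N) ->
  dlam lam (T \o u) = dlam lam u.

Lemma cup_prod_shift ls u : (forall lam, List.In lam ls -> inv2 lam) ->
  (forall i j, (i < j <= (size ls).*2)%N -> adj (u i) (u j)) ->
  cup_prod ls (T \o u) = cup_prod ls u.
Proof.
elim: ls u => [//|lam ls IH] u /= H Hu.
rewrite (H lam) //; [|by left|exact: Hu..].
congr (_ * _); rewrite -(IH (u \o addn 2)) //; first by move=> l' Hl'; apply: H; right.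
by move=> i j /= /andP[ij jl]; apply: Hu => /=; lia.
Qed.

(** The connection forms themselves may change under the translation [T]. Their curvatures and
    differences do not, and the primitive is built from these alone. *)
Lemma cup_primitive_shift lam0 ls u : inv2 lam0 ->
  (forall lam, List.In lam ls -> inv2 lam /\ inv1 (fun x y => lam x y - lam0 x y)) ->
  (forall i j, (i < j < (size ls).*2)%N -> adj (u i) (u j)) ->
  cup_primitive lam0 ls (T \o u) = cup_primitive lam0 ls u.
Proof.
move=> H0; elim: ls u => [//|lam ls IH] u /= H Hu.
have [H1 H2] := H lam (or_introl (erefl _)).
rewrite (H2 (u 0%N) (u 1%N)); last exact: Hu.
congr (_ * _ + _).
  apply: (@cup_prod_shift ls (u \o addn 1)); first by move=> l' Hl'; have [] := H l' (or_intror Hl').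
  by move=> i j /andP[ij jl]; apply: Hu => /=; lia.
(* For the last factor, [dlam lam0] reads a vertex outside the range of [Hu], but it is multiplied
   by the empty primitive, which is [0]. *)
case: ls IH H Hu => [|l1 ls] IH H Hu; first by rewrite /= !mulr0.
rewrite (H0 u); [|exact: Hu..]; congr (_ * _).
rewrite -(IH (u \o addn 2)) //; first by move=> l' Hl'; apply: H; right.
by move=> i j /= /andP[ij jl]; apply: Hu => /=; lia.
Qed.

End shift.

End cochains.

(** * The Kuhn triangulation and Stokes' formula *)

Section kuhn.
Context {R : realType}.
Variables (d' n' : nat).
Let d := d'.+1.
Let n := n'.+1.
Implicit Types (v x y : 'I_d -> nat) (s : 'S_d) (m : 'I_d).

(* The [i]-th vertex of the simplex of the Kuhn triangulation of [v + [0, 1]^d]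
   that moves along the axes in the order given by [s]. *)
Definition kuhn v s (i : nat) : 'I_d -> nat := fun m => (v m + ((s^-1)%g m < i))%N.

Definition push m x : 'I_d -> nat := fun k => (x k + (k == m))%N.

(** Carries the face [x m = 0] of the cube [[0, n]^d] to the opposite one; gluing along these
    translations gives the torus. *)
Definition face_shift m x : 'I_d -> nat := fun k => (x k + (k == m) * n)%N.

(** Evaluation on the fundamental chain of the torus. *)
Definition kuhn_sum (f : ('I_d -> nat) -> 'S_d -> R) : R :=
  \sum_(v : {ffun 'I_d -> 'I_n}) \sum_(s : 'S_d) (-1) ^+ s * f (fun m => v m : nat) s.

Lemma kuhn_sum0 (F : finType) (f : F -> ('I_d -> nat) -> 'S_d -> R) :
  kuhn_sum (fun v s => \sum_i f i v s) = \sum_i kuhn_sum (f i).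
Proof.
rewrite /kuhn_sum [RHS]exchange_big /=; apply: eq_bigr => v _.
rewrite [RHS]exchange_big /=; apply: eq_bigr => s _; exact: mulr_sumr.
Qed.

(* Interior faces are shared by two simplices of opposite signs. *)
Lemma kuhn_interior (a : (nat -> 'I_d -> nat) -> R) (i : nat) : (0 < i < d)%N ->
  kuhn_sum (fun v s => a (kuhn v s \o bump i)) = 0.
Proof.
move=> /andP[i0 id]; rewrite /kuhn_sum big1 // => v _.
have i1d : (i.-1 < d)%N by lia.
pose t := tperm (Ordinal i1d) (Ordinal id).
have ne : Ordinal i1d != Ordinal id by rewrite -val_eqE /=; lia.
(* Exchanging the consecutive moves [i.-1] and [i] changes only the vertex [i], which this face
   omits. *)
have K s : kuhn (fun m => v m : nat) (t * s)%g \o bump i = kuhn (fun m => v m : nat) s \o bump i.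
  apply/funext => j; apply/funext => m; rewrite /= /kuhn invMg permM.
  congr (_ + nat_of_bool _)%N; rewrite tpermV /t; move: ((s^-1)%g m) => k.
  case: tpermP => [->|->|//] /=; rewrite /bump; lia.
have E : \sum_(s : 'S_d) (-1) ^+ s * a (kuhn (fun m => v m : nat) s \o bump i) =
   - \sum_(s : 'S_d) (-1) ^+ s * a (kuhn (fun m => v m : nat) s \o bump i) :> R.
  rewrite [LHS](reindex_inj (mulgI t)) /= -sumrN; apply: eq_bigr => s _.
  by rewrite K odd_permM odd_tperm ne signr_addb /= expr1 mulN1r mulNr.
by move/eqP : E; rewrite -addr_eq0 -mulr2n mulrn_eq0 /= => /eqP.
Qed.

(** A unit step along [m] permutes the grid cyclically, as [ordS] does; at the wrap-around the
    hypothesis identifies the values of [f] on the two opposite faces. *)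
Lemma ffun_shift m (f : ('I_d -> nat) -> R) :
  (forall x, (forall k, (x k < n)%N) -> x m = 0%N -> f (face_shift m x) = f x) ->
  \sum_(v : {ffun 'I_d -> 'I_n}) f (push m (fun k => v k : nat)) =
  \sum_(v : {ffun 'I_d -> 'I_n}) f (fun k => v k : nat).
Proof.
move=> H.
pose h (v : {ffun 'I_d -> 'I_n}) : {ffun 'I_d -> 'I_n} :=
  [ffun k => if k == m then ordS (v k) else v k].
have hI : injective h.
  move=> v w /ffunP E; apply/ffunP => k; have := E k; rewrite !ffunE.
  by case: eqP => // _ /ordS_inj.
rewrite [RHS](reindex_inj hI) /=; apply: eq_bigr => v _.
have [vm|vm] := ltnP (v m).+1 n.
  congr f; apply/funext => k; rewrite /push /h ffunE.
  have [->|km] := eqVneq k m; last by rewrite addn0.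
  by rewrite /= modn_small // addn1.
have vE : v m = n' :> nat by have := ltn_ord (v m); rewrite /n in vm *; lia.
rewrite -[RHS]H; [|by move=> k; exact: ltn_ord|by rewrite /h ffunE eqxx /= vE modnn].
congr f; apply/funext => k; rewrite /push /face_shift /h ffunE.
have [->|km] := eqVneq k m; last by rewrite addn0.
by rewrite /= vE modnn mul1n addn1.
Qed.

(** The zeroth face of a simplex is the last face of one in the neighbouring cube along [s ord0],
    whose order of moves is rotated by the cycle [c]. As [d] is even, [c] is odd and the two faces
    cancel; at the boundary of the grid [Hper] provides the gluing. *)
Lemma kuhn_stokes (a : (nat -> 'I_d -> nat) -> R) : odd d' ->
  (forall u w, (forall i, (i < d)%N -> u i = w i) -> a u = a w) ->
  (forall x s m, (forall k, (x k < n)%N) -> x m = 0%N -> s ord_max = m ->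
     a (kuhn (face_shift m x) s) = a (kuhn x s)) ->
  kuhn_sum (fun v s => coboundary d.+1 a (kuhn v s)) = 0.
Proof.
move=> od Hdep Hper.
pose g v s := a (kuhn v s).
have Sd : kuhn_sum (fun v s => a (kuhn v s \o bump d)) = kuhn_sum g.
  apply: eq_bigr => v _; apply: eq_bigr => s _; congr (_ * _); apply: Hdep => i id /=.
  by rewrite /bump leqNgt id.
have S0 : kuhn_sum (fun v s => a (kuhn v s \o bump 0)) = - kuhn_sum g.
  pose c : 'S_d := lift_perm ord_max ord0 1.
  have oc : odd_perm c by rewrite odd_lift_perm odd_perm1 /= od.
  have c0 : c ord_max = ord0 by rewrite lift_perm_id.
  have cS (k : 'I_d) (kd : (k < d')%N) : c k = k.+1 :> nat.
    have -> : k = lift ord_max (Ordinal kd) by apply/val_inj; rewrite /= /bump leqNgt kd.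
    by rewrite lift_perm_lift perm1 /= /bump leq0n (leqNgt d') kd.
  have step v s : a (kuhn v s \o bump 0) = g (push (s ord0) v) (c * s)%g.
    apply: Hdep => i id; apply/funext => m; rewrite /= /kuhn /push invMg permM -addnA.
    congr (_ + _)%N; rewrite -[m == _](inj_eq (@perm_inj _ (s^-1)%g)) permK.
    move: ((s^-1)%g m) => k.
    have -> : bump 0 i = i.+1 by rewrite /bump leq0n.
    have [->|k0] := eqVneq k ord0.
      have -> : (c^-1)%g ord0 = ord_max by rewrite -c0 permK.
      by rewrite /= leq_gtF // -ltnS.
    have kp : (0 < k)%N by rewrite lt0n.
    have k'd : (k.-1 < d)%N by have := ltn_ord k; lia.
    have -> : k = c (Ordinal k'd).
      apply/val_inj; rewrite /= cS /=; first by rewrite prednK.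
      by have := ltn_ord k; rewrite /d; lia.
    rewrite permK cS /=; first by rewrite add0n ltnS.
    by have := ltn_ord k; rewrite /d; lia.
  rewrite /kuhn_sum.
  under eq_bigr do under eq_bigr do rewrite step.
  rewrite exchange_big /= (reindex_inj (mulgI c^-1)%g) /= [X in _ = - X]exchange_big /= -sumrN.
  apply: eq_bigr => s _.
  have sg : (-1) ^+ odd_perm (c^-1 * s)%g = - (-1) ^+ s :> R.
    by rewrite odd_permM odd_permV oc signr_addb /= expr1 mulN1r.
  rewrite -!mulr_sumr sg mulNr; congr (- (_ * _)).
  have -> : (c^-1 * s)%g ord0 = s ord_max by rewrite permM -c0 permK.
  under eq_bigr do rewrite mulKVg.
  rewrite (ffun_shift (f := g ^~ s) (m := s ord_max)) // => x xn xm.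
  exact: Hper.
rewrite /coboundary (kuhn_sum0 (fun (i : 'I_d.+1) v s => (-1) ^+ i * a (kuhn v s \o bump i))).
have Z (i : 'I_d.+1) : kuhn_sum (fun v s => (-1) ^+ i * a (kuhn v s \o bump i)) =
    (-1) ^+ i * kuhn_sum (fun v s => a (kuhn v s \o bump i)).
  rewrite /kuhn_sum mulr_sumr; apply: eq_bigr => v _.
  by rewrite mulr_sumr; apply: eq_bigr => s _; rewrite mulrCA.
under eq_bigr do rewrite Z.
rewrite big_ord_recl /= big_ord_recr /= expr0 mul1r S0.
rewrite big1 ?add0r => [|i _]; last first.
  by rewrite kuhn_interior ?mulr0 //= /bump leq0n add1n /= ltnS ltn_ord.
have -> : bump 0 d' = d by rewrite /bump leq0n.
by rewrite Sd /d -signr_odd /= od /= expr0 mul1r addNr.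
Qed.

End kuhn.

(** * Permutations of pairs of axes *)

Section block_perm.
Variable L' : nat.
Let L := L'.+1.
Let d := L'.*2.+2.

Lemma enc_subproof (i : 'I_L) (b : bool) : (i.*2 + b < d)%N.
Proof. by have := ltn_ord i; rewrite /d /L; case: b; lia. Qed.

Definition enc (i : 'I_L) (b : bool) : 'I_d := Ordinal (enc_subproof i b).

Lemma dec_subproof (j : 'I_d) : (j./2 < L)%N.
Proof. by have := ltn_ord j; rewrite /d /L; lia. Qed.

Definition dec (j : 'I_d) : 'I_L := Ordinal (dec_subproof j).

Lemma encK i b : dec (enc i b) = i.
Proof. by apply/val_inj => /=; case: b => /=; lia. Qed.

Lemma odd_enc i b : odd (enc i b) = b.
Proof. by rewrite /= oddD odd_double; case: b. Qed.

Lemma decK j : enc (dec j) (odd j) = j.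
Proof. by apply/val_inj; rewrite /= addnC odd_double_half. Qed.

Lemma enc_inj i b i' b' : enc i b = enc i' b' -> i = i' /\ b = b'.
Proof. by move=> E; split; [rewrite -(encK i b) E encK|rewrite -(odd_enc i b) E odd_enc]. Qed.

Lemma blk_inj (r : 'S_L) : injective (fun j => enc (r (dec j)) (odd j)).
Proof.
move=> j k /enc_inj[/perm_inj E1 E2].
by rewrite -(decK j) -(decK k) E1 E2.
Qed.

Definition blk (r : 'S_L) : 'S_d := perm (@blk_inj r).

Lemma blkE r i b : blk r (enc i b) = enc (r i) b.
Proof. by rewrite permE encK odd_enc. Qed.

Lemma blkM r r' : blk (r * r')%g = (blk r * blk r')%g.
Proof. by apply/permP => j; rewrite -(decK j) permM !blkE permM. Qed.

Lemma blk_tperm i j : blk (tperm i j) = (tperm (enc i false) (enc j false) * tperm (enc i true) (enc j true))%g.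
Proof.
have ne (x y : 'I_L) (b c : bool) : b != c -> enc x b != enc y c.
  by move=> bc; apply: contra bc => /eqP/enc_inj[_ ->].
apply/permP => k; rewrite -(decK k) blkE permM; move: (dec k) (odd k) => x [].
  rewrite [X in _ = tperm _ _ X]tpermD ?ne //.
  case: tpermP => [->|->|xi xj]; rewrite ?tpermL ?tpermR //.
  by rewrite tpermD //; apply/eqP => /enc_inj[E _]; [apply: xi|apply: xj].
case: (tpermP i j x) => [->|->|xi xj]; rewrite ?tpermL ?tpermR.
- by rewrite tpermD ?ne.
- by rewrite tpermD ?ne.
- rewrite [X in _ = tperm _ _ X]tpermD; first by rewrite tpermD ?ne.
    by apply/eqP => /enc_inj[E _]; apply: xi.
  by apply/eqP => /enc_inj[E _]; apply: xj.
Qed.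

(** Exchanging two pairs takes two transpositions. *)
Lemma odd_blk r : odd_perm (blk r) = false.
Proof.
case: (prod_tpermP r) => ts -> /allP ne.
elim: ts ne => [|[i j] ts IH] ne.
  rewrite big_nil (_ : blk 1 = 1%g) ?odd_perm1 //.
  by apply/permP => k; rewrite -(decK k) blkE !perm1.
rewrite big_cons blkM odd_permM IH; last by move=> t tin; apply: ne; rewrite inE tin orbT.
rewrite blk_tperm odd_permM !odd_tperm /=.
have ij : i != j by apply: (ne (i, j)); rewrite inE eqxx.
have N b : enc i b != enc j b by apply: contra ij => /eqP/enc_inj[->].
by rewrite !N.
Qed.

(** Such an [s] permutes the pairs and keeps the order inside each. This gives a common sign to all
    nonzero terms of [kuhn_sum_lam0]. *)
Lemma pairing_even (s : 'S_d) :
  (forall r : 'I_L, exists i : 'I_L, s (enc r false) = enc i false /\ s (enc r true) = enc i true) ->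
  odd_perm s = false.
Proof.
move=> H; pose f (r : 'I_L) := dec (s (enc r false)).
have fE r b : s (enc r b) = enc (f r) b.
  by have [i [E1 E2]] := H r; rewrite /f E1 encK; case: b.
have fI : injective f.
  move=> r r' E; have : s (enc r false) = s (enc r' false) by rewrite !fE E.
  by move/perm_inj/enc_inj => [].
have -> : s = blk (perm fI); last exact: odd_blk.
by apply/permP => j; rewrite -(decK j) blkE permE fE.
Qed.

End block_perm.

(** * The nonzero top class on the torus *)

Section torus.
Context {R : realType}.
Variables (L' n' : nat) (kappa : R).
Let L := L'.+1.
Let d := L'.*2.+2.
Let n := n'.+1.
Implicit Types (x y : 'I_d -> nat).

Definition grid_adj x y := forall k, (x k <= y k <= (x k).+1)%N /\ (y k <= n)%N.

Lemma kuhn_adj v (s : 'S_d) i j : (forall k, (v k < n)%N) -> (i <= j)%N -> grid_adj (kuhn v s i) (kuhn v s j).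
Proof. by move=> vn ij k; have := vn k; rewrite /kuhn; split; lia. Qed.

Hypothesis kappa_neq0 : kappa != 0.

(* The connection form [kappa * \sum_i y_i dx_i], in discrete form; the
   coordinates [y_i] and [x_i] are those of index [2 i] and [2 i + 1]. *)
Definition lam0 x y : R :=
  kappa * \sum_(i < L) (x (enc i false))%:R * ((y (enc i true))%:R - (x (enc i true))%:R).

Lemma dlam0E (u : nat -> 'I_d -> nat) : dlam lam0 u = kappa *
  \sum_(i < L) ((u 1%N (enc i false))%:R - (u 0%N (enc i false))%:R) *
    ((u 2%N (enc i true))%:R - (u 1%N (enc i true))%:R).
Proof.
rewrite /dlam /lam0 -mulrDr -mulrBr -big_split -sumrB; congr (_ * _).
by apply: eq_bigr => i _ /=; ring.
Qed.

Lemma dlam0_shift m (u : nat -> 'I_d -> nat) :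
  dlam lam0 (@face_shift _ n' m \o u) = dlam lam0 u.
Proof.
rewrite !dlam0E; congr (_ * _); apply: eq_bigr => i _.
by rewrite /face_shift /= !natrD; congr (_ * _); ring.
Qed.

Let G (s : 'S_d) (r : nat) : R :=
  \sum_(i < L) (((s^-1)%g (enc i false) == r.*2 :> nat) && ((s^-1)%g (enc i true) == r.*2.+1 :> nat))%:R.

Lemma dlam0_kuhn v (s : 'S_d) r : dlam lam0 (kuhn v s \o addn r.*2) = kappa * G s r.
Proof.
rewrite dlam0E; congr (_ * _); apply: eq_bigr => i _; rewrite /= /kuhn.
have E (a b k : nat) : (a + (k < b.+1))%:R - (a + (k < b))%:R = (k == b)%:R :> R.
  rewrite !natrD opprD addrACA subrr add0r ltnS leq_eqVlt.
  by case: ltngtP => //= _; rewrite ?subrr ?subr0.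
by rewrite addn0 addn1 addn2 !E -natrM mulnb.
Qed.

Lemma cup_prod_lam0 v (s : 'S_d) k : (k <= L)%N ->
  cup_prod (nseq k lam0) (kuhn v s \o addn (L - k).*2) = kappa ^+ k * \prod_(L - k <= r < L) G s r.
Proof.
elim: k => [|k IH] kL; first by rewrite subn0 big_geq // expr0 mulr1.
rewrite big_ltn; last by lia.
rewrite [LHS]/= -[dlam _ _]/(dlam lam0 (kuhn v s \o addn (L - k.+1).*2)) dlam0_kuhn.
have -> : (kuhn v s \o addn (L - k.+1).*2) \o addn 2 = kuhn v s \o addn (L - k).*2.
  by apply/funext => j /=; congr kuhn; lia.
rewrite IH; last exact: ltnW.
have -> : (L - k.+1).+1 = (L - k)%N by lia.
by rewrite exprS; ring.
Qed.

(** [G s r] is nonzero only if the moves [2 r] and [2 r + 1] go along the two axes of one pair, in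
    this order. A permutation for which this holds for every [r] is even, so nothing cancels, and
    the identity contributes a positive term. *)
Lemma kuhn_sum_lam0 : kuhn_sum n' (fun v s => cup_prod (nseq L lam0) (kuhn v s)) != 0.
Proof.
have E v s : cup_prod (nseq L lam0) (kuhn v s) = kappa ^+ L * \prod_(0 <= r < L) G s r.
  by have := @cup_prod_lam0 v s L (leqnn L); rewrite subnn => <-.
have G0 s r : 0 <= G s r by apply: sumr_ge0 => i _; rewrite ler0n.
have -> : kuhn_sum n' (fun v s => cup_prod (nseq L lam0) (kuhn v s)) =
    kappa ^+ L * \sum_(v : {ffun 'I_d -> 'I_n}) \sum_(s : 'S_d) (-1) ^+ s * \prod_(0 <= r < L) G s r.
  rewrite /kuhn_sum mulr_sumr; apply: eq_bigr => v _.
  by rewrite mulr_sumr; apply: eq_bigr => s _; rewrite E mulrCA.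
rewrite mulf_neq0 ?expf_neq0 // sumr_const.
suff : 0 < \sum_(s : 'S_d) (-1) ^+ s * \prod_(0 <= r < L) G s r :> R.
  move=> pos; rewrite gt_eqF // pmulrn_lgt0 // card_ffun card_ord expn_gt0.
  by rewrite ltn0Sn.
have T0 (s : 'S_d) : 0 <= (-1) ^+ s * \prod_(0 <= r < L) G s r :> R.
  have [->|ne] := eqVneq (\prod_(0 <= r < L) G s r) 0; first by rewrite mulr0.
  rewrite pairing_even ?expr0 ?mul1r ?prodr_ge0 // => r.
  have : G s r != 0.
    move: ne; rewrite big_mkord; apply: contraNneq => Gr.
    by rewrite (bigD1 r) //= Gr mul0r.
  rewrite /G => Gr.
  have [i /andP[/eqP E1 /eqP E2]] : exists i : 'I_L, ((s^-1)%g (enc i false) == r.*2 :> nat) && ((s^-1)%g (enc i true) == r.*2.+1 :> nat).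
    apply: contrapT => N; move/eqP: Gr; apply; apply: big1 => i _.
    by case E1 : (_ && _) => //; case: N; exists i.
  exists i; split; rewrite -[RHS](permKV s); congr (s _); apply/val_inj => /=.
    by rewrite E1 addn0.
  by rewrite E2 addn1.
rewrite (bigD1 1%g) //= odd_perm1 expr0 mul1r.
apply: ltr_wpDr; first by apply: sumr_ge0.
rewrite big_mkord; apply: prodr_gt0 => r _.
rewrite /G (bigD1 r) //= invg1 !perm1 /= addn0 addn1 !eqxx /=.
by apply: ltr_wpDr => //; apply: sumr_ge0 => i _; rewrite ler0n.
Qed.

Lemma cup_prod0 (I : Type) (f : I -> ('I_d -> nat) -> ('I_d -> nat) -> R) (ls : seq I) (i0 : I) u k :
  (k < size ls)%N -> dlam (f (nth i0 ls k)) (u \o addn k.*2) = 0 ->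
  cup_prod (map f ls) u = 0.
Proof.
elim: ls u k => [//|i ls IH] u [|k] /= kl E.
  have -> : dlam (f i) u = 0 by exact: E.
  by rewrite mul0r.
by rewrite (IH (u \o addn 2) k) ?mulr0.
Qed.

(* A discrete form of: the product of the [L] Chern classes of a line bundle of
   nonzero degree on each factor of [(T^2)^L] is nonzero, so the torus is not
   covered by [L] sets over which the bundle is trivial. *)
Lemma torus_cover (lam : 'I_L -> ('I_d -> nat) -> ('I_d -> nat) -> R) :
  (forall r m x y, grid_adj x y -> x m = 0%N -> y m = 0%N ->
    lam r (face_shift n' m x) (face_shift n' m y) - lam0 (face_shift n' m x) (face_shift n' m y) =
    lam r x y - lam0 x y) ->
  (forall v (s : 'S_d), (forall k, (v k < n)%N) ->
    exists r : 'I_L, dlam (lam r) (kuhn v s \o addn r.*2) = 0) ->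
  False.
Proof.
move=> Hs H0; pose ls := map lam (enum 'I_L).
have sz : size ls = L by rewrite size_map size_enum_ord.
have P0 v s : (forall k, (v k < n)%N) -> cup_prod ls (kuhn v s) = 0.
  move=> vn; have [r Er] := H0 v s vn; apply: (@cup_prod0 _ lam _ ord0 _ r); first by rewrite size_enum_ord.
  by rewrite nth_ord_enum.
have := kuhn_sum_lam0; apply/negP; rewrite negbK; apply/eqP.
have S := @kuhn_stokes R L'.*2.+1 n' (cup_primitive lam0 ls).
have E : kuhn_sum n' (fun v s => coboundary d.+1 (cup_primitive lam0 ls) (kuhn v s)) =
    kuhn_sum n' (fun v s => - cup_prod (nseq L lam0) (kuhn v s)).
  apply: eq_bigr => v _; apply: eq_bigr => s _; congr (_ * _).
  have -> : d.+1 = (size ls).*2.+1 by rewrite sz.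
  by rewrite cup_primitiveP sz P0 ?sub0r // => k; exact: ltn_ord.
have EN : kuhn_sum n' (fun v s => - cup_prod (nseq L lam0) (kuhn v s)) =
    - kuhn_sum n' (fun v s => cup_prod (nseq L lam0) (kuhn v s)).
  rewrite /kuhn_sum -sumrN; apply: eq_bigr => v _; rewrite -sumrN.
  by apply: eq_bigr => s _; rewrite mulrN.
apply: oppr_inj; rewrite oppr0 -EN -E; apply: S.
- by rewrite /= odd_double.
- move=> u w uw.
  have gen (l : seq (('I_d -> nat) -> ('I_d -> nat) -> R)) (u1 w1 : nat -> 'I_d -> nat) :
      (forall i, (i < (size l).*2.+1)%N -> u1 i = w1 i) -> cup_prod l u1 = cup_prod l w1.
    elim: l u1 w1 => [//|f l IH] u1 w1 H /=.
    rewrite /dlam !H //; congr (_ * _); apply: IH => i il; apply: H => /=.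
    by move: il; rewrite /=; lia.
  have : forall i, (i < (size ls).*2)%N -> u i = w i by rewrite sz.
  elim: ls u w {uw sz P0 E} => [//|f l IH] u w H /=.
  rewrite !H //; congr (_ * _ + _).
    by apply: gen => i il; apply: H => /=; lia.
  case: l IH H => [|f' l] IH H; first by rewrite /= !mulr0.
  rewrite /dlam !H //; congr (_ * _); apply: IH => i il; apply: H.
  by move: il => /=; lia.
- move=> x s m xn xm sm.
  have kshift i : (i < d)%N -> kuhn (face_shift n' m x) s i = face_shift n' m (kuhn x s i).
    move=> id; apply/funext => k; rewrite /kuhn /face_shift; lia.
  have -> : kuhn (face_shift n' m x) s = face_shift n' m \o kuhn x s.
    by apply/funext => i; apply/funext => k; rewrite /kuhn /face_shift /=; lia.
  (* [m] is the last axis moved along, so the first [d] vertices, the only ones that the primitive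
     reads, keep [m]-th coordinate [0], where the hypothesis on [lam] applies. *)
  pose adj (x y : 'I_d -> nat) := [/\ grid_adj x y, x m = 0%N & y m = 0%N].
  have b1 r : forall x y, adj x y -> lam r (face_shift n' m x) (face_shift n' m y) -
      lam0 (face_shift n' m x) (face_shift n' m y) = lam r x y - lam0 x y.
    by move=> a b [ab am bm]; exact: Hs.
  apply: (@cup_primitive_shift _ _ _ adj).
  + by move=> u _ _ _; exact: dlam0_shift.
  + move=> f fin.
    have [r ->] : exists r, f = lam r.
      have gen (l : seq 'I_L) : List.In f (map lam l) -> exists r, f = lam r.
        by elim: l => [//|r l IH] /= [<-|/IH //]; exists r.
      exact: gen fin.
    split; last by move=> a b ab; exact: b1.
    move=> u u01 u12 u02.
    have := dlam0_shift m u; rewrite /dlam /=.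
    have := b1 r _ _ u01; have := b1 r _ _ u12; have := b1 r _ _ u02.
    lra.
  + move=> i j /andP[ij jd]; split; first by apply: kuhn_adj => //; exact: ltnW.
      rewrite /kuhn xm add0n -sm permK /=; move: jd; rewrite sz /L; lia.
    rewrite /kuhn xm add0n -sm permK /=; move: jd; rewrite sz /L; lia.
Qed.

End torus.

(** * Equivariant functions and the Reeb loop *)

Section plane.
Context {R : realType}.
Implicit Types (a b c : R * R) (x y : R).

Definition rotv x a : R * R := (cos x * a.1 - sin x * a.2, sin x * a.1 + cos x * a.2).
Definition sqn a : R := a.1 ^+ 2 + a.2 ^+ 2.
Definition dot a b : R := a.1 * b.1 + a.2 * b.2.
Definition cross a b : R := a.1 * b.2 - a.2 * b.1.
(** The oriented angle from [a] to [b], when [dot a b] is positive. *)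
Definition ang a b : R := atan (cross a b / dot a b).

Lemma rotvD x y a : rotv x (rotv y a) = rotv (x + y) a.
Proof. by rewrite /rotv /= sinD cosD; congr pair; ring. Qed.

Lemma rotv0 a : rotv 0 a = a.
Proof. by case: a => a1 a2; rewrite /rotv cos0 sin0 /=; congr pair; ring. Qed.

Lemma sqn_rotv x a : sqn (rotv x a) = sqn a.
Proof.
rewrite /sqn /= -[RHS]mul1r -(cos2Dsin2 x); ring.
Qed.

Lemma ang_rotv x r a : 0 < r -> 0 < sqn a -> `|x| < pi / 2 ->
  ang a (r * (rotv x a).1, r * (rotv x a).2) = x.
Proof.
move=> r0 a0 xpi.
have c0 : 0 < cos x by apply: cos_gt0_pihalf; rewrite -ltr_norml.
rewrite /ang.
have -> : cross a (r * (rotv x a).1, r * (rotv x a).2) = r * sqn a * sin x.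
  by rewrite /cross /sqn /=; ring.
have -> : dot a (r * (rotv x a).1, r * (rotv x a).2) = r * sqn a * cos x.
  by rewrite /dot /sqn /=; ring.
have n0 : r * sqn a != 0 by rewrite mulf_neq0 ?gt_eqF.
rewrite -mulf_div divff // mul1r; apply: tanK.
by rewrite in_itv /= -ltr_norml.
Qed.

Lemma dot_sqn a b : 0 < dot a b -> 0 < sqn a.
Proof.
move=> d0; rewrite lt0r /sqn addr_ge0 ?sqr_ge0 // andbT paddr_eq0 ?sqr_ge0 // !sqrf_eq0.
apply: contraL d0 => /andP[/eqP E1 /eqP E2].
by rewrite /dot E1 E2 !mul0r addr0 ltxx.
Qed.

Lemma ang_spec a b : 0 < dot a b -> exists2 r, 0 < r &
  b = (r * (rotv (ang a b) a).1, r * (rotv (ang a b) a).2).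
Proof.
move=> d0.
have a0 := dot_sqn d0.
have c0 : 0 < cos (ang a b) by apply: cos_gt0_pihalf; rewrite atan_gtNpi2 atan_ltpi2.
have st : sin (ang a b) = cross a b / dot a b * cos (ang a b).
  by rewrite -[in RHS](atanK (cross a b / dot a b)) /tan divfK // gt_eqF.
exists (dot a b / (sqn a * cos (ang a b))); first by rewrite divr_gt0 // mulr_gt0.
rewrite /= st; move: (cos _) c0 => C C0.
have d1 : dot a b != 0 by rewrite gt_eqF.
have a1 : sqn a != 0 by rewrite gt_eqF.
have C1 : C != 0 by rewrite gt_eqF.
have E1 : dot a b * a.1 - cross a b * a.2 = b.1 * sqn a by rewrite /dot /cross /sqn; ring.
have E2 : cross a b * a.1 + dot a b * a.2 = b.2 * sqn a by rewrite /dot /cross /sqn; ring.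
rewrite [LHS]surjective_pairing; congr pair.
  by apply: (mulIf a1); rewrite -E1; field; rewrite a1 d1 C1.
by apply: (mulIf a1); rewrite -E2; field; rewrite a1 d1 C1.
Qed.

(** The strong condition on [cross] is there to let two angles be added without leaving the range of
    [atan]. *)
Lemma ang_small a b : `|cross a b| < dot a b -> `|ang a b| < pi / 4.
Proof.
move=> H; have d0 : 0 < dot a b by apply: le_lt_trans H.
have : `|cross a b / dot a b| < 1.
  by rewrite normrM normfV (gtr0_norm d0) ltr_pdivrMr // mul1r.
rewrite !ltr_norml => /andP[/lt_atan H1 /lt_atan H2].
by move: H1 H2; rewrite atanN atan1 /ang => -> ->.
Qed.

Lemma ang_add a b c : `|cross a b| < dot a b -> `|cross b c| < dot b c ->
  ang a b + ang b c - ang a c = 0.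
Proof.
move=> Hab Hbc; apply/eqP; rewrite subr_eq0; apply/eqP.
have dab : 0 < dot a b by apply: le_lt_trans Hab.
have dbc : 0 < dot b c by apply: le_lt_trans Hbc.
have := ang_small Hab; have := ang_small Hbc.
have [r r0 Eb] := ang_spec dab; have [r' r'0 Ec] := ang_spec dbc.
move: (ang a b) (ang b c) Eb Ec => x y Eb Ec ys xs.
have a0 := dot_sqn dab.
have -> : c = ((r' * r) * (rotv (x + y) a).1, (r' * r) * (rotv (x + y) a).2).
  by rewrite (addrC x) -rotvD Ec Eb /rotv /=; congr pair; ring.
rewrite ang_rotv ?mulr_gt0 //.
apply: le_lt_trans (ler_normD _ _) _; move: xs ys; lra.
Qed.

Lemma ang_shift a b x y : `|cross a b| < dot a b -> `|y| < pi / 4 ->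
  ang (rotv x a) (rotv (x + y) b) = ang a b + y.
Proof.
move=> Hab ys.
have dab : 0 < dot a b by apply: le_lt_trans Hab.
have := ang_small Hab; have [r r0 Eb] := ang_spec dab.
move: (ang a b) Eb => z Eb zs.
have a0 := dot_sqn dab.
have -> : rotv (x + y) b = (r * (rotv (z + y) (rotv x a)).1, r * (rotv (z + y) (rotv x a)).2).
  rewrite rotvD (_ : z + y + x = x + y + z); last by ring.
  by rewrite -(rotvD (x + y) z) Eb /rotv /=; congr pair; ring.
rewrite ang_rotv ?sqn_rotv //.
apply: le_lt_trans (ler_normD _ _) _; move: zs ys; lra.
Qed.

(** With [b = a + (x, y)], [dot a b] is [sqn a] and [cross a b] is zero up to errors of at most
    [(|a.1| + |a.2|) * e] each; the factor [8] leaves ample room. *)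
Lemma close_cross a b e : 0 < e -> (8 * e) ^+ 2 <= sqn a ->
  `|b.1 - a.1| <= e -> `|b.2 - a.2| <= e -> `|cross a b| < dot a b.
Proof.
case: a => a1 a2; case: b => b1 b2; rewrite /sqn /cross /dot /= => e0 H.
rewrite !ler_norml ltr_norml => /andP[x1 x2] /andP[y1 y2].
pose x := b1 - a1; pose y := b2 - a2.
have E1 : b1 = a1 + x by rewrite /x; ring.
have E2 : b2 = a2 + y by rewrite /y; ring.
rewrite -/x in x1 x2; rewrite -/y in y1 y2.
rewrite E1 E2; clearbody x y.
have K : 2 * (`|a1| + `|a2|) * e < a1 ^+ 2 + a2 ^+ 2.
  have s2 : (`|a1| + `|a2|) ^+ 2 <= 2 * (a1 ^+ 2 + a2 ^+ 2).
    rewrite -[a1 ^+ 2]real_normK ?num_real // -[a2 ^+ 2]real_normK ?num_real //.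
    by have := sqr_ge0 (`|a1| - `|a2|); nra.
  have s0 : 0 <= `|a1| + `|a2| by apply: addr_ge0.
  have e2 : 0 < e ^+ 2 by rewrite exprn_gt0.
  move: (`|a1| + `|a2|) (a1 ^+ 2 + a2 ^+ 2) s0 s2 H => s Q s0 s2 H.
  have := sqr_ge0 (s / 2 - 2 * e); move: s2 H; rewrite !expr2 => *; lra.
have b1' : `|a1 * y| <= `|a1| * e by rewrite normrM ler_wpM2l // ler_norml y1 y2.
have b2' : `|a2 * x| <= `|a2| * e by rewrite normrM ler_wpM2l // ler_norml x1 x2.
have b3' : `|a1 * x| <= `|a1| * e by rewrite normrM ler_wpM2l // ler_norml x1 x2.
have b4' : `|a2 * y| <= `|a2| * e by rewrite normrM ler_wpM2l // ler_norml y1 y2.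
move: b1' b2' b3' b4'; rewrite !ler_norml => /andP[? ?] /andP[? ?] /andP[? ?] /andP[? ?].
apply/andP; split; lra.
Qed.

End plane.

Lemma compact_uniform {R : realType} {V : normedModType R} (K : set V) (f : V -> R) e :
  compact K -> continuous f -> 0 < e ->
  exists2 d, 0 < d & forall z z', K z -> `|z' - z| < d -> `|f z' - f z| < e.
Proof.
move=> /compact_near_coveringP cK cf e0.
have : \forall d \near (0 : R)^'+, forall z, K z -> forall z', `|z' - z| < d -> `|f z' - f z| < e.
  apply: (cK _ _ (fun d z => forall z', `|z' - z| < d -> `|f z' - f z| < e)) => z _.
  have /near_ballP[r r0 Hr] : \forall y \near z, `|f y - f z| < e / 2.
    have : \forall y \near f z, `|y - f z| < e / 2.
      by apply/near_ballP; exists (e / 2) => //; rewrite divr_gt0.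
    exact: cf.
  have r2 : 0 < r / 2 by rewrite divr_gt0.
  exists ([set y | `|y - z| < r / 2], [set d | d < r / 2]).
    split; first by apply/near_ballP; exists (r / 2).
    exact: nbhs_right_lt.
  move=> [y d] [/= yz dr] z' z'y.
  have h1 : `|f z' - f z| < e / 2.
    apply: Hr; rewrite -(subrKA y) (splitr r); apply: le_lt_trans (ler_normD _ _) _.
    by apply: ltrD => //; exact: lt_trans dr.
  have h2 : `|f y - f z| < e / 2.
    by apply: Hr; apply: lt_trans yz _; rewrite ltr_pdivrMr // ltr_pMr // ltr1n.
  rewrite -(subrKA (f z)) (splitr e); apply: le_lt_trans (ler_normD _ _) _.
  by rewrite [X in _ + X]distrC ltrD.
move=> H; have [d [/= d0 Hd]] := filter_ex (filterI (nbhs_right_gt (0 : R)) H).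
by exists d => // z z' Kz; exact: Hd.
Qed.

Lemma foldr_ext (I : eqType) (T : Type) (f g : I -> T -> T) x (s : seq I) :
  {in s, forall i y, f i y = g i y} -> foldr f x s = foldr g x s.
Proof.
elim: s => [//|i s IH] H /=; rewrite H ?inE ?eqxx // IH // => j js.
by apply: H; rewrite inE js orbT.
Qed.

(** Serves to pull the time shift produced by one square out of the composition of all the maps
    [H]. *)
Lemma foldr_commute (I : eqType) (T : Type) (f g : I -> T -> T) (h : T -> T) i0 x (s : seq I) :
  uniq s -> i0 \in s -> (forall y, f i0 y = h (g i0 y)) ->
  (forall i y, i != i0 -> f i y = g i y) -> (forall i y, g i (h y) = h (g i y)) ->
  foldr f x s = h (foldr g x s).
Proof.
move=> us i0s f0 fN gh; elim: s us i0s => [//|i s IH] /= /andP[si us].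
rewrite inE => /orP[/eqP E|i0s].
  rewrite -E f0; congr (h (g _ _)); apply: foldr_ext => j js y.
  by apply: fN; apply: contraNneq si => ji; rewrite -E -ji.
by rewrite IH // fN ?gh //; apply: contraNneq si => ->.
Qed.

Section lam0_shift.
Context {R : realType}.
Variables (L' n' : nat) (kappa : R).
Implicit Types x y : 'I_L'.*2.+2 -> nat.

Lemma enc_neq (i j : 'I_L'.+1) (b c : bool) : (b != c) || (i != j) -> enc i b != enc j c.
Proof. by apply: contraL => /eqP/enc_inj[-> ->]; rewrite !eqxx. Qed.

Lemma face_shift_enc i b x j c : face_shift n' (enc i b) x (enc j c) =
  (x (enc j c) + ((i == j) && (b == c)) * n'.+1)%N.
Proof.
rewrite /face_shift; congr (_ + nat_of_bool _ * _)%N; rewrite eq_sym.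
have [->|ij] := eqVneq i j; have [->|bc] := eqVneq b c => /=; rewrite ?eqxx //;
  by apply/negbTE/enc_neq; rewrite ?ij ?bc ?orbT.
Qed.

Lemma grid_adj_le x y : grid_adj n' x y -> forall k, (x k <= n'.+1)%N /\ (y k <= n'.+1)%N.
Proof. by move=> xy k; have [/andP[h _] yn] := xy k; split=> //; exact: leq_trans yn. Qed.

Lemma grid_adj_step x y : grid_adj n' x y -> forall k, y k = x k \/ y k = (x k).+1.
Proof. by move=> xy k; have [h _] := xy k; lia. Qed.

Lemma kuhn_adj_base x s i : (forall k, (x k < n'.+1)%N) -> grid_adj n' x (kuhn x s i).
Proof. by move=> xn k; have := xn k; rewrite /kuhn; split; lia. Qed.

Lemma lam0_shift_true i x y :
  lam0 kappa (face_shift n' (enc i true) x) (face_shift n' (enc i true) y) = lam0 kappa x y.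
Proof.
rewrite /lam0; congr (_ * _); apply: eq_bigr => j _.
by rewrite !face_shift_enc andbF addn0 !natrD; ring.
Qed.

(** The added term is the discrete differential of the transition function of the line bundle. *)
Lemma lam0_shift_false i x y :
  lam0 kappa (face_shift n' (enc i false) x) (face_shift n' (enc i false) y) =
  lam0 kappa x y + kappa * n'.+1%:R * ((y (enc i true))%:R - (x (enc i true))%:R).
Proof.
rewrite /lam0 -mulrA -mulrDr; congr (_ * _).
rewrite (bigD1 i) //= [in RHS](bigD1 i) //= !face_shift_enc eqxx /= addn0 mul1n addn0.
rewrite (eq_bigr (fun j => (x (enc j false))%:R * ((y (enc j true))%:R - (x (enc j true))%:R))); last first.
  by move=> j /negbTE ji; rewrite !face_shift_enc eq_sym ji /= !addn0.
by rewrite natrD; ring.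
Qed.

End lam0_shift.

Section turns.
Context {R : realType}.

Lemma cos_turns (x : R) k : cos (x + k%:R * (pi *+ 2)) = cos x.
Proof.
elim: k => [|k IH]; first by rewrite mul0r addr0.
by rewrite -natr1 mulrDl mul1r addrA cosD cos2pi sin2pi mulr0 subr0 mulr1.
Qed.

Lemma sin_turns (x : R) k : sin (x + k%:R * (pi *+ 2)) = sin x.
Proof.
elim: k => [|k IH]; first by rewrite mul0r addr0.
by rewrite -natr1 mulrDl mul1r addrA sinD cos2pi sin2pi mulr0 mulr1 addr0.
Qed.

Lemma sum_shift (h : nat -> R) n : h n = h 0%N -> \sum_(j < n) h j.+1 = \sum_(j < n) h j.
Proof.
move=> hn; apply: (@addrI _ (h 0%N)); rewrite -[RHS]addrC -{2}hn.
by rewrite -(big_ord_recr n (fun j => h (nat_of_ord j))) /= big_ord_recl.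
Qed.

End turns.

Section finite_cover.
Variable M : topologicalType.

Lemma compact_finite_cover (W : M -> set M) : [set: M] !=set0 -> compact [set: M] ->
  (forall p, nbhs p (W p)) -> exists L' (p : 'I_L'.+1 -> M), forall x, exists r, W (p r) x.
Proof.
move=> [x0 _] /compact_near_coveringP cM HW.
(* The filter of finite lists ordered by inclusion: a property that holds for all large lists near
   every point yields a finite subcover. *)
pose F (P : set (seq M)) := exists s0 : seq M, forall s : seq M, {subset s0 <= s} -> P s.
have FF : Filter F.
  split; first by exists [::].
    move=> P Q [s Hs] [s' Hs']; exists (s ++ s') => u Hu.
    by split; [apply: Hs|apply: Hs'] => x xs; apply: Hu; rewrite mem_cat xs ?orbT.
  by move=> P Q PQ [s Hs]; exists s => u Hu; apply/PQ/Hs.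
have [s Hs] : F (fun s => forall x, setT x -> exists2 p, p \in s & W p x).
  apply: (cM _ F (fun s x => exists2 p, p \in s & W p x)) => x _.
  exists (W x, [set s : seq M | x \in s]) => /=.
    by split; [exact: HW|exists [:: x] => s Hs; apply: Hs; rewrite inE].
  by move=> [y s] [/= Wy xs]; exists x.
have {Hs}cov := Hs s (fun _ h => h).
have H x : exists2 k : nat, (k < size s)%N & W (nth x0 s k) x.
  have [p ps px] := cov x I.
  by exists (index p s); rewrite ?index_mem // nth_index.
have [k0 ks _] := H x0.
have E : (size s).-1.+1 = size s by rewrite prednK // (leq_ltn_trans _ ks).
exists (size s).-1, (fun r : 'I__ => nth x0 s r) => x.
have [k kl Wk] := H x.
have kl' : (k < (size s).-1.+1)%N by rewrite E.
by exists (Ordinal kl').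
Qed.

End finite_cover.

(** * Equivariant functions by averaging along orbits *)

Section sections.
Context {R : realType} {M : topologicalType}.
Variable psi : R -> M -> M.
Hypothesis psi0 : forall p, psi 0 p = p.
Hypothesis psiD : forall s t p, psi (s + t) p = psi s (psi t p).
Hypothesis psi_cts : continuous (fun z : R * M => psi z.1 z.2).
Hypothesis hM : hausdorff_space M.
Hypothesis cM : compact [set: M].
Variable N : R.
Hypothesis N_gt0 : 0 < N.
Hypothesis psiN : forall p, psi N p = p.

(** [N] is [k] times the minimal period of [p], which is at least [e0]; so [k <= B] divides [B!],
    whatever [p] is. *)
Lemma period_denominator (e0 : R) : 0 < e0 -> (forall p t, 0 < t < e0 -> psi t p <> p) ->
  exists2 l : nat, (0 < l)%N & forall p t, 0 <= t -> psi t p = p ->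
    exists j : nat, l%:R * t = j%:R * N.
Proof.
move=> e00 nsp.
have reg : regular psi by move=> p; exists N.
pose T := tau psi_cts hM e00 nsp reg.
pose B := (Num.truncn (N / e0)).+1.
exists B`!; first exact: fact_gt0.
move=> p t t0 tp.
have [j Ej] := tau_multiple psi0 psiD psi_cts hM e00 nsp reg t0 tp.
have [k k0 Ek] := tau_multiple_gt0 psi0 psiD psi_cts hM e00 nsp reg N_gt0 (psiN p).
have kB : (k <= B)%N.
  rewrite /B -(ler_nat R); apply: ltW; apply: le_lt_trans (truncnS_gt (N / e0)).
  by rewrite ler_pdivlMr // [leRHS]Ek ler_wpM2l // e0_le_tau.
have /dvdnP[m Em] : (k %| B`!)%N by apply: dvdn_fact; rewrite k0.
exists (m * j)%N; rewrite Em Ej [in RHS]Ek !natrM; ring.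
Qed.

Variable l : nat.
Hypothesis l_period : forall p t, 0 <= t -> psi t p = p -> exists j : nat, l%:R * t = j%:R * N.
Let w : R := l%:R * (pi *+ 2) / N.

Lemma w_period p t : 0 <= t -> psi t p = p -> cos (w * t) = 1.
Proof.
move=> t0 /(l_period t0)[j E].
have -> : w * t = 0 + j%:R * (pi *+ 2).
  rewrite add0r /w -!mulrA [N^-1 * t]mulrC; apply: (mulIf (lt0r_neq0 N_gt0)).
  by rewrite !mulrA divfK ?gt_eqF // -[in RHS]mulrA [_ * N]mulrC mulrA -E; ring.
by rewrite cos_turns cos0.
Qed.

(* A Riemann sum of the Fourier coefficient of weight [l] of [b] along an orbit. *)
Definition avg n (b : M -> R) (p : M) : R * R :=
  (n%:R^-1 * \sum_(j < n) b (psi (j%:R * (N / n%:R)) p) * cos (j%:R * (w * (N / n%:R))),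
   - (n%:R^-1 * \sum_(j < n) b (psi (j%:R * (N / n%:R)) p) * sin (j%:R * (w * (N / n%:R))))).

(** One sampling step re-indexes the sum cyclically: [n] steps make up the period [N] of the flow
    and [l] full turns of the weights, so the equivariance is exact. *)
Lemma avg_rot1 n b p : (0 < n)%N ->
  avg n b (psi (N / n%:R) p) = rotv (w * (N / n%:R)) (avg n b p).
Proof.
move=> n0; have n1 : n%:R != 0 :> R by rewrite pnatr_eq0 -lt0n.
set h := N / n%:R; set th := w * h.
have nh : n%:R * h = N by rewrite /h mulrC divfK.
have nth : n%:R * th = l%:R * (pi *+ 2).
  by rewrite /th mulrCA nh /w divfK // gt_eqF.
have S (f : R -> R) : (forall x k, f (x + k%:R * (pi *+ 2)) = f x) ->
    \sum_(j < n) b (psi (j%:R * h) (psi h p)) * f (j%:R * th) =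
    \sum_(j < n) b (psi (j%:R * h) p) * f (j%:R * th - th).
  move=> Hf; rewrite -(sum_shift (h := fun j => b (psi (j%:R * h) p) * f (j%:R * th - th))).
    apply: eq_bigr => j _; rewrite -psiD -natr1 !mulrDl !mul1r.
    by rewrite addrK.
  by rewrite nh psiN !mul0r psi0 nth addrC Hf sub0r.
rewrite /avg -/h -/th /rotv /=.
rewrite !S; [|exact: sin_turns|exact: cos_turns].
congr pair.
  rewrite mulrN opprK ![_ * (n%:R^-1 * _)]mulrCA -mulrDr; congr (_ * _).
  rewrite !mulr_sumr -big_split; apply: eq_bigr => j _ /=.
  by rewrite cosB; ring.
rewrite mulrN ![_ * (n%:R^-1 * _)]mulrCA -mulrBr -mulrN; congr (_ * _).
rewrite !mulr_sumr -sumrN -sumrB; apply: eq_bigr => j _ /=.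
by rewrite sinB; ring.
Qed.

Lemma avg_rot n b p a : (0 < n)%N ->
  avg n b (psi (a%:R * (N / n%:R)) p) = rotv (a%:R * (w * (N / n%:R))) (avg n b p).
Proof.
move=> n0; elim: a => [|a IH]; first by rewrite !mul0r psi0 rotv0.
by rewrite -natr1 !mulrDl !mul1r addrC psiD avg_rot1 // IH rotvD addrC.
Qed.

Lemma avg_dist n b p q e : (0 < n)%N -> 0 <= e ->
  (forall t, 0 <= t <= N -> `|b (psi t p) - b (psi t q)| <= e) ->
  `|(avg n b p).1 - (avg n b q).1| <= e /\ `|(avg n b p).2 - (avg n b q).2| <= e.
Proof.
move=> n0 e0 H; have n1 : 0 < n%:R :> R by rewrite ltr0n.
have S (f : R -> R) : (forall x, `|f x| <= 1) ->
    `|n%:R^-1 * \sum_(j < n) b (psi (j%:R * (N / n%:R)) p) * f j%:R -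
      n%:R^-1 * \sum_(j < n) b (psi (j%:R * (N / n%:R)) q) * f j%:R| <= e.
  move=> Hf; rewrite -mulrBr -sumrB normrM gtr0_norm ?invr_gt0 // mulrC ler_pdivrMr //.
  apply: le_trans (ler_norm_sum _ _ _) _.
  have -> : e * n%:R = \sum_(j < n) e by rewrite sumr_const card_ord mulr_natr.
  apply: ler_sum => j _; rewrite -mulrBl normrM -[leRHS]mulr1.
  apply: ler_pM => //; apply: H; apply/andP; split.
    by rewrite mulr_ge0 // divr_ge0 // ltW.
  rewrite mulrA ler_pdivrMr // mulrC (ler_wpM2l (ltW N_gt0)) // ler_nat.
  exact: ltnW (ltn_ord j).
split; first by apply: (S (fun x => cos (x * (w * (N / n%:R))))) => x; rewrite ler_norml cos_geN1 cos_le1.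
rewrite /= -opprD normrN.
by apply: (S (fun x => sin (x * (w * (N / n%:R))))) => x; rewrite ler_norml sin_geN1 sin_le1.
Qed.

(** [b] is a bump at [p] so concentrated that orbits starting near [p] meet it, within [[0, N]],
    only at times with [cos (w * t) > 2^-1]; the periods of [p] are no obstacle, since
    [cos (w * t) = 1] there. All terms are then nonnegative. The bound is uniform in [n], which is
    fixed only after the bumps. *)
Lemma avg_lower_bound (p : M) : exists (b : M -> R) (k : nat), [/\ continuous b, (0 < k)%N &
  \forall x \near p, forall n, (k <= n)%N -> (8 * k%:R)^-1 <= (avg n b x).1].
Proof.
pose K : set R := [set` `[0, N]] `&` [set t | cos (w * t) <= 2^-1].
have cK : compact K.
  apply: compact_closedI; first exact: segment_compact.
  have cc : continuous (fun t : R => cos (w * t)).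
    move=> t; apply: (@continuous_comp _ _ _ (fun t => w * t) (@cos R)); last exact: continuous_cos.
    by apply: continuousM; [exact: cvg_cst|exact: cvg_id].
  apply: (@closed_comp _ _ (fun t : R => cos (w * t)) [set x | x <= 2^-1]) => [x _|].
    exact: cc.
  exact: closed_le.
have KN t : K t -> psi t p <> p.
  move=> [/=]; rewrite in_itv /= => /andP[t0 _] ct tp.
  by move: ct; rewrite (w_period t0 tp) => ct; lra.
have [[V1 V2] /= [V1p V2p] V12] := near_flow_neq psi_cts hM cK KN.
pose V := (V1 `&` V2)°.
have oV : open V by exact: open_interior.
have Vp : V p by apply: filterI.
have VK x t : V x -> K t -> ~ V (psi t x).
  move=> Vx Kt Vt; apply: (V12 (x, psi t x) _ t Kt) => //=; split=> /=.
    by have [] := interior_subset Vx.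
  by have [] := interior_subset Vt.
have sep : uniform_separator (~` V) [set p].
  apply: (normal_separatorP (R := R)).1; first exact: compact_normal.
  - by rewrite closedC.
  - exact: accessible_closed_set1 (hausdorff_accessible hM) _.
  - by apply/seteqP; split=> // x [/= Nx xp]; apply: Nx; rewrite xp.
pose b : M -> R := Urysohn (~` V) [set p].
have bc : continuous b by exact: Urysohn_continuous.
have b01 x : 0 <= b x <= 1.
  have /= := @Urysohn_range M R (~` V) [set p] (b x); rewrite in_itv /=; apply.
  by exists x.
have b0 x : ~ V x -> b x = 0.
  by move=> Vx; apply: (Urysohn_sub0 sep (t := b x)) => //; exists x.
have b1 : b p = 1 by apply: (Urysohn_sub1 sep (t := b p)) => //; exists p.
have : \forall z \near ((0 : R), p), 2^-1 < b (psi z.1 z.2).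
  have C : {for ((0 : R), p), continuous (fun z : R * M => b (psi z.1 z.2))}.
    by apply: (@continuous_comp _ _ _ (fun z : R * M => psi z.1 z.2) b); [exact: psi_cts|exact: bc].
  apply: (C [set x | 2^-1 < x]); rewrite /= psi0 b1; apply: open_nbhs_nbhs; split; first exact: open_gt.
  by rewrite /=; lra.
move=> [[D W] /= [/near_ballP[e e0 De] Wp] DW].
(* The first [n %/ k] sample times are below [N / k < e], and each of their terms is at least
   [4^-1]. As [n <= 2 * k * (n %/ k)], the average is at least [(8 * k)^-1]. *)
pose k := (Num.truncn (N / e)).+1.
have kN : N / k%:R < e.
  have := truncnS_gt (N / e); rewrite -/k !ltr_pdivrMr ?ltr0n //.
  by rewrite mulrC.
exists b, k; split=> //.
apply: filterS (filterI Wp (open_nbhs_nbhs (conj oV Vp))) => x [Wx Vx] n kn.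
have n0 : 0 < n%:R :> R by rewrite ltr0n (leq_trans _ kn).
pose T j := b (psi (j%:R * (N / n%:R)) x) * cos (j%:R * (w * (N / n%:R))).
have TK (j : nat) : (j < n)%N -> b (psi (j%:R * (N / n%:R)) x) != 0 -> 2^-1 < cos (j%:R * (w * (N / n%:R))).
  move=> jn bn; rewrite ltNge; apply/negP => cj; move/eqP: bn; apply; apply: b0.
  apply: VK => //; split => /=; last by rewrite mulrCA.
  rewrite in_itv /=; apply/andP; split; first by rewrite mulr_ge0 // divr_ge0 ?ltW.
  by rewrite mulrA ler_pdivrMr // mulrC (ler_wpM2l (ltW N_gt0)) // ler_nat ltnW.
have T0 (j : nat) : (j < n)%N -> 0 <= T j.
  move=> jn; rewrite /T; have [->|bn] := eqVneq (b (psi (j%:R * (N / n%:R)) x)) 0.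
    by rewrite mul0r.
  rewrite mulr_ge0 //; first by case/andP: (b01 (psi (j%:R * (N / n%:R)) x)).
  by apply: ltW; apply: lt_trans (TK _ jn bn); rewrite invr_gt0.
have T1 (j : nat) : (j < n %/ k)%N -> 4^-1 <= T j.
  move=> jk.
  have jn : (j * k < n)%N.
    by apply: leq_trans (leq_trunc_div n k); rewrite ltn_mul2r jk.
  have j1 : (j < n)%N by apply: leq_ltn_trans jn; rewrite leq_pmulr.
  have bj : 2^-1 < b (psi (j%:R * (N / n%:R)) x).
    apply: (DW (j%:R * (N / n%:R), x)); split=> //=; apply: De.
    rewrite subr0 ger0_norm; last by rewrite mulr_ge0 // divr_ge0 ?ltW.
    apply: le_lt_trans kN; rewrite mulrA ler_pdivrMr // mulrAC ler_pdivlMr ?ltr0n //.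
    by rewrite mulrAC mulrC (ler_wpM2l (ltW N_gt0)) // -natrM ler_nat ltnW.
  have cj : 2^-1 < cos (j%:R * (w * (N / n%:R))).
    by apply: TK => //; rewrite gt_eqF //; apply: lt_trans bj; rewrite invr_gt0.
  rewrite /T; move: bj cj; nra.
rewrite /avg /= [leRHS]mulrC ler_pdivlMr //.
have -> : \sum_(j < n) b (psi (j%:R * (N / n%:R)) x) * cos (j%:R * (w * (N / n%:R))) =
    \sum_(0 <= j < n) T j by rewrite big_mkord.
rewrite (big_cat_nat (n := n %/ k)) //=; last exact: leq_div.
apply: (@le_trans _ _ ((n %/ k)%:R * 4^-1)).
  have nk : (n <= 2 * k * (n %/ k))%N.
    have := ltn_ceil n (ltn0Sn (Num.truncn (N / e))); rewrite -/k mulSn.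
    by have := leq_trunc_div n k; have : (k <= k * (n %/ k))%N;
      [rewrite leq_pmulr // divn_gt0|lia].
  rewrite [leLHS]mulrC ler_pdivrMr ?mulr_gt0 // ?ltr0n //.
  have : n%:R <= (2 * k * (n %/ k))%:R :> R by rewrite ler_nat.
  rewrite !natrM; lra.
have -> : (n %/ k)%:R * 4^-1 = \sum_(0 <= j < n %/ k) 4^-1 :> R.
  by rewrite big_mkord sumr_const card_ord mulr_natl.
rewrite -[leLHS]addr0; apply: lerD.
  by rewrite !big_mkord; apply: ler_sum => j _; apply: T1.
rewrite big_nat; apply: sumr_ge0 => j /andP[_ jn]; exact: T0.
Qed.

Hypothesis l_gt0 : (0 < l)%N.

(** * Contradiction from a square of equivariant maps *)

Section square.
Variables (H : R -> R -> M -> M) (m : nat).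
Hypothesis m_gt0 : (0 < m)%N.
Hypothesis H_cts : continuous (fun z : R * R * M => H z.1.1 z.1.2 z.2).
Hypothesis H_flow : forall x y t p, H x y (psi t p) = psi t (H x y p).
Hypothesis H_x0 : forall x p, 0 <= x <= 1 -> H x 0 p = psi (m%:R * x * N) p.
Hypothesis H_x1 : forall x p, 0 <= x <= 1 -> H x 1 p = p.
Hypothesis H_0y : forall y p, 0 <= y <= 1 -> H 0 y p = p.
Hypothesis H_1y : forall y p, 0 <= y <= 1 -> H 1 y p = p.
Variable p0 : M.

Section product.
Variable L' : nat.
Let d := L'.*2.+2.

Definition iterH (z : 'I_d -> R) : M :=
  foldr (fun i q => H (z (enc i true)) (z (enc i false)) q) p0 (enum 'I_L'.+1).

Lemma iterH_cts : continuous (fun z : 'rV[R]_d => iterH (z 0)).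
Proof.
rewrite /iterH; elim: (enum _) => [|i s IH]; first exact: cst_continuous.
move=> z /=.
apply: (@continuous_comp _ _ _ (fun z : 'rV[R]_d => ((z 0 (enc i true), z 0 (enc i false)),
   foldr (fun i q => H (z 0 (enc i true)) (z 0 (enc i false)) q) p0 s))
   (fun z : R * R * M => H z.1.1 z.1.2 z.2)); last exact: H_cts.
apply: for_continuous_pair; last exact: IH.
by apply: for_continuous_pair; exact: coord_continuous.
Qed.

Variable n' : nat.
Let n := n'.+1.
Let grid (x : 'I_d -> nat) : 'I_d -> R := fun j => (x j)%:R / n%:R.

Lemma grid01 x j : (x j <= n)%N -> 0 <= grid x j <= 1.
Proof.
move=> xn; rewrite /grid divr_ge0 //= ler_pdivrMr ?ltr0n // mul1r ler_nat //.
Qed.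

Lemma iterH_shift_true i x : (forall k, (x k <= n)%N) -> x (enc i true) = 0%N ->
  iterH (grid (face_shift n' (enc i true) x)) = iterH (grid x).
Proof.
move=> xn x0; apply: foldr_ext => j _ q; rewrite /grid !face_shift_enc andbF addn0 andbT.
have [<-|ij] := eqVneq i j; last by rewrite addn0.
rewrite x0 mul1n add0n divff ?pnatr_eq0 // mul0r.
by rewrite H_1y ?H_0y //; exact: grid01.
Qed.

(** On the side [y = 0] the [i]-th map is a time shift, on the side [y = 1] it is the identity;
    [H_flow] moves the shift past the maps outside it. *)
Lemma iterH_shift_false i x : (forall k, (x k <= n)%N) -> x (enc i false) = 0%N ->
  iterH (grid x) = psi ((m * x (enc i true))%:R * (N / n%:R))
                       (iterH (grid (face_shift n' (enc i false) x))).
Proof.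
move=> xn x0; rewrite /iterH.
apply: (foldr_commute (i0 := i)); first exact: enum_uniq.
- by rewrite mem_enum.
- move=> q; rewrite /grid !face_shift_enc eqxx x0 /= addn0 mul1n add0n divff ?pnatr_eq0 // mul0r.
  rewrite H_x0 ?H_x1 ?(grid01 (x := x)) //.
  by rewrite natrM; congr psi; ring.
- by move=> j q ji; rewrite /grid !face_shift_enc eq_sym (negbTE ji) !addn0.
- by move=> j q; rewrite H_flow.
Qed.

End product.

Lemma no_null_homotopy : False.
Proof.
have /choice [b /choice [k0 Hbk]] := avg_lower_bound.
have M0 : [set: M] !=set0 by exists p0.
pose W q : set M := [set x | forall n, (k0 q <= n)%N -> (8 * (k0 q)%:R)^-1 <= (avg n (b q) x).1].
have Wq q : nbhs q (W q) by case: (Hbk q).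
have [L' [p cover]] := compact_finite_cover M0 cM Wq.
pose k := \max_(r < L'.+1) k0 (p r).
have kr r : (k0 (p r) <= k)%N by exact: (leq_bigmax_cond (F := fun r => k0 (p r))).
have k_gt0 : (0 < k)%N.
  by apply: leq_trans (kr ord0); case: (Hbk (p ord0)).
pose c : R := (8 * k%:R)^-1.
have c0 : 0 < c by rewrite invr_gt0 mulr_gt0 ?ltr0n.
(* A vector with first coordinate at least [c] keeps at least [8 * e] after a change by [e], as
   [close_cross] requires. *)
pose e := c / 9.
have e0 : 0 < e by rewrite divr_gt0.
pose d := L'.*2.+2.
pose K : set ('rV[R]_d * R) := [set v : 'rV[R]_d | forall i, [set` `[0, 1]%R] (v ord0 i)] `*` [set` `[0, N]].
have cK : compact K.
  apply: compact_setX; last exact: segment_compact.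
  exact: (@rV_compact R d (fun=> [set` `[0, 1]%R]) (fun=> @segment_compact R 0 1)).
pose f r (z : 'rV[R]_d * R) := b (p r) (psi z.2 (iterH (z.1 0))).
have fc r : continuous (f r).
  move=> z; apply: (@continuous_comp _ _ _ (fun z : 'rV[R]_d * R => psi z.2 (iterH (z.1 0))) (b (p r))).
    apply: (@continuous_comp _ _ _ (fun z : 'rV[R]_d * R => (z.2, iterH (z.1 0))) (fun z => psi z.1 z.2)).
      apply: for_continuous_pair; first exact: cvg_snd.
      apply: (@continuous_comp _ _ _ fst (fun z : 'rV[R]_d => iterH (z 0))); first exact: cvg_fst.
      exact: iterH_cts.
    exact: psi_cts.
  by case: (Hbk (p r)) => h _ _; exact: h.
have Ex r : exists nr : nat, forall z z', K z -> `|z' - z| < nr.+1%:R^-1 -> `|f r z' - f r z| < e.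
  have [dl dl0 Hdl] := compact_uniform cK (fc r) e0.
  exists (Num.truncn dl^-1) => z z' Kz zz'; apply: Hdl => //; apply: lt_trans zz' _.
  by rewrite invf_plt ?posrE ?ltr0n // truncnS_gt.
have {Ex} /choice [nr Hnr] := Ex.
(* The three terms serve the lower bound of the averages, their variation by at most [e] along an
   edge, and [m * th < pi / 4], which says [8 * l * m < n]. *)
pose n' := (k + \max_(r < L'.+1) (nr r).+1 + 8 * l * m)%N.
pose n := n'.+1.
have nr_n r : (nr r).+1%:R^-1 > n%:R^-1 :> R.
  rewrite ltf_pV2 ?posrE ?ltr0n // ltr_nat /n ltnS.
  have : ((nr r).+1 <= \max_(r < L'.+1) (nr r).+1)%N by exact: (leq_bigmax_cond (F := fun r => (nr r).+1)).
  rewrite /n'; lia.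
pose h := N / n%:R; pose th := w * h.
have n0 : 0 < n%:R :> R by rewrite ltr0n.
have thE : n%:R * th = l%:R * (pi *+ 2).
  by rewrite /th /h /w; field; rewrite !gt_eqF //.
have th0 : 0 < th.
  by rewrite -(pmulr_rgt0 _ n0) thE mulr_gt0 ?ltr0n // mulrn_wgt0 // pi_gt0.
have thm : m%:R * th < pi / 4.
  rewrite -(ltr_pM2l n0) mulrCA thE.
  have : (8 * l * m)%:R < n%:R :> R by rewrite ltr_nat /n /n'; lia.
  rewrite !natrM; have := pi_gt0 R; rewrite mulr2n; nra.
pose grid (x : 'I_d -> nat) : 'I_d -> R := fun j => (x j)%:R / n%:R.
pose F r x := avg n (b (p r)) (iterH (grid x)).
(* Chosen so that [kappa * n], by which [lam0] changes across a face [y_i = 0], is the rotation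
   [- m * th] of the sections for a unit step in [x_i]. *)
pose kappa := - (m%:R * th) / n%:R.
have kappa0 : kappa != 0.
  by rewrite lt_eqF // /kappa mulNr oppr_lt0 divr_gt0 // mulr_gt0 // ltr0n.
pose big r x := (8 * e) ^+ 2 <= sqn (F r x).
(* Where the section is small no angle is defined; [lam0] is the default because it makes
   [lam r - lam0] vanish there, hence periodic. *)
pose lam r x y := if big r x && big r y then ang (F r x) (F r y) else lam0 kappa x y.
have Fnear r x y : grid_adj n' x y \/ grid_adj n' y x ->
    `|(F r y).1 - (F r x).1| <= e /\ `|(F r y).2 - (F r x).2| <= e.
  move=> xy; apply: avg_dist => //; first exact: ltW.
  move=> t tN.
  have E z : iterH (grid z) = iterH ((\row_j grid z j) 0).
    by congr iterH; apply/funext => j; rewrite mxE.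
  rewrite !E; apply: ltW; apply: (Hnr r (\row_j grid x j, t) (\row_j grid y j, t)).
    split=> /=; last by rewrite in_itv.
    move=> i; rewrite mxE /= in_itv /=; apply: grid01.
    by case: xy => /grid_adj_le/(_ i)[].
  apply: le_lt_trans (nr_n r); rewrite prod_normE /= subrr normr0 ge_max; apply/andP; split; last by rewrite invr_ge0 ltW.
  apply: rV_norm_le; first by rewrite invr_ge0 ltW.
  move=> j; rewrite !mxE /grid -mulrBl normrM [X in _ * X]gtr0_norm ?invr_gt0 //.
  rewrite -[leRHS]mul1r ler_wpM2r ?invr_ge0 ?(ltW n0) //.
  have : (x j = y j \/ (x j).+1 = y j) \/ (y j).+1 = x j.
    case: xy => /grid_adj_step/(_ j)[->|->]; [by left; left|by left; right|by left; left|by right].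
  case=> [[->|<-]|<-]; first by rewrite subrr normr0.
    by rewrite -natr1 addrC addKr normr1.
  by rewrite -natr1 opprD addrA subrr sub0r normrN normr1.
have Fcross r x y : grid_adj n' x y -> big r x -> `|cross (F r x) (F r y)| < dot (F r x) (F r y).
  move=> xy bx; have [h1 h2] := Fnear r x y (or_introl xy).
  exact: (close_cross e0).
apply: (@torus_cover R L' n' kappa kappa0 lam).
- move=> r j x y xy xj yj.
  have xn i : (x i <= n)%N by have [] := grid_adj_le xy i.
  have yn i : (y i <= n)%N by have [] := grid_adj_le xy i.
  rewrite -(decK j) in xj yj *; move: (dec j) (odd j) xj yj => i [] xj yj.
    have Fs z : (forall k, (z k <= n)%N) -> z (enc i true) = 0%N -> F r (face_shift n' (enc i true) z) = F r z.
      by move=> zn z0; rewrite /F /grid iterH_shift_true.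
    by rewrite /lam /big lam0_shift_true !Fs.
  have Fs z : (forall k, (z k <= n)%N) -> z (enc i false) = 0%N ->
      F r (face_shift n' (enc i false) z) = rotv (- ((m * z (enc i true))%:R * th)) (F r z).
    move=> zn z0; rewrite /F /grid [in RHS](iterH_shift_false zn z0) avg_rot // rotvD.
    by rewrite -/n -/h -/th addNr rotv0.
  rewrite /lam /big !Fs // !sqn_rotv -!/(big r _).
  case: ifP => [/andP[bx by_]|_]; last by rewrite !subrr.
  have -> : - ((m * y (enc i true))%:R * th) = - ((m * x (enc i true))%:R * th) -
      m%:R * th * ((y (enc i true))%:R - (x (enc i true))%:R).
    by rewrite !natrM; ring.
  rewrite ang_shift; last 2 first.
  - exact: Fcross.
  - have : (y (enc i true) = x (enc i true) \/ y (enc i true) = (x (enc i true)).+1).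
      exact: grid_adj_step.
    case=> ->; first by rewrite subrr mulr0 oppr0 normr0 divr_gt0 // pi_gt0.
    rewrite -natr1 addrAC subrr add0r mulr1 normrN ger0_norm //.
    by rewrite mulr_ge0 // ltW.
  rewrite lam0_shift_false /kappa divfK ?gt_eqF //; ring.
(* Some section is large at the base [v]; it varies by at most [e] from there, so it is large at all
   vertices of the simplex. The angles then add up and the curvature vanishes. *)
- move=> v s vn; have [r Hr] := cover (iterH (grid v)).
  exists r.
  have Fv : c <= (F r v).1.
    apply: le_trans (Hr n _).
      rewrite lef_pV2 ?posrE ?mulr_gt0 ?ltr0n // ?(ler_pM2l) ?ltr0n ?ler_nat //.
      by case: (Hbk (p r)).
    by apply: leq_trans (kr r) _; rewrite /n /n'; lia.
  have bigk i : big r (kuhn v s i).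
    have [h1 _] := Fnear r v (kuhn v s i) (or_introl (kuhn_adj_base s i vn)).
    rewrite /big /sqn -[leLHS]addr0 lerD ?sqr_ge0 //.
    move: h1; rewrite ler_norml => /andP[h1 _].
    by rewrite ler_pXn2r ?nnegrE //; rewrite /e in h1 *; lra.
  rewrite /dlam /lam !bigk /=.
  have adj i j : (i <= j)%N -> `|cross (F r (kuhn v s i)) (F r (kuhn v s j))| <
      dot (F r (kuhn v s i)) (F r (kuhn v s j)).
    by move=> ij; have a := kuhn_adj s vn ij; exact: (Fcross _ _ _ a (bigk i)).
  by apply: ang_add; apply: adj; rewrite leq_add2l.
Qed.

End square.
End sections.

(** * Strict contactomorphisms commute with the Reeb flow *)

Section top_forms.
Context {R : realType} {n : nat}.
Let V := 'rV[R]_n.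
Variable u : V.

Definition slot p (v : 'I_p -> V) (i : 'I_p) (x : V) : 'I_p -> V := fun j => if j == i then x else v j.

(** Such forms come from the quotient by the line of [u], of dimension [n - 1] when [u != 0]. *)
Definition horizontal p (a : pform p) :=
  (forall v i c x y, a (slot v i (c *: x + y)) = c * a (slot v i x) + a (slot v i y)) /\
  (forall v i, v i = u -> a v = 0) :> Prop.

Lemma slot_inj p q (v : 'I_p -> V) i x (f : 'I_q -> 'I_p) k : injective f -> f k = i ->
  (fun j => slot v i x (f j)) = slot (fun j => v (f j)) k x.
Proof. by move=> fI <-; apply/funext => j; rewrite /slot (inj_eq fI). Qed.

Lemma slot_out p q (v : 'I_p -> V) i x (f : 'I_q -> 'I_p) : (forall j, f j != i) ->
  (fun j => slot v i x (f j)) = (fun j => v (f j)).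
Proof. by move=> fi; apply/funext => j; rewrite /slot (negbTE (fi j)). Qed.

Lemma wedge_horizontal p q (a : pform p) (b : pform q) : horizontal a -> horizontal b ->
  horizontal (wedge a b).
Proof.
move=> [aL aU] [bL bU]; split=> [v i c x y|v i vi]; rewrite /wedge.
  rewrite [RHS]addrC mulrCA -[RHS]addrC -mulrDr; congr (_ * _).
  rewrite mulr_sumr -big_split; apply: eq_bigr => s _ /=.
  have lI : injective (fun k => s (lshift q k)) by move=> k k' /perm_inj/lshift_inj.
  have rI : injective (fun k => s (rshift p k)) by move=> k k' /perm_inj/rshift_inj.
  have [k Ek|k Ek] := splitP ((s^-1)%g i).
    have sk : s (lshift q k) = i.
      by rewrite -[RHS](permKV s); congr (s _); apply/val_inj.
    have ne j : s (rshift p j) != i.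
      by apply/eqP; rewrite -sk => /perm_inj E; have := eq_lrshift k j; rewrite E eqxx.
    have E1 z := slot_inj v z lI sk.
  have E2 z := slot_out v z ne.
  rewrite (E1 (c *: x + y)) (E1 x) (E1 y) (E2 (c *: x + y)) (E2 x) (E2 y).
  rewrite aL.
  by rewrite mulrDl mulrDr; congr (_ + _); rewrite -mulrA mulrCA.
  have sk : s (rshift p k) = i.
    by rewrite -[RHS](permKV s); congr (s _); apply/val_inj.
  have ne j : s (lshift q j) != i.
    by apply/eqP; rewrite -sk => /perm_inj E; have := eq_lrshift j k; rewrite E eqxx.
  have E1 z := slot_inj v z rI sk.
  have E2 z := slot_out v z ne.
  rewrite (E1 (c *: x + y)) (E1 x) (E1 y) (E2 (c *: x + y)) (E2 x) (E2 y).
  rewrite bL.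
  by rewrite !mulrDr; congr (_ + _); rewrite !(mulrCA _ c).
rewrite big1 ?mulr0 // => s _.
have [k Ek|k Ek] := splitP ((s^-1)%g i).
  rewrite (aU _ k) ?mul0r ?mulr0 //.
  by rewrite -vi -[in RHS](permKV s i); congr (v (s _)); apply/val_inj.
rewrite (bU _ k) ?mul0r ?mulr0 //.
by rewrite -vi -[in RHS](permKV s i); congr (v (s _)); apply/val_inj.
Qed.

Lemma wedge_pow_horizontal p (a : pform p) k : horizontal a -> horizontal (wedge_pow a k).
Proof.
move=> ha; elim: k => [|k IH]; last exact: wedge_horizontal.
by split=> v [].
Qed.

Lemma wedge_perm p q (a : @pform R V p) (b : pform q) v (t : 'S_(p + q)) :
  wedge a b (fun i => v (t i)) = (-1) ^+ t * wedge a b v.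
Proof.
rewrite /wedge mulrCA; congr (_ * _).
rewrite [in RHS](reindex_inj (mulIg t)) /= mulr_sumr; apply: eq_bigr => s _.
rewrite [RHS]mulrA odd_permM -signr_addb addbC addbK.
by congr (_ * (a _ * b _)); apply/funext => i; rewrite permM.
Qed.

Lemma wedge_alternating p q (a : @pform R V p) (b : pform q) v i j : i != j -> v i = v j ->
  wedge a b v = 0.
Proof.
move=> ij vij; have := wedge_perm a b v (tperm i j).
rewrite odd_tperm ij expr1 mulN1r.
have -> : (fun k => v (tperm i j k)) = v.
  by apply/funext => k; case: tpermP => [->|->|].
move=> E; have {}E : wedge a b v + wedge a b v = 0 by rewrite {1}E addNr.
by move: E; rewrite -mulr2n => /eqP; rewrite mulrn_eq0 => /eqP.
Qed.

(** The [p + q >= n] arguments are linearly dependent modulo [u]. Replacing [v i] by a combination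
    [c *m X] that is a multiple of [u] gives zero by horizontality, and [c 0 i] times the value by
    alternation. *)
Lemma wedge_top_zero p q (a : pform p) (b : pform q) v : u != 0 -> (n <= p + q)%N ->
  horizontal a -> horizontal b -> wedge a b v = 0.
Proof.
move=> u0 npq ha hb; have [wL wU] := wedge_horizontal ha hb.
have w0 z i : wedge a b (slot z i 0) = 0.
  by have := wL z i (-1) 0 0; rewrite scaler0 addr0 mulN1r addNr.
pose X : 'M[R]_(p + q, n) := \matrix_i v i.
have [c c0 cu] : exists2 c : 'rV[R]_(p + q), c != 0 & (c *m X <= u)%MS.
  have rk : (\rank (X *m cokermx u) < p + q)%N.
    apply: leq_ltn_trans (mxrankM_maxr _ _) _.
    rewrite mxrank_coker rank_rV u0 /=.
    have n0 : (0 < n)%N.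
      have [j _] := rV0Pn _ u0; exact: leq_ltn_trans (ltn_ord j).
    by rewrite (leq_trans _ npq) // subn1 prednK.
  have : kermx (X *m cokermx u) != 0 by rewrite -mxrank_eq0 mxrank_ker -lt0n subn_gt0.
  move=> /rowV0Pn[c /sub_kermxP cX c0]; exists c => //.
  by rewrite submxE -mulmxA cX.
have [lm cE] : exists lm, c *m X = lm *: u by apply/sub_rVP.
have [i ci] : exists i, c 0 i != 0 by apply/rV0Pn.
have E : wedge a b (slot v i (c *m X)) = c 0 i * wedge a b v.
  have S (s : seq 'I_(p + q)) : wedge a b (slot v i (\sum_(j <- s) c 0 j *: v j)) =
      \sum_(j <- s) c 0 j * wedge a b (slot v i (v j)).
    elim: s => [|j s IH]; first by rewrite !big_nil w0.
    by rewrite !big_cons wL IH.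
  have -> : c *m X = \sum_j c 0 j *: v j.
    by rewrite mulmx_sum_row; apply: eq_bigr => j _; rewrite rowK.
  rewrite S (bigD1 i) //= big1 ?addr0 => [|j ji].
    by congr (_ * wedge _ _ _); apply/funext => k; rewrite /slot; case: eqP => [->|].
  rewrite (@wedge_alternating _ _ _ _ _ i j) ?mulr0 //; first by rewrite eq_sym.
  by rewrite /slot eqxx (negbTE ji).
apply/eqP; move: E; rewrite cE -[lm *: u]addr0 wL w0 addr0.
rewrite (wU _ i) ?mulr0; last by rewrite /slot eqxx.
by move/esym/eqP; rewrite mulf_eq0 (negbTE ci).
Qed.

End top_forms.

Lemma pairingDl {R : realType} {n : nat} (a b : 'cV[R]_n) (v : 'rV[R]_n) :
  pairing (a + b) v = pairing a v + pairing b v.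
Proof. by rewrite /pairing mulmxDr mxE. Qed.

Lemma pairingZl {R : realType} {n : nat} c (a : 'cV[R]_n) (v : 'rV[R]_n) :
  pairing (c *: a) v = c * pairing a v.
Proof. by rewrite /pairing -scalemxAr mxE. Qed.

Lemma pairingBl {R : realType} {n : nat} (a b : 'cV[R]_n) (v : 'rV[R]_n) :
  pairing (a - b) v = pairing a v - pairing b v.
Proof. by rewrite -scaleN1r pairingDl pairingZl mulN1r. Qed.

Lemma is_derive_tx {R : realType} {n : nat} (a : R -> R) (b : R -> 'rV[R]_n) (t : R) a' b' :
  is_derive t (1 : R) a a' -> is_derive t (1 : R) b b' ->
  is_derive t (1 : R) (fun s => tx (a s) (b s)) (tx a' b').
Proof.
move=> Ha /is_derive_coord Hb; apply/is_derive_coord => i j; rewrite [tx a' b' i j]mxE.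
have -> : (fun s => tx (a s) (b s) i j) =
    match fintype.split j with inl _ => a | inr l => fun s => b s i l end.
  by apply/funext => s; rewrite mxE; case: (fintype.split j) => l //; rewrite mxE.
by case: (fintype.split j) => l; [rewrite mxE|exact: Hb].
Qed.

Section contact_kernel.
Context {R : realType} {k : nat} {M : topologicalType}.
Variables (A : smooth_atlas R k.*2.+1 M) (eta : one_form A) (xi : vector_field A).
Hypothesis contact_eta : contact k eta.

(** If [u] were nonzero, [eta] and [d eta] would both be horizontal for it, and their product of
    degree [1 + 2 k], the dimension, would vanish. *)
Lemma contact_kernel i x u : chart_img i x -> pairing (of_loc eta i x) u = 0 ->
  (forall v, ext_deriv eta i x u v = 0) -> u = 0.
Proof.
move=> ix eu du; apply/eqP; apply: contraT => u0.
have [v] := contact_eta ix; rewrite (wedge_top_zero v u0) ?eqxx //.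
- by rewrite muln2.
- split=> [w j c y z|w j wj]; rewrite /form_at /slot.
    by rewrite !(ord1 j) /= pairingD pairingZ.
  by rewrite -[ord0](ord1 j) wj.
- apply: wedge_pow_horizontal; split=> [w j c y z|w j wj]; rewrite /dform_at.
    have [->|->] : j = ord0 \/ j = ord_max.
      by case: j => -[|[|//]] h; [left|right]; apply/val_inj.
      have E x' : slot w ord0 x' ord0 = x' by [].
      have E' x' : slot w ord0 x' ord_max = w ord_max by [].
      by rewrite !ext_derivE // !E !E' lincombD lincombZ pairingD pairingZ pairingDl pairingZl; ring.
    have E x' : slot w ord_max x' ord0 = w ord0 by [].
    have E' x' : slot w ord_max x' ord_max = x' by [].
    by rewrite !ext_derivE // !E !E' lincombD lincombZ pairingD pairingZ pairingDl pairingZl; ring.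
  have anti a b : ext_deriv eta i x a b = - ext_deriv eta i x b a by rewrite /ext_deriv opprB.
  have [j0|j1] : j = ord0 \/ j = ord_max.
    by case: j {wj} => -[|[|//]] h; [left|right]; apply/val_inj.
  - by rewrite -j0 wj du.
  - by rewrite anti -j1 wj du oppr0.
Qed.

End contact_kernel.

(** * Strict contactomorphisms and the Reeb field *)

Section strict_contact.
Context {R : realType} {n : nat} {M : topologicalType}.
Variables (A : smooth_atlas R n M) (eta : one_form A).

(** Differentiating [f^* eta = eta] produces second derivatives of [f], which are symmetric and
    cancel in the antisymmetrization. *)
Lemma pullback_ext_deriv (f : M -> M) i j x v w : smooth_map A f ->
  pulls_back f (of_loc eta) (of_loc eta) -> locdom f i j x ->
  ext_deriv eta j (loc f i j x) (v *m jac (loc f i j) x) (w *m jac (loc f i j) x) =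
  ext_deriv eta i x v w.
Proof.
move=> sf pf fx; set F := loc f i j.
have oU : open (locdom f i j) by apply: locdom_open; case: sf.
have sU : smooth_on (locdom f i j) F by case: sf.
have ix : chart_img i x by case: fx.
have jy : chart_img j (F x) by case: fx => _ /chart_in.
have sF : sdf F x by exact: smooth_map_sdf.
have E a b : 'D_a (fun y => pairing (of_loc eta i y) b) x =
    pairing (lincomb (partials (of_loc eta j) (F x)) (a *m jac F x)) (b *m jac F x) +
    pairing (of_loc eta j (F x)) ('D_a ('D_b F) x).
  have N : \forall y \near x, pairing ((of_loc eta j \o F) y) ('D_b F y) = pairing (of_loc eta i y) b.
    by apply: filterS (open_nbhs_nbhs (conj oU fx)) => y; exact: pf.
  rewrite -(near_eq_derive a N).
  have D1 : is_derive x a (of_loc eta j \o F) (lincomb (partials (of_loc eta j) (F x)) (a *m jac F x)).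
    have := sdiff_is_derive a (sdiff_comp sF (of_sdf eta jy)).
    by rewrite -lincomb_comp lincomb_jac.
  have D2 : is_derive x a ('D_b F) ('D_a ('D_b F) x).
    by have [? _] := sdiff_is_derive a (sdiff_deriv b oU sU fx); exact: DeriveDef.
  have := is_derive_pairing D1 D2; rewrite derive_jac //.
  by move=> [_].
rewrite [RHS]/ext_deriv !E ext_derivE // (schwarz v w oU sU fx); ring.
Qed.

End strict_contact.

Section strict_reeb.
Context {R : realType} {k : nat} {M : topologicalType}.
Variables (A : smooth_atlas R k.*2.+1 M) (eta : one_form A) (xi : vector_field A).
Hypothesis contact_eta : contact k eta.
Hypothesis reeb_xi : is_reeb eta xi.
Variable psi : R -> M -> M.
Hypothesis flow_psi : is_flow xi psi.
Hypothesis hM : hausdorff_space M.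

(** The difference of the two vectors is killed by [eta] and [d eta], so [contact_kernel] applies.
    The inverse [g] shows that every [v] is in the image of the differential. *)
Lemma strict_preserves_reeb (f : M -> M) i j x : is_diffeo A f ->
  pulls_back f (of_loc eta) (of_loc eta) -> locdom f i j x ->
  vf_loc xi i x *m jac (loc f i j) x = vf_loc xi j (loc f i j x).
Proof.
move=> [sf [g [sg fg gf]]] pf fx; set F := loc f i j.
have ix : chart_img i x by case: fx.
have jy : chart_img j (F x) by case: fx => _ /chart_in.
have gy : locdom g j i (F x).
  by split=> //; case: fx => _ fj; rewrite /F /loc chartK // fg; exact: chart_inv_in.
have gE : loc g j i (F x) = x.
  by case: fx => _ fj; rewrite /F /loc chartK // fg chart_invK.
have J1 : jac (loc g j i) (F x) *m jac F x = 1%:M.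
  have fx' : locdom f i j (loc g j i (F x)) by rewrite gE.
  have [_] := jac_loc_comp sg sf gy fx'; rewrite gE => <-.
  by rewrite (_ : f \o g = id) ?jac_loc_id //; apply/funext => p /=; rewrite gf.
have [e1 d1] := reeb_xi ix; have [e2 d2] := reeb_xi jy.
apply/eqP; rewrite -subr_eq0; apply/eqP; apply: (contact_kernel contact_eta jy).
  rewrite pairingB e2 -derive_jac; last exact: smooth_map_sdf.
  by rewrite pf // e1 subrr.
move=> v.
have -> : v = v *m jac (loc g j i) (F x) *m jac F x by rewrite -mulmxA J1 mulmx1.
move: (v *m _) => w.
rewrite ext_derivE // !lincombB !pairingB pairingBl.
have := pullback_ext_deriv (vf_loc xi i x) w sf pf fx; rewrite d1 ext_derivE // -/F => E.
have := d2 (w *m jac F x); rewrite ext_derivE // => E'; move: E E'; lra.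
Qed.

(** The curve [psi (- s) (f (psi s p))] has velocity zero: [f] and [psi (- s)] both carry [xi] to
    [xi], and the time derivative of [psi (- s)] contributes [- xi]. *)
Lemma strict_commutes (f : M -> M) t p : is_diffeo A f ->
  pulls_back f (of_loc eta) (of_loc eta) -> f (psi t p) = psi t (f p).
Proof.
move=> df pf; have sf : smooth_map A f by case: df.
have cf : continuous f by case: sf.
pose c s := psi (- s) (f (psi s p)).
have cc : continuous c.
  move=> s; apply: (flow_continuous2 flow_psi); first exact: continuousN.
  apply: (@continuous_comp _ _ _ (psi^~ p) f); last exact: cf.
  exact: (flow_orbit_continuous flow_psi).
have H s : exists2 i : chart_index A, chart_dom i (c s) & \forall r \near s, is_derive (r : R) (1 : R) (chart i \o c) 0.
  have [i ic] := chart_cover A (c s); exists i => //.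
  have : nbhs s (c @^-1` chart_dom i).
    by apply: cc; apply: open_nbhs_nbhs; split=> //; exact: chart_dom_open.
  apply: filterS => {ic}r ic.
  have [a pa] := chart_cover A (psi r p).
  have [b qb] := chart_cover A (f (psi r p)).
  pose h s := chart a (psi s p); pose F := loc f a b.
  pose g s := tx (- s) (F (h s)).
  have fx : locdom f a b (h r).
    by split; [exact: chart_in|rewrite /h chartK].
  have yE : F (h r) = chart b (f (psi r p)) by rewrite /F /loc /h chartK.
  have py : locdom (psi (- r)) b i (F (h r)).
    by split; rewrite yE ?chartK //; exact: chart_in.
  have N : \forall s \near r, (flow_loc psi b i \o g) s = (chart i \o c) s.
    have : nbhs r ((psi^~ p) @^-1` (chart_dom a `&` f @^-1` chart_dom b)).
      apply: (flow_orbit_continuous flow_psi); apply: open_nbhs_nbhs; split=> //.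
      apply: openI; first exact: chart_dom_open.
      by apply: open_comp => [z _|]; [exact: cf|exact: chart_dom_open].
    apply: filterS => z [/= za zb].
    by rewrite /g flow_loc_tx /F /h /loc !chartK.
  apply: near_eq_is_derive N _.
  have Dh : is_derive r (1 : R) (F \o h) (vf_loc xi b (F (h r))).
    rewrite -(strict_preserves_reeb df pf fx).
    apply: sdf_curve; first exact: (flow_integral flow_psi).
    exact: smooth_map_sdf.
  have Dg : is_derive r (1 : R) g (tx (- 1) (vf_loc xi b (F (h r)))).
    exact: is_derive_tx.
  have := sdf_curve Dg (flow_loc_sdf flow_psi py).
  rewrite (flow_jac flow_psi py) strict_preserves_reeb //.
    by rewrite scaleN1r addNr.
    exact: (flow_is_diffeo flow_psi).
  exact: (flow_preserves_form reeb_xi flow_psi).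
have := locally_constant_curve hM cc H t 0.
rewrite /c oppr0 !(flow0 flow_psi) => <-.
by rewrite -(flowD flow_psi) subrr (flow0 flow_psi).
Qed.

End strict_reeb.

(** * Loops of strict contactomorphisms *)

Lemma near_ball {R : realType} {V : normedModType R} (x : V) e : 0 < e ->
  nbhs x [set y : V | `|y - x| < e].
Proof. by move=> e0; apply: (near_ballP x _).1; exists e. Qed.

(** * Evaluation and flow in the C^oo topology *)

Section Coo_topology.
Context {R : realType} {n : nat} {M : topologicalType}.
Variable A : smooth_atlas R n M.

Lemma diffeo_smooth (g : diffeo A) : smooth_map A g.
Proof. by case: g => g []. Qed.

Lemma Coo_subbase_nbhs (g : diffeo A) (B : set (diffeo A)) : Coo_subbase B -> B g -> nbhs g B.
Proof.
move=> SB Bg; exists B; split => //.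
exists [set B]; last by rewrite bigcup_set1.
by move=> _ ->; exact: (@finI_from1 _ _ (@Coo_subbase R n M A) id).
Qed.

Lemma Coo_cvg {T : Type} (F : set_system T) (f : T -> diffeo A) (g : diffeo A) : Filter F ->
  (forall B, Coo_subbase B -> B g -> F (f @^-1` B)) -> f @ F --> g.
Proof.
move=> FF H S [X [/= [D DF <-] [B DB Bg]] BS].
have [E ES EB] := DF _ DB.
have FB : F (f @^-1` B).
  rewrite -EB preimage_bigcap; apply: filter_bigI => C CE.
  by apply: H; [have := ES _ CE; rewrite inE|move: Bg; rewrite -EB; apply].
by apply: filterS FB => x Bx; apply: BS; exists B.
Qed.

(** Order zero suffices: the empty list of derivatives on a closed cube [K] about [p0]. Half of the
    radius [d] is spent on the motion of the point, half on the change of the map. *)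
Lemma eval_continuous (g0 : diffeo A) (p0 : M) :
  {for (g0, p0), continuous (fun z : diffeo A * M => z.1 z.2)}.
Proof.
move=> U /= Ug.
have [i ip] := chart_cover A p0; have [j jq] := chart_cover A (g0 p0).
have sg := diffeo_smooth g0.
have jy : chart_img j (chart j (g0 p0)) by exact: chart_in.
have Uj : nbhs (chart_inv j (chart j (g0 p0))) U by rewrite chartK.
have /near_ballP[d d0 Hd] := nbhs_chart_inv jy Uj.
have x0 : locdom g0 i j (chart i p0) by split; [exact: chart_in|rewrite chartK].
have y0 : loc g0 i j (chart i p0) = chart j (g0 p0) by rewrite /loc chartK.
have [c0 _] := sg.2 i j [::] _ x0.
have d2 : 0 < d / 2 by rewrite divr_gt0.
have N : \forall x \near chart i p0, locdom g0 i j x /\ `|loc g0 i j x - chart j (g0 p0)| < d / 2.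
  apply: filterI; first by apply: open_nbhs_nbhs; split=> //; apply: locdom_open; exact: sg.1.
  rewrite -y0; apply: (c0 [set y | `|y - _| < d / 2]).
  exact: near_ball.
have /near_ballP[r r0 Hr] := N.
have r2 : 0 < r / 2 by rewrite divr_gt0.
have r2r : r / 2 < r by rewrite ltr_pdivrMr // ltr_pMr // ltr1n.
pose K := [set x : 'rV[R]_n | forall k, [set` `[chart i p0 0 k - r / 2, chart i p0 0 k + r / 2]%R] (x 0 k)].
have cK : compact K.
  apply: (@rV_compact R n (fun k => [set` `[chart i p0 0 k - r / 2, chart i p0 0 k + r / 2]%R])).
  by move=> k; exact: segment_compact.
have KB x : K x -> `|x - chart i p0| < r.
  move=> Kx; apply: le_lt_trans r2r; apply: rV_norm_le; first exact: ltW.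
  move=> k; have := Kx k; rewrite /= in_itv /= !mxE ler_norml.
  move: (x 0 k) (chart i p0 0 k) (r / 2) => a b c; clear; lra.
have BK x : `|x - chart i p0| < r / 2 -> K x.
  move=> xr k; rewrite /= in_itv /= -ler_distlC.
  have := rV_norm_coord (x - chart i p0) k; rewrite !mxE distrC => h.
  exact: le_trans h (ltW xr).
have nB : nbhs g0 (Coo_nbhd g0 i j K [::] (d / 2)).
  apply: Coo_subbase_nbhs.
    exists g0, i, j, K, [::], (d / 2); split=> //.
    by move=> x /KB/Hr[].
  split; first by move=> x /KB/Hr[].
  by move=> x _; rewrite subrr normr0.
have nP : nbhs p0 [set q | chart_dom i q /\ `|chart i q - chart i p0| < r / 2].
  apply: (nbhs_chart (U := [set x | `|x - chart i p0| < r / 2])) => //.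
  exact: near_ball.
exists (Coo_nbhd g0 i j K [::] (d / 2), [set q | chart_dom i q /\ `|chart i q - chart i p0| < r / 2]).
  by [].
move=> [g p] [/= [Kg Hg] [ip' pr]].
have Kx : K (chart i p) by exact: BK.
have [_ gj] := Kg _ Kx; rewrite chartK // in gj.
have gE : loc g i j (chart i p) = chart j (g p) by rewrite /loc chartK.
have [_] : chart_img j (chart j (g p)) /\ U (chart_inv j (chart j (g p))).
  apply: Hd; rewrite -gE (splitr d) -(subrKA (loc g0 i j (chart i p))).
  apply: le_lt_trans (ler_normD _ _) _; apply: ltrD; first exact: Hg.
  by have [] := Hr _ (KB _ Kx).
by rewrite chartK.
Qed.

Variables (xi : vector_field A) (psi : R -> M -> M).
Hypothesis flow_psi : is_flow xi psi.

(** The space derivatives of [psi r] are slices of derivatives of the joint flow, hence continuous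
    in [(r, x)]; compactness of [K] gives uniformity. *)
Lemma flow_Coo_continuous : continuous (fun t => Diffeo (flow_is_diffeo flow_psi t)).
Proof.
move=> t; apply: Coo_cvg => _ [f [i [j [K [s [e [sf cK Kf e0 ->]]]]]]] [Kt Ht].
have Kg : \forall r \near t, forall x, K x -> locdom (psi r) i j x /\
    `|pderiv s (loc (psi r) i j) x - pderiv s (loc f i j) x| < e.
  move: cK => /compact_near_coveringP cK.
  apply: (cK _ (nbhs t) (fun r x => locdom (psi r) i j x /\
    `|pderiv s (loc (psi r) i j) x - pderiv s (loc f i j) x| < e)) => x Kx.
  pose G := pderiv [seq rshift 1 k | k <- s] (flow_loc psi i j).
  have GE r y : pderiv s (loc (psi r) i j) y = G (tx r y).
    by rewrite loc_flow_slice pderiv_slice.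
  (* Half of the margin left at [x]: the subbasic set is centred at [f], not at [psi t]. *)
  pose e1 := (e - `|G (tx t x) - pderiv s (loc f i j) x|) / 2.
  have e10 : 0 < e1 by rewrite divr_gt0 // subr_gt0 -GE; exact: Ht.
  have tU : flow_locdom psi i j (tx t x) by apply/flow_locdom_tx; exact: Kt.
  have [cG _] := flow_smooth_on flow_psi [seq rshift 1 k | k <- s] tU.
  have [cf _] := sf.2 i j s _ (Kf _ Kx).
  have N1 : \forall y \near tx t x, flow_locdom psi i j y /\ `|G y - G (tx t x)| < e1.
    apply: filterI.
      by apply: open_nbhs_nbhs; split=> //; exact: (flow_locdom_open flow_psi).
    by apply: (cG [set y | `|y - _| < e1]); exact: near_ball.
  have N2 : \forall y \near x, `|pderiv s (loc f i j) y - pderiv s (loc f i j) x| < e1.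
    by apply: (cf [set y | `|y - _| < e1]); exact: near_ball.
  have /near_ballP[d d0 Hd] := N1.
  exists ([set y | `|y - x| < d] `&` [set y | `|pderiv s (loc f i j) y - pderiv s (loc f i j) x| < e1],
          [set r | `|r - t| < d]) => /=.
    split; last exact: near_ball.
    by apply: filterI => //; exact: near_ball.
  move=> [y r] [/= [yx fy] rt].
  have [/flow_locdom_tx h1 h2] : flow_locdom psi i j (tx r y) /\ `|G (tx r y) - G (tx t x)| < e1.
    by apply: Hd; rewrite txB tx_norm_ltP.
  split=> //; rewrite GE.
  have -> : G (tx r y) - pderiv s (loc f i j) y = (G (tx r y) - G (tx t x)) +
      ((G (tx t x) - pderiv s (loc f i j) x) - (pderiv s (loc f i j) y - pderiv s (loc f i j) x)).
    by rewrite opprB addrA subrKA subrKA.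
  apply: le_lt_trans (ler_normD _ _) _.
  apply: (@lt_le_trans _ _ (e1 + (`|G (tx t x) - pderiv s (loc f i j) x| + e1))).
    apply: ltrD => //; apply: le_lt_trans (ler_normB _ _) _.
    by rewrite ltrD2l.
  by rewrite addrCA /e1 -splitr addrC subrK.
apply: filterS Kg => r Hr; split=> [x /Hr[]//|x /Hr[]//].
Qed.

End Coo_topology.

Lemma continuous_paste {R : realType} {T U : topologicalType} (a : T -> R) (f g : T -> U) :
  continuous a -> continuous f -> continuous g -> (forall z, a z = 0 -> f z = g z) ->
  continuous (fun z => if a z <= 0 then f z else g z).
Proof.
move=> ca cf cg fg z V Vz.
suff : nbhs z [set y | V (if a y <= 0 then f y else g y)] by [].
have [az|az|az] := ltgtP (a z) 0; rewrite /= ?leNgt ?az ?ltxx /= in Vz.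
- have fz : nbhs z [set y | V (f y)] by apply: cf; move: Vz; rewrite ltNge ltW.
  have az' : nbhs z [set y | a y < 0].
    by apply: (ca z [set x | x < 0]); apply: open_nbhs_nbhs; split=> //; exact: open_lt.
  by apply: filterS (filterI fz az') => y [Vy /= ay] /=; rewrite ltW.
- have gz : nbhs z [set y | V (g y)] by exact: cg.
  have az' : nbhs z [set y | 0 < a y].
    by apply: (ca z [set x | 0 < x]); apply: open_nbhs_nbhs; split=> //; exact: open_gt.
  by apply: filterS (filterI gz az') => y [Vy /= ay] /=; rewrite leNgt ay.
- have fz : nbhs z [set y | V (f y)] by exact: cf.
  have gz : nbhs z [set y | V (g y)] by apply: cg; rewrite -fg.
  by apply: filterS (filterI fz gz) => y [fy gy] /=; case: ifP.
Qed.

Section clamp.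
Context {R : realType}.

(** The retraction onto [[0, 1]], which extends maps continuous within the square to maps continuous
    everywhere. *)
Definition clamp (x : R) : R := Num.max 0 (Num.min x 1).

Lemma clamp01 x : 0 <= clamp x <= 1.
Proof. by rewrite /clamp le_max lexx /= ge_max ler01 ge_min lexx orbT. Qed.

Lemma clamp_id x : 0 <= x <= 1 -> clamp x = x.
Proof. by move=> /andP[x0 x1]; rewrite /clamp min_l // max_r. Qed.

Lemma clamp0 : clamp 0 = 0.
Proof. by rewrite clamp_id // lexx ler01. Qed.

Lemma clamp1 : clamp 1 = 1.
Proof. by rewrite clamp_id // ler01 lexx. Qed.

Lemma clamp_cts : continuous clamp.
Proof.
move=> x; apply: (@continuous_max R R (fun=> 0) (fun x => Num.min x 1)); first exact: cvg_cst.
by apply: (@continuous_min R R id (fun=> 1)); [exact: cvg_id|exact: cvg_cst].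
Qed.

End clamp.

(** * Winding of loops of strict contactomorphisms *)

Section loops.
Context {R : realType} {k : nat} {M : topologicalType}.
Variables (A : smooth_atlas R k.*2.+1 M) (eta : one_form A) (xi : vector_field A).
Variable psi : R -> M -> M.
Hypothesis closed_connected_M : closed_connected M.
Hypothesis contact_eta : contact k eta.
Hypothesis reeb_xi : is_reeb eta xi.
Hypothesis flow_psi : is_flow xi psi.
Variable N : R.
Hypothesis N_gt0 : 0 < N.
Hypothesis psiN : forall p, psi N p = p.
Implicit Types (f g h : R -> diff_str eta) (m : nat).

Let psi0 := flow0 flow_psi.
Let psiD := flowD flow_psi.
Let psi_cts := flow_cts flow_psi.

Definition ev (g : diff_str eta) : M -> M := set_val g.

Lemma ev_flow (a : diff_str eta) t p : ev a (psi t p) = psi t (ev a p).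
Proof.
have [_ hM _ _ _] := closed_connected_M.
apply: (strict_commutes contact_eta reeb_xi flow_psi hM).
  by rewrite /ev; case: (set_val a).
by have := valP a; rewrite inE.
Qed.

Lemma flow_str_subproof t : Diffeo (flow_is_diffeo flow_psi t) \in diff_str eta.
Proof. by rewrite inE => i j x v; exact: (flow_preserves_form reeb_xi flow_psi). Qed.

Definition flow_str t : diff_str eta :=
  exist _ (Diffeo (flow_is_diffeo flow_psi t)) (flow_str_subproof t).

Lemma flow_str_cts : continuous flow_str.
Proof. apply: continuous_comp_initial; exact: flow_Coo_continuous. Qed.

Lemma flow_str_id t : (forall p, psi t p = p) -> flow_str t = id_str eta.
Proof.
move=> tp; apply/val_inj => /=.
have E : psi t = id by apply/funext.
by move: (flow_is_diffeo flow_psi t); rewrite E => H; congr Diffeo; exact: Prop_irrelevance.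
Qed.

Lemma psi_nat m p : psi (m%:R * N) p = p.
Proof. by apply: flow_mulr => //; exact: psiN. Qed.

Definition reeb_loop m (t : R) : diff_str eta := flow_str (m%:R * t * N).

Lemma reeb_loopP m : is_loop (id_str eta) (reeb_loop m).
Proof.
split.
- apply: continuous_subspaceT => t.
  apply: (@continuous_comp _ _ _ (fun t : R => m%:R * t * N) flow_str); last exact: flow_str_cts.
  by apply: continuousM; [apply: continuousM; [exact: cvg_cst|exact: cvg_id]|exact: cvg_cst].
- by apply: flow_str_id => p; rewrite mulr0 mul0r psi0.
- by apply: flow_str_id => p; rewrite mulr1 psi_nat.
Qed.

(* Families of maps that are only jointly continuous and commute with the flow. *)
Definition weak_homotopy (K : R -> R -> M -> M) (f g : R -> M -> M) : Prop :=
  [/\ continuous (fun z : R * R * M => K z.1.1 z.1.2 z.2),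
      forall x y t p, K x y (psi t p) = psi t (K x y p),
      forall x p, 0 <= x <= 1 -> K x 0 p = f x p /\ K x 1 p = g x p &
      forall y p, 0 <= y <= 1 -> K 0 y p = p /\ K 1 y p = p].

(** The last clause is for gluing: [continuous_paste] asks for agreement at all [x], also outside
    [[0, 1]]. *)
Lemma homotopic_weak f g : homotopic (id_str eta) f g ->
  exists K, weak_homotopy K (fun x => ev (f x)) (fun x => ev (g x)) /\
    forall x y p, K x y p = K (clamp x) y p.
Proof.
move=> [H [/subspace_continuousP cH bH]].
exists (fun x y => ev (H (clamp x, clamp y))); split; last first.
  by move=> x y p; rewrite (clamp_id (clamp01 x)).
split.
- have cc : continuous (fun z : R * R => H (clamp z.1, clamp z.2)).
    move=> z U Uz.
    have Az w : (`[0, 1] `*` `[0, 1])%classic (clamp w.1 : R, clamp w.2 : R).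
      by split; rewrite /= in_itv /= clamp01.
    have W : nbhs (clamp z.1, clamp z.2) [set w : R * R | (`[0, 1] `*` `[0, 1])%classic w -> U (H w)].
      exact: cH _ (Az z) _ Uz.
    have ccl : {for z, continuous (fun z : R * R => (clamp z.1, clamp z.2))}.
      by apply: for_continuous_pair; (apply: (@continuous_comp _ _ _ _ clamp);
        [by [exact: cvg_fst|exact: cvg_snd]|exact: clamp_cts]).
    suff : nbhs z [set w : R * R | U (H (clamp w.1, clamp w.2))] by [].
    have W' : nbhs z [set w : R * R | (`[0, 1] `*` `[0, 1])%classic (clamp w.1, clamp w.2) ->
        U (H (clamp w.1, clamp w.2))] := ccl _ W.
    by apply: filterS W' => w /=; apply; exact: Az.
  move=> z.
  apply: (@continuous_comp _ _ _ (fun z : R * R * M => (set_val (H (clamp z.1.1, clamp z.1.2)), z.2))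
    (fun z : diffeo A * M => z.1 z.2)); last exact: eval_continuous.
  apply: for_continuous_pair; last exact: cvg_snd.
  apply: (@continuous_comp _ _ _ (fun z : R * R * M => H (clamp z.1.1, clamp z.1.2)) set_val); last exact: initial_continuous.
  apply: (@continuous_comp _ _ _ fst (fun z : R * R => H (clamp z.1, clamp z.2))); first exact: cvg_fst.
  exact: cc.
- by move=> x y t p; rewrite ev_flow.
- move=> x p x01; rewrite clamp0 clamp1 (clamp_id x01).
  by have [-> -> _ _] := bH x x01.
- move=> y p y01; rewrite clamp0 clamp1 (clamp_id y01).
  by have [_ _ -> ->] := bH y y01.
Qed.

Lemma cont_fam {T : topologicalType} (K : R -> R -> M -> M) (a b : T -> R) (c : T -> M) :
  continuous (fun z : R * R * M => K z.1.1 z.1.2 z.2) -> continuous a -> continuous b ->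
  continuous c -> continuous (fun z => K (a z) (b z) (c z)).
Proof.
move=> cK ca cb cc z.
apply: (@continuous_comp _ _ _ (fun z => ((a z, b z), c z)) (fun z : R * R * M => K z.1.1 z.1.2 z.2)); last exact: cK.
apply: for_continuous_pair; last exact: cc.
by apply: for_continuous_pair; [exact: ca|exact: cb].
Qed.

Lemma cont_psi {T : topologicalType} (a : T -> R) (c : T -> M) :
  continuous a -> continuous c -> continuous (fun z => psi (a z) (c z)).
Proof. by move=> ca cc z; apply: (flow_continuous2 flow_psi); [exact: ca|exact: cc]. Qed.

Let coordx : continuous (fun z : R * R * M => z.1.1).
Proof. by move=> z; apply: (@continuous_comp _ _ _ fst fst); exact: cvg_fst. Qed.

Let coordy : continuous (fun z : R * R * M => z.1.2).
Proof. by move=> z; apply: (@continuous_comp _ _ _ fst snd); [exact: cvg_fst|exact: cvg_snd]. Qed.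

Let coordp : continuous (fun z : R * R * M => z.2).
Proof. by move=> z; exact: cvg_snd. Qed.

Lemma cont_affine {T : topologicalType} (a : T -> R) (u v : R) : continuous a ->
  continuous (fun z => u * a z + v).
Proof.
move=> ca z; apply: (@cvgD _ _ _ (nbhs z)); last exact: cvg_cst.
by apply: cvgM; [exact: cvg_cst|exact: ca].
Qed.

Lemma cont_clamp {T : topologicalType} (a : T -> R) : continuous a ->
  continuous (fun z => clamp (a z)).
Proof. by move=> ca z; apply: (@continuous_comp _ _ _ a clamp); [exact: ca|exact: clamp_cts]. Qed.

Definition winds m (f : R -> M -> M) : Prop :=
  exists K, weak_homotopy K (fun x => psi (m%:R * x * N)) f.

Lemma winds_homotopic m f g : winds m (fun x => ev (f x)) -> homotopic (id_str eta) f g ->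
  winds m (fun x => ev (g x)).
Proof.
move=> [K [cK fK bK sK]] /homotopic_weak[W [[cW fW bW sW] Wc]].
exists (fun x y p => if 2 * y + -1 <= 0 then K (clamp x) (2 * y + 0) p else W x (2 * y + -1) p).
split.
- apply: (continuous_paste (a := fun z : R * R * M => 2 * z.1.2 + -1)
    (f := fun z => K (clamp z.1.1) (2 * z.1.2 + 0) z.2) (g := fun z => W z.1.1 (2 * z.1.2 + -1) z.2)).
  + exact: cont_affine.
  + by apply: cont_fam => //; [exact: cont_clamp|exact: cont_affine].
  + by apply: cont_fam => //; exact: cont_affine.
  + move=> [[x y] p] /= y2; rewrite y2 Wc.
    have -> : 2 * y + 0 = 1 by lra.
    have cx := clamp01 x.
    by have [_ ->] := bK _ p cx; have [-> _] := bW _ p cx.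
- by move=> x y t p; case: ifP => _; [exact: fK|exact: fW].
- move=> x p x01; rewrite mulr0 add0r oppr_le0 ler01 addr0 clamp_id //.
  split; first by have [] := bK x p x01.
  rewrite mulr1 ifF; last by apply/negbTE; rewrite -ltNge; lra.
  by have [_] := bW x p x01; rewrite (_ : 2 + -1 = 1) //; lra.
- move=> y p /andP[y0 y1]; rewrite clamp0 clamp1.
  case: ifP => [y2|/negbT]; last rewrite -ltNge => y2.
    by apply: sK; apply/andP; split; lra.
  by apply: sW; apply/andP; split; lra.
Qed.

Lemma winds_concat m f g : winds 1 (fun x => ev (f x)) -> winds m (fun x => ev (g x)) ->
  winds m.+1 (fun x => ev (loop_concat f g x)).
Proof.
move=> [K [cK fK bK sK]] [W [cW fW bW sW]].
(* These shifts even out the speed: at [y = 0] they turn the total times [2 x N] and [m (2 x - 1) N]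
   of the two halves into [(m + 1) x N] and [(m + 1) x N - N]. They vanish at [y = 1] and at both
   ends, and agree at [x = 1 / 2]. *)
pose tau1 (x y : R) := (m%:R - 1) * N * x * (1 - clamp y).
pose tau2 (x y : R) := (m%:R - 1) * N * (1 - x) * (1 - clamp y).
exists (fun x y p => if 2 * x + -1 <= 0 then K (2 * x + 0) (clamp y) (psi (tau1 x y) p)
  else W (2 * x + -1) (clamp y) (psi (tau2 x y) p)).
have ct (a : R * R * M -> R) : continuous a -> continuous (fun z => a z * (1 - clamp z.1.2)).
  move=> ca z; apply: (@cvgM _ _ (nbhs z)); first exact: ca.
  by apply: (@cvgB _ _ _ (nbhs z)); [exact: cvg_cst|exact: (cont_clamp coordy)].
split.
- apply: (continuous_paste (a := fun z : R * R * M => 2 * z.1.1 + -1)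
    (f := fun z => K (2 * z.1.1 + 0) (clamp z.1.2) (psi (tau1 z.1.1 z.1.2) z.2))
    (g := fun z => W (2 * z.1.1 + -1) (clamp z.1.2) (psi (tau2 z.1.1 z.1.2) z.2))).
  + exact: cont_affine.
  + apply: cont_fam => //; [exact: cont_affine|exact: cont_clamp|apply: cont_psi => //].
    by apply: ct => z; apply: (@cvgM _ _ (nbhs z)); [exact: cvg_cst|exact: coordx].
  + apply: cont_fam => //; [exact: cont_affine|exact: cont_clamp|apply: cont_psi => //].
    apply: ct => z; apply: (@cvgM _ _ (nbhs z)); first exact: cvg_cst.
    by apply: (@cvgB _ _ _ (nbhs z)); [exact: cvg_cst|exact: coordx].
  + move=> [[x y] p] /= x2; rewrite x2.
    have -> : 2 * x + 0 = 1 by lra.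
    have cy := clamp01 y.
    have [_ ->] := sK _ (psi (tau1 x y) p) cy; have [-> _] := sW _ (psi (tau2 x y) p) cy.
    have xx : 1 - x = x by lra.
    by rewrite /tau1 /tau2 xx.
- move=> x y t p; rewrite -!psiD !(addrC _ t) !psiD.
  by case: ifP => _; [exact: fK|exact: fW].
- move=> x p /andP[x0 x1]; rewrite /tau1 /tau2 clamp0 clamp1 subrr subr0 !mulr0 !mulr1 psi0.
  rewrite /loop_concat.
  case: ifP => [x2|/negbT]; last rewrite -ltNge => x2.
    have x01 : 0 <= 2 * x + 0 <= 1 by apply/andP; split; lra.
    have -> : x <= 2^-1 by lra.
    have [-> _] := bK _ (psi ((m%:R - 1) * N * x) p) x01; have [_ ->] := bK _ p x01.
    by rewrite addr0 -psiD -natr1; split=> //; congr psi; ring.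
  have x01 : 0 <= 2 * x + -1 <= 1 by apply/andP; split; lra.
  have -> : (x <= 2^-1) = false by apply/negbTE; rewrite -ltNge; lra.
  have [-> _] := bW _ (psi ((m%:R - 1) * N * (1 - x)) p) x01; have [_ ->] := bW _ p x01.
  split=> //; rewrite -psiD -natr1 -[in RHS](flow_opp_fix psi0 psiD (psiN p)) -psiD.
  by congr psi; ring.
- move=> y p y01; rewrite /tau1 /tau2 (clamp_id y01) !mulr0 mul0r add0r lerN10 subrr mulr0 mul0r psi0.
  have -> : (2 * 1 + -1 <= 0 :> R) = false by apply/negbTE; rewrite -ltNge; lra.
  split; first by rewrite add0r; have [] := sK _ p y01.
  rewrite (_ : 2 * 1 + -1 = 1 :> R); last by lra.
  by have [] := sW _ p y01.
Qed.

Lemma winds_const : winds 0 (fun=> ev (id_str eta)).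
Proof.
exists (fun _ _ p => p); split=> //.
by move=> x p _; rewrite !mul0r psi0.
Qed.

Lemma winds_id m : (0 < m)%N -> ~ winds m (fun=> ev (id_str eta)).
Proof.
move=> m0 [K [cK fK bK sK]]; have [[p0 _] hM _ cM _] := closed_connected_M.
have [e0 e00 nsp] := no_small_period reeb_xi flow_psi cM.
have [l l0 lP] := period_denominator psi0 psiD psi_cts hM N_gt0 psiN e00 nsp.
apply: (no_null_homotopy psi0 psiD psi_cts hM cM N_gt0 psiN lP l0 m0 cK fK) p0.
- by move=> x p x01; have [] := bK x p x01.
- by move=> x p x01; have [] := bK x p x01.
- by move=> y p y01; have [] := sK y p y01.
- by move=> y p y01; have [] := sK y p y01.
Qed.

Lemma homotopic_refl f : is_loop (id_str eta) f -> homotopic (id_str eta) f f.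
Proof.
move=> [/subspace_continuousP cf f0 f1]; exists (fun z => f (clamp z.1)); split.
  apply: continuous_subspaceT => z.
  apply: (@continuous_comp _ _ _ fst (fun x => f (clamp x))); first exact: cvg_fst.
  move=> U Ux; have W := cf _ _ _ Ux.
  have W' : nbhs (clamp z.1) [set x : R | (`[0, 1])%classic x -> U (f x)].
    by apply: W; rewrite /= in_itv /= clamp01.
  suff : nbhs z.1 [set x : R | U (f (clamp x))] by [].
  have W2 : nbhs z.1 [set x : R | (`[0, 1])%classic (clamp x) -> U (f (clamp x))] := clamp_cts W'.
  by apply: filterS W2 => x /=; apply; rewrite in_itv /= clamp01.
by move=> t t01 /=; rewrite clamp0 clamp1 clamp_id.
Qed.

Lemma reeb_loop_class_inj m1 m2 : (m1 < m2)%N ->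
  loop_class (id_str eta) (reeb_loop m1) <> loop_class (id_str eta) (reeb_loop m2).
Proof.
move=> m12 E.
have : loop_class (id_str eta) (reeb_loop m1) (reeb_loop m1).
  by split; [exact: reeb_loopP|exact/homotopic_refl/reeb_loopP].
rewrite E => -[_ /homotopic_weak[W [[cW fW bW sW] _]]].
have m0 : (0 < m2 - m1)%N by rewrite subn_gt0.
(* Composition with [psi (- m1 x N)] turns a homotopy between the two loops into a null-homotopy of
   the loop of multiplicity [m2 - m1]. *)
apply: (winds_id m0); exists (fun x y p => W x y (psi (- (m1%:R * N) * x + 0) p)); split.
- apply: cont_fam => //; apply: cont_psi => //; exact: cont_affine.
- by move=> x y t p; rewrite -psiD (addrC _ t) psiD fW.
- move=> x p x01; have [-> _] := bW x (psi (- (m1%:R * N) * x + 0) p) x01.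
  have [_ ->] := bW x (psi (- (m1%:R * N) * x + 0) p) x01.
  rewrite /ev /= -!psiD natrB; last exact: ltnW.
  by split; [congr psi; ring|rewrite -[RHS]psi0; congr psi; ring].
- move=> y p y01; rewrite mulr0 mulr1 !addr0 psi0.
  have [-> _] := sW y p y01; have [_ ->] := sW y (psi (- (m1%:R * N)) p) y01.
  by split=> //; apply: flow_opp_fix => //; exact: psi_nat.
Qed.

Lemma pi1_infinite : infinite_set (@pi1 R (diff_str eta) (id_str eta)).
Proof.
pose F m := loop_class (id_str eta) (reeb_loop m).
have FI : injective F.
  move=> m1 m2 E; case: (ltngtP m1 m2) => // H; first by case: (reeb_loop_class_inj H).
  by case: (reeb_loop_class_inj H); rewrite -/(F m1) E.
have sub : range F `<=` @pi1 R (diff_str eta) (id_str eta).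
  by move=> _ [m _ <-]; exists (reeb_loop m) => //; exact: reeb_loopP.
move=> /(sub_finite_set sub); apply/infiniteP.
have /card_eqPle[] // : (range F #= [set: nat])%card.
by apply: inj_card_eq => m1 m2 _ _; exact: FI.
Qed.

Variable c : R -> diff_str eta.
Hypothesis reeb_c : is_reeb_loop psi N c.

Lemma winds_reeb_loop : winds 1 (fun x => ev (c x)).
Proof.
have [_ cE] := reeb_c; exists (fun x _ p => psi (N * x + 0) p); split.
- by apply: cont_psi => //; exact: cont_affine.
- by move=> x _ t p; rewrite -!psiD addrC.
- by move=> x p _; rewrite mul1r addr0 /ev cE mulrC.
- by move=> y p _; rewrite mulr0 mulr1 !addr0 psi0 psiN.
Qed.

Lemma winds_pow m h : pi1_pow (id_str eta) (loop_class (id_str eta) c) m h ->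
  winds m (fun x => ev (h x)).
Proof.
elim: m h => [|m IH] h /=; first by move=> [_ H]; exact: winds_homotopic winds_const H.
move=> [_ [f [g [[_ cf] gm fgh]]]].
apply: winds_homotopic fgh; apply: winds_concat; last exact: IH.
exact: winds_homotopic winds_reeb_loop cf.
Qed.

(** If the power were trivial, the constant loop would belong to it and would wind [m] times,
    against [winds_id]. *)
Lemma reeb_infinite_order : infinite_order (id_str eta) (loop_class (id_str eta) c).
Proof.
move=> m m0 E; apply: (winds_id m0); apply: (winds_pow (h := fun=> id_str eta)).
rewrite E; have lp : is_loop (id_str eta) (fun=> id_str eta).
  by split=> //; apply: continuous_subspaceT; exact: cst_continuous.
by split=> //; exact: homotopic_refl.
Qed.

End loops.

Theorem theorem4p1 (R : realType) (k : nat) (M : topologicalType)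
    (A : smooth_atlas R k.*2.+1 M) (eta : one_form A)
    (xi : vector_field A) (psi : R -> M -> M)
    (closed_connected_M : closed_connected M)
    (contact_eta : contact k eta)
    (reeb_xi : is_reeb eta xi)
    (flow_psi : is_flow xi psi)
    (regular_psi : regular psi) :
  infinite_set (@pi1 R (diff_str eta) (id_str eta)) /\
  (exists N : R, 0 < N /\ forall p, psi N p = p) /\
  (forall N : R, 0 < N -> (forall p, psi N p = p) ->
    exists c : R -> diff_str eta,
      is_reeb_loop psi N c /\
      infinite_order (id_str eta) (loop_class (id_str eta) c)).
Proof.
have [N [N0 psiN]] := common_period closed_connected_M reeb_xi flow_psi regular_psi.
split.
  exact: (pi1_infinite closed_connected_M contact_eta reeb_xi flow_psi N0 psiN).
split; first by exists N.
(* The last claim concerns every period [N], so the one found above is discarded. *)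
move=> {N0 psiN}N N0 psiN; exists (reeb_loop reeb_xi flow_psi N 1).
have reeb_c : is_reeb_loop psi N (reeb_loop reeb_xi flow_psi N 1).
  split; first exact: reeb_loopP.
  by move=> t; rewrite /= mul1r mulrC.
split=> //.
exact: (reeb_infinite_order closed_connected_M contact_eta reeb_xi flow_psi N0 psiN).
Qed.
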